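(* Let $0<\nu\le1$ and $\delta\in(0,1)$. There exist an integer $n_0(\nu,\delta)$ and a constant $L(\delta,\nu)>0$, depending only on $\nu$ and $\delta$, such that the following holds. Suppose that $p\ge n/2$, consider the collection $\mathcal{M}_{\lfloor n/2\rfloor}$, and assume that $$pen(m)=(1-\nu)\frac{d_m}{n-d_m}\qquad\text{for every } m\in\mathcal{M}_{\lfloor n/2\rfloor}.$$ Then for all $n\ge n_0(\nu,\delta)$, $$\mathbb{P}_\theta\Big[d_{\widehat m}\ge\frac n4\Big]\ge1-\delta\qquad\text{and}\qquad \mathbb{E}\big[l(\widetilde\theta,\theta)\big]\ge l(\theta_{m_{\lfloor n/2\rfloor}},\theta)+L(\delta,\nu)\sigma^2 .$$
   Context: Model: $Y=X\theta+\epsilon$, where $\theta\in\mathbb{R}^p$ is arbitrary, the row vector $X=(X_i)_{1\le i\le p}$ is a zero mean Gaussian vector with nonsingular covariance matrix $\Sigma$, and $\epsilon$ is a zero mean Gaussian variable with variance $\sigma^2>0$, independent of $X$. One observes $n$ i.i.d. replications of $(Y,X)$: $\mathbf{Y}\in\mathbb{R}^n$ is the vector of observations of $Y$ and $\mathbf{X}$ the $n\times p$ matrix of observations of $X$; $\mathbb{P}_\theta$ is the corresponding probability. $\|z\|_n^2=\frac1n\sum_{i=1}^n z_i^2$ for $z\in\mathbb{R}^n$. The loss is $l(\theta_1,\theta_2):=\mathbb{E}[(X\theta_1-X\theta_2)^2]$. A model $m$ is a subset of $\{1,\dots,p\}$, $d_m$ its cardinality, $S_m$ the set of vectors of $\mathbb{R}^p$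 whose components outside $m$ are zero. $\theta_m$ is the unique minimizer of $\theta'\mapsto\mathbb{E}[(Y-X\theta')^2]$ over $S_m$; for $d_m<n$, $\widehat\theta_m$ is the a.s. unique minimizer of $\|\mathbf{Y}-\mathbf{X}\theta'\|_n^2$ over $S_m$. Put $m_0=\emptyset$, $m_i=\{1,\dots,i\}$ and $\mathcal{M}_i=\{m_0,\dots,m_i\}$. Given a collection $\mathcal{M}$ and a penalty $pen$, $\widehat m\in\arg\min_{m\in\mathcal{M}}\|\mathbf{Y}-\mathbf{X}\widehat\theta_m\|_n^2[1+pen(m)]$ and $\widetilde\theta:=\widehat\theta_{\widehat m}$. *)

(* Defs.v *)
From HB Require Import structures.
From mathcomp Require Import all_boot all_order all_algebra.
From mathcomp Require Import all_classical all_reals all_analysis.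

Set Implicit Arguments.
Unset Strict Implicit.
Unset Printing Implicit Defensive.

Import Order.TTheory GRing.Theory Num.Theory.
Import numFieldNormedType.Exports.

Local Open Scope classical_set_scope.
Local Open Scope ring_scope.

Definition is_argmin {d : Order.disp_t} {V : porderType d} {U : Type}
    (D : set U) (f : U -> V) (x : U) : Prop :=
  D x /\ forall y, D y -> (f x <= f y)%O.

Section probability.
Context {d : measure_display} {T : measurableType d} {R : realType}.
Variable P : probability T R.

Definition equal_in_law {d1} {U : measurableType d1} (Z1 Z2 : T -> U) : Prop :=
  forall A : set U, measurable A -> pushforward P Z1 A = pushforward P Z2 A.

Definition independent2 {d1 d2} {U1 : measurableType d1}
    {U2 : measurableType d2} (Z1 : T -> U1) (Z2 : T -> U2) : Prop :=
  forall (A : set U1) (B : set U2), measurable A -> measurable B ->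
    P (Z1 @^-1` A `&` Z2 @^-1` B) = (P (Z1 @^-1` A) * P (Z2 @^-1` B))%E.

(* The product rule for subfamilies of I is the case where some A i are setT. *)
Definition mutually_independent {I : finType} {d1} {U : measurableType d1}
    (Z : I -> T -> U) : Prop :=
  forall A : I -> set U, (forall i, measurable (A i)) ->
    P (\bigcap_i (Z i @^-1` A i)) = (\prod_(i : I) P (Z i @^-1` A i))%E.

(* normal_prob takes the standard deviation, and its value at standard
   deviation 0 is not the point mass; v is the variance. *)
Definition gaussian_law (m v : R) : set R -> \bar R :=
  if v == 0 then \d_m else normal_prob m (Num.sqrt v).

Definition is_gaussian (Z : T -> R) (m v : R) : Prop :=
  forall A : set R, measurable A -> pushforward P Z A = gaussian_law m v A.

End probability.

(* Tuples carry the product sigma-algebra, row vectors carry none. *)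
Definition rowv {R : realType} {p : nat} (x : p.-tuple R) : 'rV[R]_p :=
  \row_j tnth x j.

(* The product X theta, for a row vector X. *)
Definition dotp {R : realType} {p : nat} (x : p.-tuple R) (a : 'cV[R]_p) : R :=
  (rowv x *m a) 0 0.

Section gaussian_regression.
Context {d : measure_display} {T : measurableType d} {R : realType}.
Variable P : probability T R.
Context {p : nat}.

Definition gaussian_vector (X : T -> p.-tuple R) : Prop :=
  forall a : 'cV[R]_p, exists m v : R,
    0 <= v /\ is_gaussian P (fun w => dotp (X w) a) m v.

Definition zero_mean (X : T -> p.-tuple R) : Prop :=
  forall j : 'I_p, 'E_P[fun w => tnth (X w) j]%E = 0%E.

Definition has_covariance (X : T -> p.-tuple R) (Sigma : 'M[R]_p) : Prop :=
  forall i j : 'I_p,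
    covariance P (fun w => tnth (X w) i) (fun w => tnth (X w) j)
    = (Sigma i j)%:E.

Definition response (X : T -> p.-tuple R) (eps : T -> R) (theta : 'cV[R]_p)
    (w : T) : R := dotp (X w) theta + eps w.

Definition loss (X : T -> p.-tuple R) (theta1 theta2 : 'cV[R]_p) : \bar R :=
  'E_P[fun w => ((dotp (X w) theta1 - dotp (X w) theta2) ^+ 2)%R]%E.

Definition pred_risk (Y : T -> R) (X : T -> p.-tuple R) (theta' : 'cV[R]_p) :
    \bar R :=
  'E_P[fun w => ((Y w - dotp (X w) theta') ^+ 2)%R]%E.

Definition iid_replications {n : nat} (Y : T -> R) (X : T -> p.-tuple R)
    (bY : 'I_n -> T -> R) (bX : 'I_n -> T -> p.-tuple R) : Prop :=
  (forall i, equal_in_law P (fun w => (bY i w, bX i w)) (fun w => (Y w, X w)))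
  /\ mutually_independent P (fun i w => (bY i w, bX i w)).

Definition obs_response {n : nat} (bY : 'I_n -> T -> R) (w : T) : 'cV[R]_n :=
  \col_i bY i w.

Definition obs_design {n : nat} (bX : 'I_n -> T -> p.-tuple R) (w : T) :
    'M[R]_(n, p) :=
  \matrix_(i, j) tnth (bX i w) j.

End gaussian_regression.

Definition sqnorm_n {R : realType} {n : nat} (z : 'cV[R]_n) : R :=
  n%:R^-1 * \sum_(i < n) z i 0 ^+ 2.

Definition emp_risk {R : realType} {n p : nat} (y : 'cV[R]_n) (x : 'M[R]_(n, p))
    (theta' : 'cV[R]_p) : R :=
  sqnorm_n (y - x *m theta').

Definition model_space (R : realType) {p : nat} (m : {set 'I_p}) :
    set 'cV[R]_p :=
  [set theta : 'cV[R]_p | forall j, j \notin m -> theta j 0 = 0].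
Arguments model_space R {p} m.

(* The index j : 'I_p stands for the coordinate j + 1 of {1, ..., p}. *)
Definition nested_model (p i : nat) : {set 'I_p} :=
  [set j : 'I_p | (j < i)%N]%SET.

Definition nested_collection (p i : nat) : {set {set 'I_p}} :=
  [set nested_model p k | k : 'I_i.+1]%SET.

(* Main.v *)
(* With the coordinates of X orthonormalized along 1, ..., p by Gram-Schmidt for
   Sigma, the scores X c_j and eps / sigma are standardized and independent.
   The residual Y - X theta_{m_k} is then a combination of the scores j >= k and
   of the noise, with variance s_k ^ 2, and it is independent of the first k
   scores. Hence the residual sum of squares on m_k is xi^T M xi for an
   independent noise vector xi and a projection M of rank n - k, and a
   second-moment bound makes it concentrate at (n - k) s_k ^ 2.

   Dimension: on a grid of finitely many k, whose size depends on nu and delta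
   only, all these concentrations hold simultaneously with high probability, and
   the residual sum of squares is nonincreasing in k. Since s_k is nonincreasing,
   the criterion at m_N, with N = n / 2, is roughly
   (n - N) s_N ^ 2 (1 + (1 - nu) N / (n - N)) = (n - nu N) s_N ^ 2, less than
   its value (n - nu k) s_k ^ 2 at every k < n / 4.

   Loss: when n / 4 <= k is selected, the residual sum of squares is at
   most a fraction 1 - c nu of the squared norm of the noise xi of m_N. Writing D
   for the coordinates, in the scores j < N, of the error of the estimator, and
   u_j for the empirical products of score j with xi, this forces
   2 sum_j D_j u_j >= c nu n s_N ^ 2. As E[sum_j u_j ^ 2] = n N s_N ^ 2,
   Cauchy-Schwarz gives |D| ^ 2 >= c' nu ^ 2 s_N ^ 2 with positive probability;
   the loss is l(theta_{m_N}, theta) + |D| ^ 2, and s_N >= sigma. *)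

Require Import Defs.
From HB Require Import structures.
From mathcomp Require Import all_boot all_order all_algebra.
From mathcomp Require Import all_classical all_reals all_analysis.
From mathcomp Require Import measurable_realfun ring lra.

Set Implicit Arguments.
Unset Strict Implicit.
Unset Printing Implicit Defensive.

Import Order.TTheory GRing.Theory Num.Theory.
Import numFieldNormedType.Exports.

Local Open Scope classical_set_scope.
Local Open Scope ring_scope.

(** [gaussian_vector] only says that each linear form of X is Gaussian, with some mean and variance.
    The independence of the scores therefore has to be derived from their covariances: the
    expectation of the cosine of every linear combination is computed, and a uniqueness argument
    turns these integrals into the product rule. Stein's identity supplies the Gaussian moments and
    cosine integrals. The deviation bounds are Chebyshev bounds. A centred quadratic form has
    variance of order s_k^4 times the squared Frobenius norm of its matrix, which is at most n for a
    projection, so a deviation of size eta n s_k^2 has probability of order 1/(eta^2 n). The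
    variance cancels, hence n_0 and L do not depend on p, Sigma, theta or sigma. A bound of order
    1/n cannot be summed over n/2 models, which is why the grid must have bounded size. Relative
    errors nu/40 and grid gaps of at most nu n/50 fit into the margin between the factor 1 - nu/4 of
    the criterion at k = n/4 and its factor of about 1 - nu/2 at N. *)

Lemma measurable_preimage d d' (T : measurableType d) (U : measurableType d')
    (f : T -> U) (B : set U) :
  measurable_fun [set: T] f -> measurable B -> measurable (f @^-1` B).
Proof. by move=> mf mB; rewrite -[_ @^-1` _]setTI; exact: mf. Qed.

Lemma measurable_eq_cst d (T : measurableType d) (R : realType) (f : T -> R) c :
  measurable_fun [set: T] f -> measurable [set w | f w = c].
Proof. by move=> mf; exact: (@measurable_preimage _ _ _ _ _ [set c]). Qed.

Lemma measurable_ge d (T : measurableType d) (R : realType) (f : T -> R) e :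
  measurable_fun [set: T] f -> measurable [set w | e <= f w].
Proof. by move=> mf; rewrite -[X in measurable X]setTI; exact: measurable_fun_le. Qed.

Lemma measurable_cos (R : realType) : measurable_fun [set: R] (@cos R).
Proof. by apply: continuous_measurable_fun; exact: continuous_cos. Qed.

Lemma measurable_sin (R : realType) : measurable_fun [set: R] (@sin R).
Proof. by apply: continuous_measurable_fun; exact: continuous_sin. Qed.

Lemma norm_cos_le1 (R : realType) (x : R) : `|cos x| <= 1.
Proof. by rewrite ler_norml cos_geN1 cos_le1. Qed.

Lemma norm_sin_le1 (R : realType) (x : R) : `|sin x| <= 1.
Proof. by rewrite ler_norml sin_geN1 sin_le1. Qed.

Lemma markov_ge0 d (T : measurableType d) (R : realType) (P : probability T R)
    (f : T -> R) (e b : R) : measurable_fun [set: T] f -> (forall w, 0 <= f w) ->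
  0 < e -> (\int[P]_w (f w)%:E <= b%:E)%E ->
  (P [set w | (e <= f w)%R] <= (b / e)%:E)%E.
Proof.
move=> mf f0 e0 fb; set A := [set w | _].
have mA : measurable A by exact: measurable_ge.
have mfE : measurable_fun [set: T] (EFin \o f) by exact/measurable_EFinP.
rewrite EFinM lee_pdivlMr// muleC.
apply: le_trans fb; rewrite -(integral_cst P mA e%:E).
apply: (@le_trans _ _ (\int[P]_(w in A) (f w)%:E)%E).
  apply: ge0_le_integral => //; first by move=> w _; rewrite lee_fin ltW.
  exact: measurable_funTS.
by apply: ge0_subset_integral => // w _; rewrite lee_fin.
Qed.

(** * Integrals against the normal law as integrals of the density *)

Section normal_density_integral.
Import HBNNSimple.
Context {R : realType}.
Implicit Types (m s x : R).
Local Notation mu := lebesgue_measure.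

(** On simple functions this is the definition of [normal_prob] applied to the level sets; monotone
    convergence extends it on both sides. *)
Lemma ge0_integral_normal_prob m s (f : R -> \bar R) :
  measurable_fun [set: R] f -> (forall x, 0 <= f x)%E ->
  (\int[normal_prob m s]_x f x = \int[mu]_x (f x * (normal_pdf m s x)%:E))%E.
Proof.
move=> mf f0; pose g := nnsfun_approx measurableT mf.
have gf x : limn (EFin \o g^~ x) = f x.
  by apply/cvg_lim => //; exact: cvg_nnsfun_approx.
have mpdf : measurable_fun [set: R] (fun x => (normal_pdf m s x)%:E).
  by apply/measurable_EFinP; exact: measurable_normal_pdf.
have mgE n : measurable_fun [set: R] (EFin \o g n).
  by apply/measurable_EFinP.
have ndg x : {homo (fun n => (g n x)%:E) : n k / (n <= k)%N >-> (n <= k)%E}.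
  by move=> n k nk; rewrite lee_fin; exact/lefP/nd_nnsfun_approx.
under eq_integral do rewrite -gf.
rewrite monotone_convergence//=; last by move=> n x _; rewrite lee_fin.
transitivity (limn (fun n =>
    \int[mu]_x ((g n x)%:E * (normal_pdf m s x)%:E)))%E.
  congr (limn _); apply/funext => n.
  have gk0 k x : (0 <= (k * \1_(g n @^-1` [set k]) x)%:E)%E.
    exact: nnfun_muleindic_ge0.
  have mgk k : measurable_fun [set: R] (fun x => (k * \1_(g n @^-1` [set k]) x)%:E).
    by apply/measurable_EFinP; exact: measurable_funM.
  under eq_integral do rewrite fimfunE -fsumEFin//.
  rewrite ge0_integral_fsum//.
  under [RHS]eq_integral do rewrite fimfunE -fsumEFin// ge0_mule_fsuml//.
  rewrite ge0_integral_fsum//; last 2 first.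
  - by move=> k; apply: emeasurable_funM; [exact: mgk | exact: mpdf].
  - by move=> k x _; rewrite mule_ge0// lee_fin normal_pdf_ge0.
  apply: eq_fsbigr => k _.
  have [k0|k0] := ltP k 0.
    rewrite preimage_nnfun0//.
    by rewrite !integral0_eq// => x _; rewrite indic0 mulr0 ?mul0e.
  under eq_integral do rewrite EFinM.
  under [RHS]eq_integral do rewrite EFinM -muleA.
  have mi : measurable_fun [set: R] (fun x => (\1_(g n @^-1` [set k]) x : R)%:E).
    by apply/measurable_EFinP.
  have mgk1 : measurable (g n @^-1` [set k]) by exact: measurable_sfunP.
  rewrite ge0_integralZl//.
  rewrite ge0_integralZl//; last 2 first.
  - by apply: emeasurable_funM; [exact: mi | exact: mpdf].
  - by move=> x _; rewrite mule_ge0// lee_fin normal_pdf_ge0.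
  congr (_ * _)%E.
  transitivity (normal_prob m s (g n @^-1` [set k] `&` setT)).
    exact: integral_indic.
  rewrite setIT /normal_prob [LHS]integral_mkcond.
  apply: eq_integral => x _; rewrite patchE indicE; case: ifPn => _.
    by rewrite mul1e.
  by rewrite mul0e.
have <- : (\int[mu]_x limn (fun n => (g n x)%:E * (normal_pdf m s x)%:E) =
           \int[mu]_x (f x * (normal_pdf m s x)%:E))%E.
  apply: eq_integral => x _; apply/cvg_lim => //.
  apply: cvgeZr => //.
  exact: cvg_nnsfun_approx.
rewrite monotone_convergence//.
- by move=> n; apply: emeasurable_funM; [exact: mgE|exact: mpdf].
- by move=> n x _; rewrite mule_ge0// lee_fin// normal_pdf_ge0.
- by move=> x _ n k nk; rewrite lee_wpmul2r ?lee_fin ?normal_pdf_ge0//; exact: ndg.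
Qed.

End normal_density_integral.

(** * Stein's identity *)

Section normal_stein.
Context {R : realType}.
Variables (m s : R).
Hypothesis s0 : 0 < s.
Local Notation mu := (@lebesgue_measure R).
Local Notation pdf := (normal_pdf m s).

(** With u = (x - m)^2 / (8 s^2) this is (1 + u)^2. It has degree four in x, so it dominates every
    power up to the fourth, and it is at most exp(2 u), so its product with the density stays below
    a multiple of the normal density of variance 2 s^2. *)
Definition normal_weight (x : R) : R := (1 + (x - m) ^+ 2 / (s ^+ 2 * 8)) ^+ 2.

Lemma normal_weight_ge1 x : 1 <= normal_weight x.
Proof.
rewrite /normal_weight -[leLHS](expr1n _ 2) lerXn2r ?nnegrE//.
  by rewrite addr_ge0// divr_ge0 ?sqr_ge0// mulr_ge0// sqr_ge0.
by rewrite lerDl divr_ge0 ?sqr_ge0// mulr_ge0// sqr_ge0.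
Qed.

Lemma normal_weight_fun x :
  normal_weight x * expR (- (x - m) ^+ 2 / (s ^+ 2 * 4)) <= 1.
Proof.
rewrite /normal_weight; set u := (x - m) ^+ 2 / _.
have u0 : 0 <= u by rewrite divr_ge0 ?sqr_ge0// mulr_ge0// sqr_ge0.
have -> : - (x - m) ^+ 2 / (s ^+ 2 * 4) = - (u *+ 2).
  by rewrite /u; field; rewrite gt_eqF.
rewrite expRN ler_pdivrMr ?expR_gt0// mul1r mulr2n expRD -expr2.
rewrite lerXn2r ?nnegrE ?expR_ge0//; first by rewrite addr_ge0.
exact: expR_ge1Dx.
Qed.

Let s2 : R := Num.sqrt 2 * s.

Let s2_gt0 : 0 < s2. Proof. by rewrite mulr_gt0// sqrtr_gt0. Qed.

Lemma normal_pdf_weight x : normal_weight x * pdf x <=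
  normal_peak s / normal_peak s2 * normal_pdf m s2 x.
Proof.
rewrite !normal_pdfE ?gt_eqF//= mulrA divfK; last first.
  by rewrite gt_eqF// normal_peak_gt0// gt_eqF.
rewrite mulrCA ler_wpM2l ?normal_peak_ge0//.
rewrite /normal_fun /s2 exprMn sqr_sqrtr//.
have -> : - (x - m) ^+ 2 / (s ^+ 2 *+ 2) =
   - (x - m) ^+ 2 / (s ^+ 2 * 4) + - (x - m) ^+ 2 / (s ^+ 2 * 4).
  by field; rewrite gt_eqF.
have -> : - (x - m) ^+ 2 / (2 * s ^+ 2 *+ 2) = - (x - m) ^+ 2 / (s ^+ 2 * 4).
  by field; rewrite gt_eqF.
rewrite expRD mulrA ler_piMl ?expR_ge0//.
exact: normal_weight_fun.
Qed.

Lemma integrable_normal_weight :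
  mu.-integrable setT (fun x => (normal_weight x * pdf x)%:E).
Proof.
have mw : measurable_fun [set: R] normal_weight.
  apply: measurable_funX; apply: measurable_funD => //.
  apply: measurable_funM => //.
  by apply: measurable_funX; exact: measurable_funB.
apply: le_integrable (integrableZl measurableT
   (normal_peak s / normal_peak s2) (integrable_normal_pdf m s2)) => //.
  by apply/measurable_EFinP/measurable_funM => //; exact: measurable_normal_pdf.
move=> x _ /=; rewrite lee_fin.
have w0 : 0 <= normal_weight x by exact: le_trans (normal_weight_ge1 x).
rewrite (ger0_norm (mulr_ge0 w0 (normal_pdf_ge0 _ _ _))).
apply: le_trans (ler_norm _); exact: normal_pdf_weight.
Qed.

Lemma integrable_normal_bounded (q : R -> R) (C : R) :
  measurable_fun [set: R] q -> (forall x, `|q x| <= C * normal_weight x) ->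
  mu.-integrable setT (fun x => (q x * pdf x)%:E).
Proof.
move=> mq qC.
apply: le_integrable (integrableZl measurableT C integrable_normal_weight) => //.
  by apply/measurable_EFinP/measurable_funM => //; exact: measurable_normal_pdf.
move=> x _ /=; rewrite lee_fin normrM mulrA [leRHS]normrM.
rewrite ler_wpM2r// (le_trans (qC x))// ler_norm//.
Qed.

Lemma is_derive_normal_pdf (x : R) :
  is_derive x 1 pdf (- (x - m) / s ^+ 2 * pdf x).
Proof.
rewrite !normal_pdfE ?gt_eqF//.
have dg : is_derive x (1 : R) (fun x => - (x - m) ^+ 2 / (s ^+ 2 *+ 2))
    (- (x - m) / s ^+ 2).
  apply: is_derive_eq.
  rewrite /GRing.scale/=; field. by rewrite gt_eqF.
have de : is_derive x (1 : R) (normal_fun m s)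
    ((- (x - m) / s ^+ 2) * normal_fun m s x).
  rewrite mulrC.
  exact: (@is_derive1_comp _ expR (fun x => - (x - m) ^+ 2 / (s ^+ 2 *+ 2))
    _ _ _ (is_derive_expR _) dg).
apply: is_derive_eq.
by rewrite /GRing.scale/=; ring.
Qed.

(** The condition on [e] means e = 1 or e = -1, which treats both ends of the line at once. *)
Lemma cvg_normal_pdf_tail (e : R) : e ^+ 2 = 1 ->
  normal_pdf m s2 (m + e * n%:R) @[n --> \oo] --> (0 : R).
Proof.
move=> e2.
rewrite normal_pdfE ?gt_eqF//= -(mulr0 (normal_peak s2)).
apply: cvgM; first exact: cvg_cst.
rewrite /normal_fun.
rewrite (_ : (fun _ => _) = (fun y => expR (- (y ^+ 2 / (s2 ^+ 2 *+ 2)))) \o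
  (fun n => n%:R)); last first.
  by apply/funext => n /=; rewrite addrAC subrr add0r exprMn e2 mul1r mulNr.
apply: cvg_comp; first exact: cvgr_idn.
apply: (@cvg_comp _ _ _ (fun y => y ^+ 2 / (s2 ^+ 2 *+ 2)) (fun y => expR (- y))).
  apply: gt0_cvgMly; first by rewrite invr_gt0 pmulrn_lgt0// exprn_gt0.
  exact: cvgr_expr2.
exact: cvgr_expR.
Qed.

(** The integrand is the derivative of q times the density. Its integral over a growing interval
    centred at m is a difference of boundary values, which vanish in the limit because the weight
    times the density has a Gaussian tail. *)
Lemma normal_stein (q dq : R -> R) (C : R) :
  (forall x : R, is_derive x 1 q (dq x)) -> continuous dq ->
  (forall x, `|q x| <= C * normal_weight x) ->
  (forall x, `|dq x| <= C * normal_weight x) ->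
  (forall x, `|q x * (x - m)| <= C * normal_weight x) ->
  (\int[mu]_x ((dq x - q x * (x - m) / s ^+ 2) * pdf x)%:E = 0)%E.
Proof.
move=> Dq cdq qC dqC qxC.
pose h x := dq x - q x * (x - m) / s ^+ 2.
have cq : continuous q.
  by move=> x; apply/differentiable_continuous/derivable1_diffP; case: (Dq x).
have ch : continuous h.
  move=> x; apply: cvgB; first exact: cdq.
  apply: cvgM; last exact: cvg_cst.
  apply: cvgM; first exact: cq.
  by apply: cvgB; [exact: cvg_id|exact: cvg_cst].
have mh : measurable_fun [set: R] h by exact: continuous_measurable_fun.
have hC x : `|h x| <= (C + C / s ^+ 2) * normal_weight x.
  rewrite (le_trans (ler_normB _ _))// mulrDl lerD//.
  rewrite normrM (ger0_norm (_ : 0 <= (s ^+ 2)^-1)) ?invr_ge0 ?sqr_ge0//.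
  by rewrite mulrAC ler_wpM2r ?invr_ge0 ?sqr_ge0.
have ih : mu.-integrable setT (fun x => (h x * pdf x)%:E).
  exact: integrable_normal_bounded hC.
pose F x := q x * pdf x.
have DF (x : R) : is_derive x 1 F (h x * pdf x).
  have := Dq x; have := is_derive_normal_pdf x => Dp Dqx.
  apply: is_derive_eq.
  by rewrite /GRing.scale/= /h; ring.
have cF : continuous F.
  by move=> x; apply/differentiable_continuous/derivable1_diffP; case: (DF x).
pose I n : set R := `[m - n%:R, m + n%:R]%classic.
(* The index [n.+1] keeps the interval nondegenerate, as the fundamental theorem of calculus asks
   for. *)
have IE n : (\int[mu]_x (((h x * pdf x)%:E) * (\1_(I n.+1) x)%:E) =
    (F (m + n.+1%:R) - F (m - n.+1%:R))%:E)%E.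
  rewrite EFinB -(@continuous_FTC2 _ (fun x => h x * pdf x) F).
  - rewrite [RHS]integral_mkcond; apply: eq_integral => x _.
    by rewrite epatch_indic.
  - by rewrite ltrD2l gtrN.
  - apply: continuous_subspaceT => x.
    by apply: cvgM; [exact: ch|exact: continuous_normal_pdf (lt0r_neq0 s0) _].
  - split.
    + by move=> x _; case: (DF x).
    + exact: cvg_at_right_filter (cF _).
    + exact: cvg_at_left_filter (cF _).
  - by move=> x _; rewrite derive1E; exact: derive_val.
have cvg1 : (F (m + n.+1%:R) - F (m - n.+1%:R))%:E @[n --> \oo] --> (0 : \bar R).
  apply: cvg_EFin; first exact: nearW.
  rewrite -[X in _ --> X](subr0 (0 : R)).
  have tail (e : R) : e ^+ 2 = 1 -> F (m + e * n.+1%:R) @[n --> \oo] --> (0 : R).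
    move=> e2; apply: norm_cvg0.
    rewrite (cvg_shiftS (fun n => `|F (m + e * n%:R)|)).
    have tl : C * (normal_peak s / normal_peak s2) *
        normal_pdf m s2 (m + e * n%:R) @[n --> \oo] --> (0 : R).
      rewrite -[X in _ --> X](mulr0 (C * (normal_peak s / normal_peak s2))).
      by apply: cvgM; [exact: cvg_cst|exact: cvg_normal_pdf_tail].
    apply: (squeeze_cvgr _ (@cvg_cst _ (0 : R) _ _ _) tl).
    apply: nearW => n; rewrite normr_ge0/= normrM.
    rewrite (ger0_norm (normal_pdf_ge0 _ _ _)).
    rewrite (le_trans (ler_wpM2r (normal_pdf_ge0 _ _ _) (qC _)))//.
    have C0 : 0 <= C.
      have := le_trans (normr_ge0 _) (qC 0).
      by rewrite pmulr_lge0// (lt_le_trans _ (normal_weight_ge1 _)).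
    have := ler_wpM2l C0 (normal_pdf_weight (m + e * n%:R)).
    by rewrite !mulrA.
  apply: cvgB; first by have := tail 1; under eq_fun do rewrite mul1r; apply; rewrite expr1n.
  by have := tail (-1); under eq_fun do rewrite mulN1r; apply; rewrite sqrrN expr1n.
have cvg2 : (\int[mu]_x (((h x * pdf x)%:E) * (\1_(I n.+1) x)%:E))%E @[n --> \oo] -->
    (\int[mu]_x (h x * pdf x)%:E)%E.
  apply: (@dominated_cvg _ _ R mu setT measurableT
    (fun n x => (h x * pdf x)%:E * (\1_(I n.+1) x)%:E)%E
    (fun x => (h x * pdf x)%:E) (fun x => `|(h x * pdf x)%:E|%E)) => //.
  - move=> n; apply: emeasurable_funM; first exact: (measurable_int mu).
    have mI : measurable (I n.+1) by exact: measurable_itv.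
    by apply/measurable_EFinP/measurable_indic.
  - move=> x _; apply: cvg_near_cst.
    near=> n; rewrite indicE mem_set ?mule1//= /I /= in_itv/=.
    rewrite -ler_distlC.
    have := archi_boundP (normr_ge0 (x - m)) => /ltW xb.
    rewrite distrC (le_trans xb)// ler_nat.
    near: n; exact: nbhs_infty_ge.
  - exact: integrable_abse.
  - move=> n x _; rewrite abseM -[leRHS]mule1 lee_wpmul2l//.
    by rewrite indicE; case: (_ \in _); rewrite ?abse1 ?abse0 //= lee_fin.
move: cvg2; under eq_fun do rewrite IE.
by move=> cvg2; exact: (cvg_unique _ cvg2 cvg1).
Unshelve. all: end_near. Qed.

End normal_stein.

(** * Moments and trigonometric integrals of the normal density *)

Section normal_moments.
Context {R : realType}.
Variables (m s : R).
Hypothesis s0 : 0 < s.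
Local Notation mu := (@lebesgue_measure R).
Local Notation pdf := (normal_pdf m s).
Local Notation weight := (normal_weight m s).

Let C : R := 1 + s ^+ 4 * 64.
Let C_ge1 : 1 <= C. Proof. by rewrite lerDl mulr_ge0// exprn_ge0// ltW. Qed.

Lemma normal_weight_ge4 x : (x - m) ^+ 4 <= s ^+ 4 * 64 * weight x.
Proof.
rewrite /normal_weight; set u := (x - m) ^+ 2 / (s ^+ 2 * 8).
have -> : (x - m) ^+ 4 = s ^+ 4 * 64 * u ^+ 2 by rewrite /u; field; rewrite gt_eqF.
rewrite ler_wpM2l ?mulr_ge0 ?exprn_ge0// ?(ltW s0)//.
have u0 : 0 <= u by rewrite divr_ge0 ?sqr_ge0// mulr_ge0// sqr_ge0.
by rewrite lerXn2r ?nnegrE ?addr_ge0// lerDr.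
Qed.

Lemma normal_weight_leX k x : (k <= 4)%N -> `|(x - m) ^+ k| <= C * weight x.
Proof.
move=> k4; rewrite normrX.
have w1 := normal_weight_ge1 m s x.
have w4 : `|x - m| ^+ 4 <= s ^+ 4 * 64 * weight x.
  have := normal_weight_ge4 x; rewrite -(ger0_norm (exprn_even_ge0 (x - m) _))//.
  by rewrite normrX.
apply: (@le_trans _ _ (1 + `|x - m| ^+ 4)); last first.
  by rewrite /C mulrDl mul1r lerD.
have [x1|x1] := leP `|x - m| 1.
  apply: (@le_trans _ _ 1); first by rewrite exprn_ile1.
  by rewrite lerDl exprn_ge0.
apply: (@le_trans _ _ (`|x - m| ^+ 4)); last by rewrite lerDr.
by apply: ler_weXn2l => //; exact: ltW.
Qed.

Lemma integrable_normal_exprn k : (k <= 4)%N ->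
  mu.-integrable setT (fun x => ((x - m) ^+ k * pdf x)%:E).
Proof.
move=> k4; apply: (integrable_normal_bounded s0 (C := C)).
  by apply: measurable_funX; exact: measurable_funB.
by move=> x; exact: normal_weight_leX.
Qed.

(** Stein's identity for the power k+1. Since (x - m) q(x) is then the power k+2, the bound on k
    keeps all terms within the degree four that the weight controls. *)
Lemma normal_moment_rec k : (k.+1 <= 3)%N ->
  (\int[mu]_x ((x - m) ^+ k.+2 * pdf x)%:E =
   (s ^+ 2 * k.+1%:R)%:E * \int[mu]_x ((x - m) ^+ k * pdf x)%:E)%E.
Proof.
move=> k3.
have Dq (x : R) : is_derive x (1 : R) (fun x => (x - m) ^+ k.+1)
    (k.+1%:R * (x - m) ^+ k).
  have -> : (fun x : R => (x - m) ^+ k.+1) = (fun x : R => x - m) ^+ k.+1.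
    by apply/funext => y; rewrite exprfctE.
  apply: is_derive_eq.
  by rewrite /GRing.scale/= oppr0 addr0 mulr1 mulr_natl.
have cX j : continuous (fun x : R => (x - m) ^+ j).
  move=> x; apply: (@continuous_comp _ _ _ (fun x => x - m) (fun x => x ^+ j)).
    by apply: cvgB; [exact: cvg_id|exact: cvg_cst].
  exact: exprn_continuous.
have CC : C <= C *+ 4.
  by have := C_ge1; lra.
have W x : C * weight x <= C *+ 4 * weight x.
  by rewrite ler_wpM2r// (le_trans _ (normal_weight_ge1 _ _ _)).
have st : (\int[mu]_x ((k.+1%:R * (x - m) ^+ k -
    (x - m) ^+ k.+1 * (x - m) / s ^+ 2) * pdf x)%:E = 0)%E.
  apply: (@normal_stein _ m s s0 _ _ (C *+ 4) Dq).
  - by move=> x; apply: cvgM; [exact: cvg_cst|exact: cX].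
  - by move=> x; rewrite (le_trans (normal_weight_leX _ _))// leqW.
  - move=> x; have -> : C *+ 4 * weight x = 4%:R * (C * weight x) by ring.
    rewrite normrM normr_nat.
    rewrite ler_pM ?ler_nat//; first exact: leqW.
    by apply: normal_weight_leX; rewrite ltnW// leqW.
  - by move=> x; rewrite -exprSr (le_trans (normal_weight_leX _ _)).
have ik : mu.-integrable setT (fun x => (k.+1%:R * ((x - m) ^+ k * pdf x))%:E).
  under eq_fun do rewrite EFinM.
  by apply: integrableZl => //; apply: integrable_normal_exprn; rewrite ltnW// ltnW.
have ik2 : mu.-integrable setT (fun x => ((s ^+ 2)^-1 * ((x - m) ^+ k.+2 * pdf x))%:E).
  under eq_fun do rewrite EFinM.
  by apply: integrableZl => //; apply: integrable_normal_exprn.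
have : (\int[mu]_x ((k.+1%:R * ((x - m) ^+ k * pdf x))%:E -
    ((s ^+ 2)^-1 * ((x - m) ^+ k.+2 * pdf x))%:E) = 0)%E.
  rewrite -st; apply: eq_integral => x _; rewrite -EFinB; congr (_%:E).
  by rewrite -exprSr; ring.
rewrite integralB//.
under eq_integral do rewrite EFinM.
rewrite integralZl//; last by apply: integrable_normal_exprn; rewrite ltnW// ltnW.
under [X in (_ - X)%E]eq_integral do rewrite EFinM.
rewrite integralZl//; last exact: integrable_normal_exprn.
rewrite -[X in (_ * X - _)%E]fineK ?integrable_fin_num//; last first.
  by apply: integrable_normal_exprn; rewrite ltnW// ltnW.
have fin2 := integrable_fin_num measurableT (@integrable_normal_exprn k.+2 k3).
rewrite -[X in (_ - _ * X)%E]fineK//.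
move=> [] /eqP; rewrite subr_eq0 => /eqP e.
rewrite -[LHS]fineK// -[X in (_ * X)%E]fineK ?integrable_fin_num//; last first.
  by apply: integrable_normal_exprn; rewrite ltnW// ltnW.
rewrite -EFinM -mulrA e mulrA divff ?mul1r//.
by rewrite expf_eq0/= gt_eqF.
Qed.

(** Stein's identity for the constant function 1. *)
Lemma normal_mean : (\int[mu]_x ((x - m) * pdf x)%:E = 0)%E.
Proof.
have D1 (x : R) : is_derive x (1 : R) (cst 1 : R -> R) 0.
  exact: is_derive_cst.
have w1 := normal_weight_ge1 m s.
have CW x : 1 <= C * weight x by rewrite -[leLHS]mulr1 ler_pM.
have st : (\int[mu]_x ((0 - cst 1 x * (x - m) / s ^+ 2) * pdf x)%:E = 0)%E.
  apply: (@normal_stein _ m s s0 _ _ C D1).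
  - by move=> x; exact: cvg_cst.
  - by move=> x; rewrite normr1.
  - by move=> x; rewrite normr0 (le_trans _ (CW x)).
  - by move=> x; rewrite mul1r -[x - m]expr1 normal_weight_leX.
have i1 : mu.-integrable setT (fun x => ((x - m) * pdf x)%:E).
  exact: (@integrable_normal_exprn 1).
move: st; under eq_integral => x _.
  rewrite (_ : _ * pdf x = - (s ^+ 2)^-1 * ((x - m) * pdf x)); last first.
    by rewrite /cst/=; ring.
  rewrite EFinM; over.
rewrite integralZl//.
move/eqP; rewrite mule_eq0 => /orP[|/eqP//].
by rewrite eqe oppr_eq0 invr_eq0 expf_eq0/= gt_eqF.
Qed.

Lemma normal_variance : (\int[mu]_x ((x - m) ^+ 2 * pdf x)%:E = (s ^+ 2)%:E)%E.
Proof.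
rewrite (@normal_moment_rec 0)// mulr1.
under eq_integral do rewrite expr0 mul1r.
by rewrite integral_normal_pdf mule1.
Qed.

Lemma normal_moment4 : (\int[mu]_x ((x - m) ^+ 4 * pdf x)%:E = (3 * s ^+ 4)%:E)%E.
Proof.
rewrite (@normal_moment_rec 2)// normal_variance -EFinM; congr (_%:E).
by ring.
Qed.

(* The integral [G t] solves [G' = - s ^+ 2 * t * G] by Stein's identity. *)
Lemma normal_trig (f g : R -> R) (t : R) :
  (forall x : R, is_derive x (1 : R) f (g x)) ->
  (forall x : R, is_derive x (1 : R) g (- f x)) ->
  (forall x, `|f x| <= 1) -> (forall x, `|g x| <= 1) ->
  \int[mu]_x (f (t * (x - m)) * pdf x) = f 0 * expR (- (s ^+ 2 * t ^+ 2 / 2)).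
Proof.
move=> Df Dg f1 g1.
have cf : continuous f.
  by move=> x; apply/differentiable_continuous/derivable1_diffP; case: (Df x).
have cg : continuous g.
  by move=> x; apply/differentiable_continuous/derivable1_diffP; case: (Dg x).
have clin (h : R -> R) u : continuous h -> continuous (fun x => h (u * (x - m))).
  move=> ch x; apply: (@continuous_comp _ _ _ (fun x => u * (x - m)) h); last exact: ch.
  apply: cvgM; first exact: cvg_cst.
  by apply: cvgB; [exact: cvg_id|exact: cvg_cst].
have Dlin (h dh : R -> R) u (x : R) : is_derive (u * (x - m)) (1 : R) h (dh (u * (x - m))) ->
    is_derive x (1 : R) (fun x => h (u * (x - m))) (u * dh (u * (x - m))).
  move=> Dh; rewrite mulrC.
  have Dl : is_derive x (1 : R) (fun x => u * (x - m)) u.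
    by apply: is_derive_eq; rewrite /GRing.scale/= oppr0 addr0 mulr1.
  exact: (@is_derive1_comp _ h (fun x => u * (x - m))).
have w1 := normal_weight_ge1 m s.
have CW x : 1 <= C * weight x by rewrite -[leLHS]mulr1 ler_pM.
pose G u := \int[mu]_x (f (u * (x - m)) * pdf x).
have iG (u : R) : mu.-integrable setT (EFin \o (fun x => f (u * (x - m)) * pdf x)).
  apply: (integrable_normal_bounded s0 (C := C)).
    by apply: continuous_measurable_fun; exact: clin.
  by move=> x; rewrite (le_trans (f1 _)).
have iXg (u : R) : mu.-integrable setT
    (fun x => ((x - m) * g (u * (x - m)) * pdf x)%:E).
  apply: (integrable_normal_bounded s0 (C := C)).
    apply: measurable_funM; first exact: measurable_funB.
    by apply: continuous_measurable_fun; exact: clin.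
  move=> x; rewrite normrM -[leRHS]mulr1 ler_pM//.
  by rewrite -[x - m]expr1 normal_weight_leX.
have iX : mu.-integrable setT (EFin \o (fun x => `|x - m| * pdf x)).
  apply: (integrable_normal_bounded s0 (C := C)).
    by apply: measurableT_comp => //; exact: measurable_funB.
  by move=> x; rewrite normr_id -[x - m]expr1 normal_weight_leX.
(* Differentiation under the integral, with majorant |x - m| times the density, produces the
   integral of (x - m) g(u (x - m)). Stein's identity for x -> g(u (x - m)) turns it into - s^2 u
   G(u). *)
have DG (u : R) : is_derive u (1 : R) G (- (s ^+ 2 * u) * G u).
  pose F (y : R) (x : R) := f (y * (x - m)) * pdf x.
  have DF (y x : R) : is_derive y (1 : R) (F ^~ x) ((x - m) * g (y * (x - m)) * pdf x).
    by apply: is_derive_eq; rewrite /GRing.scale/=; ring.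
  have dFE (y x : R) : partial1of2 F y x = (x - m) * g (y * (x - m)) * pdf x.
    by rewrite /partial1of2 derive1E; exact: derive_val.
  have Iu : `]u - 1, u + 1[%classic u by rewrite /= in_itv/= ltrBlDr ltrDl ltr01.
  have ub y x : `]u - 1, u + 1[%classic y -> [set: R] x ->
      `|partial1of2 F y x| <= `|x - m| * pdf x.
    move=> _ _; rewrite dFE !normrM (ger0_norm (normal_pdf_ge0 _ _ _)).
    by rewrite ler_wpM2r ?normal_pdf_ge0// ler_piMr.
  have X0 x : 0 <= `|x - m| * pdf x by rewrite mulr_ge0 ?normal_pdf_ge0.
  have dF1 y x : `]u - 1, u + 1[%classic y -> [set: R] x -> derivable (F ^~ x) y 1.
    by move=> _ _; case: (DF y x).
  have D1 := @derivable_under_integral _ _ _ mu F _ measurableT u (u - 1) (u + 1)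
    Iu (fun y _ => iG y) dF1 _ X0 iX ub.
  have D2 := @differentiation_under_integral _ _ _ mu F _ measurableT u (u - 1) (u + 1)
    Iu (fun y _ => iG y) dF1 _ X0 iX ub.
  apply: DeriveDef; first exact: D1.
  rewrite -derive1E [LHS]D2.
  under eq_Rintegral do rewrite dFE.
  have st : (\int[mu]_x ((- u * f (u * (x - m)) -
      g (u * (x - m)) * (x - m) / s ^+ 2) * pdf x)%:E = 0)%E.
    apply: (@normal_stein _ m s s0 (fun x => g (u * (x - m)))
      (fun x => - u * f (u * (x - m))) (C * (1 + `|u|))).
    - move=> x; rewrite mulNr -mulrN.
      exact: (@Dlin g (fun x => - f x) u x (Dg _)).
    - by move=> x; apply: cvgM; [exact: cvg_cst|exact: clin].
    - move=> x; rewrite (le_trans (g1 _))// mulrAC -[leLHS]mulr1.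
      by rewrite ler_pM// lerDl.
    - move=> x; rewrite normrM normrN mulrAC.
      rewrite (@le_trans _ _ (1 * (1 + `|u|)))//.
        rewrite mul1r (@le_trans _ _ (`|u| * 1)) ?ler_wpM2l//.
        by rewrite mulr1 lerDr.
      by rewrite ler_wpM2r// addr_ge0.
    - move=> x; rewrite normrM mulrAC.
      rewrite (@le_trans _ _ (1 * (C * weight x)))//.
        by rewrite ler_pM// -[x - m]expr1 normal_weight_leX.
      rewrite mul1r ler_peMr// ?lerDl//.
      by rewrite (le_trans _ (CW x)).
  rewrite /Rintegral in D1 D2 *.
  have i1 : mu.-integrable setT (fun x => (- u * (f (u * (x - m)) * pdf x))%:E).
    exact: (integrableZl measurableT (- u) (iG u)).
  have i2 : mu.-integrable setT
      (fun x => ((s ^+ 2)^-1 * ((x - m) * g (u * (x - m)) * pdf x))%:E).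
    exact: (integrableZl measurableT (s ^+ 2)^-1 (iXg u)).
  have : (\int[mu]_x ((- u * (f (u * (x - m)) * pdf x))%:E -
     ((s ^+ 2)^-1 * ((x - m) * g (u * (x - m)) * pdf x))%:E) = 0)%E.
    by rewrite -st; apply: eq_integral => x _; rewrite -EFinB; congr (_%:E); ring.
  rewrite integralB//.
  under eq_integral do rewrite EFinM.
  rewrite integralZl//; last exact: iG.
  under [X in (_ - X)%E]eq_integral do rewrite EFinM.
  rewrite integralZl//.
  rewrite -[X in (_ * X - _)%E]fineK ?(integrable_fin_num measurableT (iG u))//.
  rewrite -[X in (_ - _ * X)%E]fineK ?integrable_fin_num//.
  rewrite /G /Rintegral; set a := fine _; set b := fine _.
  rewrite -EFinM -EFinM -EFinB => -[] /eqP; rewrite subr_eq0 => /eqP e.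
  have -> : - (s ^+ 2 * u) * a = s ^+ 2 * (- u * a) by ring.
  by rewrite e mulrA mulfV ?mul1r// expf_eq0/= gt_eqF.
(* Solving the differential equation: G times the inverse of the expected exponential has derivative
   zero, hence equals G 0. *)
pose H u := G u * expR (s ^+ 2 * u ^+ 2 / 2).
have DH (u : R) : is_derive u (1 : R) H 0.
  have De : is_derive u (1 : R) (fun u => expR (s ^+ 2 * u ^+ 2 / 2))
      (expR (s ^+ 2 * u ^+ 2 / 2) * (s ^+ 2 * u)).
    have Dl : is_derive u (1 : R) (fun u => s ^+ 2 * u ^+ 2 / 2) (s ^+ 2 * u).
      by apply: is_derive_eq; rewrite /GRing.scale/=; field.
    exact: (@is_derive1_comp _ expR (fun u => s ^+ 2 * u ^+ 2 / 2)).
  by apply: is_derive_eq; rewrite /GRing.scale/=; ring.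
have HE := is_derive_0_is_cst t 0 DH.
have G0 : G 0 = f 0.
  rewrite /G; under eq_Rintegral do rewrite mul0r.
  rewrite RintegralZl//; last exact: integrable_normal_pdf.
  by rewrite /Rintegral integral_normal_pdf mulr1.
move: HE; rewrite /H G0 expr0n mulr0 mul0r expR0 mulr1 => <-.
by rewrite -/(G t) expRN mulfK// gt_eqF// expR_gt0.
Qed.

End normal_moments.

(** * Change of variables under a law *)

Section law_integral.
Context d d' (T : measurableType d) (U : measurableType d') (R : realType).
Variables (P : {measure set T -> \bar R}) (V : T -> U).
Hypothesis mV : measurable_fun [set: T] V.
Variable nu : {measure set U -> \bar R}.
Hypothesis lawV : forall A, measurable A -> pushforward P V A = nu A.
Local Open Scope ereal_scope.

Lemma ge0_law_integral (f : U -> \bar R) : measurable_fun [set: U] f ->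
  (forall x, 0 <= f x) -> \int[P]_w f (V w) = \int[nu]_x f x.
Proof.
move=> mf f0; transitivity (\int[pushforward P V]_x f x).
  by rewrite ge0_integral_pushforward// => x _.
by apply: eq_measure_integral => A mA _; exact: lawV.
Qed.

Lemma law_integral (f : U -> \bar R) : measurable_fun [set: U] f ->
  \int[P]_w f (V w) = \int[nu]_x f x.
Proof.
move=> mf; rewrite integralE [RHS]integralE; congr (_ - _).
  rewrite -ge0_law_integral//; last exact: measurable_funepos.
  by apply: eq_integral => x _; rewrite !funeposE.
rewrite -ge0_law_integral//; last exact: measurable_funeneg.
by apply: eq_integral => x _; rewrite !funenegE.
Qed.

Lemma law_integrable (f : U -> \bar R) : measurable_fun [set: U] f ->
  nu.-integrable setT f -> P.-integrable setT (fun w => f (V w)).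
Proof.
move=> mf /integrableP[_ fy]; apply/integrableP; split.
  exact: measurableT_comp.
rewrite (ge0_law_integral (f := fun x => `|f x|))//.
exact: measurableT_comp.
Qed.

End law_integral.

Section normal_prob_integral.
Context {R : realType}.
Variables (m s : R).
Local Notation mu := (@lebesgue_measure R).

Lemma integral_normal_prob (f : R -> R) : measurable_fun [set: R] f ->
  (\int[normal_prob m s]_x (f x)%:E =
   \int[mu]_x (f x * normal_pdf m s x)%:E)%E.
Proof.
move=> mf; have mfE : measurable_fun [set: R] (EFin \o f) by exact/measurable_EFinP.
rewrite integralE [RHS]integralE; congr (_ - _)%E.
  rewrite ge0_integral_normal_prob//; last exact: measurable_funepos.
  apply: eq_integral => x _; rewrite !funeposE EFinM.
  have p0 := normal_pdf_ge0 m s x.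
  by rewrite maxe_pMl ?lee_fin ?mul0e.
rewrite ge0_integral_normal_prob//; last exact: measurable_funeneg.
apply: eq_integral => x _; rewrite !funenegE EFinM.
have p0 := normal_pdf_ge0 m s x.
by rewrite -muleN1 -[in RHS]muleN1 muleAC maxe_pMl ?lee_fin ?mul0e.
Qed.

Lemma integrable_normal_prob (f : R -> R) : measurable_fun [set: R] f ->
  mu.-integrable setT (fun x => (f x * normal_pdf m s x)%:E) ->
  (normal_prob m s).-integrable setT (EFin \o f).
Proof.
move=> mf /integrableP[_ fy]; apply/integrableP; split; first exact/measurable_EFinP.
rewrite (@integral_normal_prob (fun x => `|f x|)); last exact: measurableT_comp.
move: fy; under eq_integral do rewrite abse_EFin normrM (ger0_norm (normal_pdf_ge0 _ _ _)).
by [].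
Qed.

End normal_prob_integral.

(** * Moments and cosine integrals of a Gaussian variable *)

Section gaussian_moments.
Context d (T : measurableType d) (R : realType) (P : probability T R).
Variables (V : T -> R) (m v : R).
Hypothesis mV : measurable_fun [set: T] V.
Hypothesis v0 : 0 <= v.
Hypothesis gV : is_gaussian P V m v.

Let Nm : {measure set (measurableTypeR R) -> \bar R} := normal_prob m (Num.sqrt v).

Let law_dirac : v = 0 -> forall A, measurable A -> pushforward P V A = \d_m A.
Proof. by move=> vE A mA; rewrite gV// /gaussian_law vE eqxx. Qed.

Let law_normal : v != 0 -> forall A, measurable A ->
  pushforward P V A = Nm A.
Proof. by move=> vE A mA; rewrite gV// /gaussian_law (negbTE vE). Qed.

Let sv : v != 0 -> 0 < Num.sqrt v.
Proof. by move=> v1; rewrite sqrtr_gt0 lt0r v1. Qed.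

Let mV' : measurable_fun [set: T] (V : T -> measurableTypeR R).
Proof. exact: mV. Qed.

Let Dm : {measure set (measurableTypeR R) -> \bar R} := \d_(m : measurableTypeR R).

Let mX k : measurable_fun [set: R] (fun x => (x - m) ^+ k).
Proof. by apply: measurable_funX; exact: measurable_funB. Qed.

(** The law is a point mass at m when v = 0 and has a density otherwise, so every integral is
    computed in these two cases. *)
Let gaussian_integral (f : R -> R) c : measurable_fun [set: R] f ->
  (v = 0 -> f m = c) ->
  (v != 0 -> (\int[lebesgue_measure]_x (f x * normal_pdf m (Num.sqrt v) x)%:E = c%:E)%E) ->
  (\int[P]_w (f (V w))%:E = c%:E)%E.
Proof.
move=> mf c1 c2; have mfE : measurable_fun [set: R] (EFin \o f) by exact/measurable_EFinP.
have [vE|vE] := eqVneq v 0.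
  rewrite (law_integral mV' (nu := Dm) (law_dirac vE) mfE) integral_dirac//.
  by rewrite /= diracT mul1e c1.
by rewrite (law_integral mV' (nu := Nm) (law_normal vE) mfE) integral_normal_prob// c2.
Qed.

Lemma gaussian_integrable_exprn k : (k <= 4)%N ->
  P.-integrable setT (fun w => ((V w - m) ^+ k)%:E).
Proof.
move=> k4; have mfE : measurable_fun [set: R] (fun x => ((x - m) ^+ k)%:E).
  by apply/measurable_EFinP; exact: mX.
have [vE|vE] := eqVneq v 0.
  apply: (law_integrable mV' (nu := Dm) (law_dirac vE) mfE).
  apply/integrableP; split => //; rewrite integral_dirac//; last exact: measurableT_comp.
  by rewrite diracT mul1e /= ltry.
apply: (law_integrable mV' (nu := Nm) (law_normal vE) mfE).
apply: integrable_normal_prob => //; apply: integrable_normal_exprn => //; exact: sv.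
Qed.

Lemma gaussian_mean : (\int[P]_w (V w - m)%:E = 0)%E.
Proof.
apply: (@gaussian_integral (fun x => x - m)).
- exact: measurable_funB.
- by move=> _; rewrite subrr.
- by move=> vE; rewrite normal_mean ?sv.
Qed.

Lemma gaussian_variance : (\int[P]_w ((V w - m) ^+ 2)%:E = v%:E)%E.
Proof.
apply: (@gaussian_integral (fun x => (x - m) ^+ 2)) => //.
- by move=> ->; rewrite subrr expr0n.
- by move=> vE; rewrite normal_variance ?sv// sqr_sqrtr.
Qed.

Lemma gaussian_moment4 : (\int[P]_w ((V w - m) ^+ 4)%:E = (3 * v ^+ 2)%:E)%E.
Proof.
apply: (@gaussian_integral (fun x => (x - m) ^+ 4)) => //.
- by move=> ->; rewrite subrr !expr0n mulr0.
- by move=> vE; rewrite normal_moment4 ?sv// (exprM _ 2 2) sqr_sqrtr.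
Qed.

(** The phase [phi] covers sines as well, and cos(x + phi), - sin(x + phi) form a pair of the kind
    that [normal_trig] asks for. *)
Lemma gaussian_cos t phi :
  (\int[P]_w (cos (t * (V w - m) + phi))%:E =
   (cos phi * expR (- (v * t ^+ 2 / 2)))%:E)%E.
Proof.
pose f (x : R) := cos (x + phi); pose g (x : R) := - sin (x + phi).
have Df (x : R) : is_derive x (1 : R) f (g x).
  by apply: is_derive_eq; rewrite /GRing.scale/= addr0 mulr1.
have Dg (x : R) : is_derive x (1 : R) g (- f x).
  by apply: is_derive_eq; rewrite /GRing.scale/= addr0 mulr1.
have f1 x : `|f x| <= 1 by exact: norm_cos_le1.
have g1 x : `|g x| <= 1 by rewrite normrN norm_sin_le1.
have mf : measurable_fun [set: R] (fun x => f (t * (x - m))).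
  apply: (measurableT_comp (@measurable_cos R) (_ : measurable_fun _ (fun x => _ + phi))).
  by apply: measurable_funD => //; apply: measurable_funM => //; exact: measurable_funB.
apply: (@gaussian_integral (fun x => f (t * (x - m)))) => //.
- by move=> ->; rewrite /f subrr mulr0 add0r !mul0r oppr0 expR0 mulr1.
- move=> vE; have := normal_trig m (sv vE) t Df Dg f1 g1.
  rewrite sqr_sqrtr// {2}/f add0r => <-; rewrite /Rintegral fineK//.
  apply: integrable_fin_num => //.
  apply: (integrable_normal_bounded (sv vE) (C := 1)) => // x.
  by rewrite mul1r (le_trans (f1 _))// normal_weight_ge1.
Qed.

Lemma gaussian_atomless x : v != 0 -> P (V @^-1` [set x]) = 0%E.
Proof.
move=> vE; have := law_normal vE (measurable_set1 x).
rewrite /pushforward => ->.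
have /null_content_dominatesP := normal_prob_dominates m (Num.sqrt v).
by move=> H; apply: H; [exact: measurable_set1|exact: lebesgue_measure_set1].
Qed.

End gaussian_moments.

(** * Normal laws concentrating at a point *)

Section normal_tail.
Context {R : realType}.
Implicit Types m r b : R.

Lemma is_gaussian_normal_prob m s : 0 < s ->
  is_gaussian (normal_prob m s : probability (measurableTypeR R) R)
    (id : measurableTypeR R -> R) m (s ^+ 2).
Proof.
move=> s0 A mA; rewrite /gaussian_law expf_eq0/= gt_eqF//.
by rewrite sqrtr_sqr gtr0_norm.
Qed.

Lemma normal_prob_chebyshev m r b (A : set R) : 0 < r -> measurable A ->
  m != b -> (forall x, A x -> `|b - m| <= `|x - m|) ->
  (normal_prob m r A <= (r ^+ 2 / (b - m) ^+ 2)%:E)%E.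
Proof.
move=> r0 mA mb Ab.
have mid : measurable_fun [set: measurableTypeR R] (id : measurableTypeR R -> R).
  exact: measurable_id.
have gv := gaussian_variance mid (sqr_ge0 r) (is_gaussian_normal_prob m r0).
have bm : 0 < (b - m) ^+ 2 by rewrite exprn_even_gt0//= subr_eq0 eq_sym.
have mq : measurable_fun [set: measurableTypeR R] (fun x : R => (x - m) ^+ 2).
  by apply: measurable_funX; exact: measurable_funB.
apply: le_trans (markov_ge0 mq (fun x => sqr_ge0 _) bm (_ : _ <= (r ^+ 2)%:E)%E); last by rewrite -gv.
apply: le_measure; rewrite ?inE//; first exact: measurable_ge.
move=> x /Ab h /=; rewrite -(real_normK (num_real (b - m))).
by rewrite -(real_normK (num_real (x - m))) lerXn2r ?nnegrE.
Qed.

(** By Chebyshev's inequality the law with standard deviation 1/(n+1) tends to the point mass at m.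
    The end point b = m is excluded, since half of the mass stays on each side there. *)
Lemma cvg_normal_prob_ray m b : m != b ->
  normal_prob m n.+1%:R^-1 `]-oo, b]%classic @[n --> \oo] -->
  ((m < b)%R%:R%:E : \bar R).
Proof.
move=> mb.
have c0 : (0 : R)%:E = 0%E by [].
have cvgr : ((n.+1%:R^-1 ^+ 2 / (b - m) ^+ 2)%:E : \bar R) @[n --> \oo] --> 0%E.
  rewrite -c0; apply: cvg_EFin; first exact: nearW.
  rewrite /comp/= -(mul0r ((b - m) ^+ 2)^-1).
  apply: cvgM; last exact: cvg_cst.
  have -> : (0 : R) = 0 ^+ 2 by rewrite expr0n.
  apply: (@cvg_comp _ _ _ (fun n => n.+1%:R^-1) (fun x => x ^+ 2)).
    exact: cvg_harmonic.
  exact: exprn_continuous.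
have [mltb|mltb] := ltP m b.
  have -> : (fun n => normal_prob m n.+1%:R^-1 `]-oo, b]%classic) =
      (fun n => 1 - normal_prob m n.+1%:R^-1 (~` `]-oo, b]%classic))%E.
    apply/funext => n; rewrite probability_setC//.
    by rewrite oppeB ?fin_num_adde_defr// addeA subee// add0e.
  rewrite -[X in _ --> X](sube0 (1%:E)).
  apply: cvgeB => //; first exact: cvg_cst.
  apply: (squeeze_cvge _ (cvg_cst 0%E) cvgr).
  apply: nearW => n; rewrite measure_ge0/=.
  apply: normal_prob_chebyshev => //; first exact: measurableC.
  move=> x; rewrite setCitvl/= in_itv/= andbT => bx.
  rewrite !ger0_norm ?subr_ge0 ?lerB ?(ltW bx) ?(ltW mltb)//.
  by rewrite (le_trans (ltW mltb))// ltW.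
apply: (squeeze_cvge _ (cvg_cst 0%E) cvgr).
apply: nearW => n; rewrite measure_ge0/=.
apply: normal_prob_chebyshev => // x /=; rewrite in_itv/= => xb.
by rewrite ler0_norm ?subr_le0// ler0_norm ?subr_le0 ?(le_trans xb)// !opprB lerB.
Qed.

End normal_tail.

Lemma integral_cst_probability d' (U : measurableType d') (R : realType)
    (Q : probability U R) (c : R) : (\int[Q]_w cst c%:E w = c%:E)%E.
Proof. by rewrite integral_cst// [X in (_ * X)%E](@probability_setT _ _ _ Q) mule1. Qed.

Lemma integrable_norm_le d' (U : measurableType d') (R : realType)
    (Q : probability U R)
    (f : U -> R) (C : R) :
  measurable_fun [set: U] f -> (forall w, `|f w| <= C) ->
  Q.-integrable setT (fun w => (f w)%:E).
Proof.
move=> mf fC; apply/integrableP; split; first exact/measurable_EFinP.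
apply: (@le_lt_trans _ _ (\int[Q]_w cst C%:E w)%E).
  apply: ge0_le_integral => //.
  - by apply/measurable_EFinP; exact: measurableT_comp.
  - by move=> w _; rewrite lee_fin.
by rewrite integral_cst_probability ltry.
Qed.

Lemma norm_indic_le1 (U : Type) (R : realType) (A : set U) x :
  `|\1_A x : R| <= 1.
Proof. by rewrite indicE; case: (_ \in A); rewrite ?normr1 ?normr0. Qed.

(** * Cosine integrals determine the integrals over events of a variable *)

Section trig_uniqueness.
Context d (T : measurableType d) (R : realType) (P : probability T R).
Variables (V W : T -> R) (K : R).
Hypothesis mV : measurable_fun [set: T] V.
Hypothesis mW : measurable_fun [set: T] W.
Hypothesis WK : forall w, `|W w| <= K.
Hypothesis cosW : forall a phi : R, (\int[P]_w (W w * cos (a * V w + phi))%:E = 0)%E.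
Local Notation mu := (@lebesgue_measure R).


Let mcos := @measurable_cos R.
Let norm_cos := @norm_cos_le1 R.

Let WM (f : T -> R) w : `|f w| <= 1 -> `|W w * f w| <= K.
Proof. by move=> f1; rewrite normrM -[leRHS]mulr1 ler_pM. Qed.


Let cos_shift (a y : R) : (\int[P]_w (W w * cos (a * (V w - y)))%:E = 0)%E.
Proof. by rewrite -(cosW a (- (a * y))); apply: eq_integral => w _; rewrite mulrBr. Qed.

(* Averaging [cos (a * (V - y))] over a Gaussian frequency [a] yields a Gaussian bump. *)
Let bump (r y : R) : 0 < r -> (\int[P]_w (W w * normal_pdf (V w) r y)%:E = 0)%E.
Proof.
(* A frequency of standard deviation 1/r averages cos(a (V - y)) to exp(-(V - y)^2 / (2 r^2)), which
   is the density of standard deviation r up to its peak value. *)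
move=> r0; pose s := r^-1; have s0 : 0 < s by rewrite invr_gt0.
pose N : probability (measurableTypeR R) R := normal_prob 0 s.
pose F (z : T * measurableTypeR R) := (W z.1 * cos (z.2 * (V z.1 - y)))%:E.
have mF : measurable_fun [set: T * measurableTypeR R] F.
  apply/measurable_EFinP; apply: measurable_funM.
    exact: measurableT_comp.
  apply: measurableT_comp => //; apply: measurable_funM => //.
  by apply: measurable_funB => //; exact: measurableT_comp.
have iF : (P \x N)%E.-integrable setT F.
  apply/integrable12ltyP => //.
  apply: (@le_lt_trans _ _ (\int[P]_w cst K%:E w)%E); last first.
    by rewrite integral_cst_probability ltry.
  apply: ge0_le_integral => //.
  - by move=> w _; exact: integral_ge0.
  - apply: (@measurable_fun_fubini_tonelli_F _ _ _ _ _ N (abse \o F)) => //.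
      exact: measurableT_comp.
    by move=> z /=.
  - move=> w _; apply: (@le_trans _ _ (\int[N]_x cst K%:E x)%E).
      apply: ge0_le_integral => //.
      + by apply: measurableT_comp => //; exact: (measurable_comp measurableT _ mF (measurable_pair1 w)).
      + by move=> x _; rewrite lee_fin; exact: (@WM (fun w => cos (x * (V w - y)))).
    by rewrite integral_cst_probability.
have := Fubini iF.
rewrite [RHS]integral0_eq; last by move=> a _; exact: cos_shift.
have mid : measurable_fun [set: measurableTypeR R] (id : measurableTypeR R -> R).
  exact: measurable_id.
under eq_integral => w _.
  under eq_integral do rewrite /F/= EFinM.
  rewrite integralZl//; last first.
    apply: (@integrable_norm_le _ _ _ N _ 1) => //.
    by apply: measurableT_comp => //; exact: measurable_funM.
  have gc := gaussian_cos mid (sqr_ge0 s) (is_gaussian_normal_prob 0 s0) (V w - y) 0.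
  rewrite cos0 mul1r in gc.
  have -> : (\int[N]_x (cos (x * (V w - y)))%:E =
      (expR (- (s ^+ 2 * (V w - y) ^+ 2 / 2)))%:E)%E.
    by rewrite -gc; apply: eq_integral => x _; rewrite [x - 0]subr0 addr0 mulrC.
  over.
move=> E0.
transitivity (\int[P]_w ((normal_peak r)%:E *
   ((W w)%:E * (expR (- (s ^+ 2 * (V w - y) ^+ 2 / 2)))%:E)))%E.
  apply: eq_integral => w _; rewrite -!EFinM; congr (_%:E).
  rewrite normal_pdfE ?gt_eqF//= mulrCA; congr (_ * (_ * _)).
  rewrite /normal_fun /s; congr expR; field.
  by rewrite gt_eqF.
rewrite integralZl//; first by rewrite E0 mule0.
apply: (@integrable_norm_le _ _ _ P (fun w => W w * expR (- (s ^+ 2 * (V w - y) ^+ 2 / 2))) K).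
  apply: measurable_funM => //; apply: measurableT_comp => //.
  apply: measurableT_comp => //; apply: measurable_funM => //; apply: measurable_funM => //.
  by apply: measurable_funX; exact: measurable_funB.
move=> w; apply: (@WM (fun w => expR (- (s ^+ 2 * (V w - y) ^+ 2 / 2)))).
rewrite ger0_norm ?expR_ge0// -expR0 ler_expR oppr_le0.
by rewrite divr_ge0// mulr_ge0// sqr_ge0.
Qed.

Let mpdf r : 0 < r ->
  measurable_fun [set: T * R] (fun z => normal_pdf (V z.1) r z.2).
Proof.
move=> r0; rewrite (_ : (fun z => _) = (fun z : T * R => normal_peak r *
    expR (- (z.2 - V z.1) ^+ 2 / (r ^+ 2 *+ 2)))); last first.
  by apply/funext => z; rewrite normal_pdfE ?gt_eqF.
apply: measurable_funM => //; apply: measurableT_comp => //.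
apply: measurable_funM => //; apply: measurableT_comp => //.
apply: measurable_funX; apply: measurable_funB => //.
by apply: measurableT_comp => //; exact: measurable_fst.
Qed.

(** The probability of the ray under the normal law at V is the integral over y <= b of the bumps
    centred at y, since the density is integrated in y with mean V. Fubini exchanges this integral
    with the one over P, and each bump contributes zero. *)
Let smoothed_ray (r b : R) : 0 < r ->
  (\int[P]_w ((W w)%:E * normal_prob (V w) r `]-oo, b]%classic) = 0)%E.
Proof.
move=> r0.
pose F (z : T * measurableTypeR R) :=
  (W z.1 * (normal_pdf (V z.1) r z.2 * \1_(`]-oo, b]%classic : set R) z.2))%:E.
have mF : measurable_fun [set: T * measurableTypeR R] F.
  apply/measurable_EFinP; apply: measurable_funM.
    by apply: measurableT_comp => //; exact: measurable_fst.
  apply: measurable_funM; first exact: mpdf.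
  by apply: measurableT_comp => //; exact: measurable_snd.
have normF w y : (`|F (w, y)| <= `|W w|%:E * (normal_pdf (V w) r y)%:E)%E.
  rewrite -EFinM lee_fin normrM ler_wpM2l//= normrM.
  rewrite (ger0_norm (normal_pdf_ge0 _ _ _)) ler_piMr ?normal_pdf_ge0//.
  exact: norm_indic_le1.
have mpdfw w : measurable_fun [set: measurableTypeR R]
    (fun y => (normal_pdf (V w) r y)%:E).
  by apply/measurable_EFinP; exact: measurable_normal_pdf.
have iF : (P \x mu)%E.-integrable setT F.
  apply/integrable12ltyP => //.
  apply: (@le_lt_trans _ _ (\int[P]_w cst K%:E w)%E); last first.
    by rewrite integral_cst_probability ltry.
  apply: ge0_le_integral => //.
  - by move=> w _; exact: integral_ge0.
  - apply: (@measurable_fun_fubini_tonelli_F _ _ _ _ _ mu (abse \o F)) => //.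
      exact: measurableT_comp.
    by move=> z /=.
  - move=> w _.
    apply: (@le_trans _ _ (\int[mu]_y (`|W w|%:E * (normal_pdf (V w) r y)%:E))%E).
      apply: ge0_le_integral => //.
      + by apply: measurableT_comp => //; exact: (measurable_comp measurableT _ mF (measurable_pair1 w)).
      + by apply: measurable_funeM; exact: mpdfw.
    rewrite ge0_integralZl//; last by move=> y _; rewrite lee_fin normal_pdf_ge0.
    by rewrite integral_normal_pdf mule1 lee_fin.
have := Fubini iF.
rewrite [RHS]integral0_eq; last first.
  move=> y _; have [yb|yb] := boolP (y \in (`]-oo, b]%classic : set R)).
    under eq_integral do rewrite /F/= indicE yb mulr1.
    exact: bump.
  rewrite integral0_eq// => w _.
  by rewrite /F/= indicE (negbTE yb) !mulr0.
move=> <-; apply: eq_integral => w _.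
under [RHS]eq_integral do rewrite /F/= EFinM.
rewrite integralZl//; last first.
  apply: le_integrable (integrable_normal_pdf (V w) r) => //.
    apply/measurable_EFinP; apply: measurable_funM => //.
    exact: measurable_normal_pdf.
  move=> y _ /=; rewrite lee_fin normrM ler_piMr//; exact: norm_indic_le1.
congr (_ * _)%E; rewrite /normal_prob [LHS]integral_mkcond.
apply: eq_integral => y _; rewrite patchE indicE; case: ifPn => _.
  by rewrite mulr1.
by rewrite mulr0.
Qed.

Hypothesis V0 : forall x, P (V @^-1` [set x]) = 0%E.

Let iW : P.-integrable setT (fun w => (W w)%:E).
Proof. exact: (@integrable_norm_le _ _ _ P _ K). Qed.

Let mVlt b : measurable (V @^-1` `]-oo, b[%classic).
Proof. exact: measurable_preimage. Qed.

(** The standard deviation tends to zero under dominated convergence. The limit is the indicator of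
    V < b except on V = b, a null event because V has no atoms. *)
Let ray b : (\int[P]_(w in V @^-1` `]-oo, b[%classic) (W w)%:E = 0)%E.
Proof.
pose f n w := ((W w)%:E * normal_prob (V w) n.+1%:R^-1 `]-oo, b]%classic)%E.
pose f1 w := ((W w)%:E * ((V w < b)%R%:R)%:E)%E.
have mb : measurable (V @^-1` [set b]) by exact: measurable_preimage.
have mf n : measurable_fun setT (f n).
  apply: emeasurable_funM; first exact/measurable_EFinP.
  have mg : measurable_fun [set: T * measurableTypeR R]
     (fun z => (normal_pdf (V z.1) n.+1%:R^-1 z.2 *
        \1_(`]-oo, b]%classic : set R) z.2)%:E).
    apply/measurable_EFinP; apply: measurable_funM; first exact: mpdf.
    apply: measurableT_comp; last exact: measurable_snd.
    exact: measurable_indic.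
  apply: (eq_measurable_fun (fun w => \int[mu]_y (normal_pdf (V w) n.+1%:R^-1 y *
        \1_(`]-oo, b]%classic : set R) y)%:E)%E).
    move=> w _; rewrite /normal_prob [RHS]integral_mkcond.
    apply: eq_integral => y _; rewrite patchE indicE; case: ifPn => _.
      by rewrite mulr1.
    by rewrite mulr0.
  apply: (@measurable_fun_fubini_tonelli_F _ _ _ _ _ mu _ mg) => z.
  by rewrite lee_fin mulr_ge0 ?normal_pdf_ge0.
have mf1 : measurable_fun setT f1.
  rewrite (_ : f1 = (fun w => (W w * \1_(V @^-1` `]-oo, b[%classic) w)%:E)).
    by apply/measurable_EFinP; apply: measurable_funM => //; exact: measurable_indic.
  apply/funext => w; rewrite /f1 -EFinM indicE; congr (_ * _%:R)%:E.
  have [Vb|Vb] := boolP (V w < b).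
    by rewrite mem_set//= in_itv.
  by rewrite memNset//= in_itv/= (negbTE Vb).
have cvgf : {ae P, forall w, setT w -> f n w @[n --> \oo] --> f1 w}.
  exists (V @^-1` [set b]); split => // w /= /not_implyP[_ nc].
  apply/eqP/negPn/negP => Vb; apply: nc.
  apply: cvgeZl => //; exact: cvg_normal_prob_ray.
have fle n w : (`|f n w| <= cst K%:E w)%E.
  rewrite abseM -[leRHS]mule1 /= lee_pmul//.
    by rewrite lee_fin.
  by rewrite gee0_abs// probability_le1.
have ig : P.-integrable setT (cst K%:E) by exact: finite_measure_integrable_cst.
have fleae : {ae P, forall w n, setT w -> (`|f n w| <= cst K%:E w)%E}.
  exact: aeW.
have [_ _] := dominated_convergence measurableT mf mf1 cvgf ig fleae.
rewrite (_ : [sequence _]_n = cst 0%E); last first.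
  by apply/funext => n; apply: smoothed_ray; rewrite invr_gt0.
move=> lim; have {lim}f10 := cvg_unique _ (cvg_cst 0%E) lim.
rewrite [RHS]f10//.
rewrite [LHS]integral_mkcond; apply: eq_integral => w _.
rewrite patchE /f1; have [Vb|Vb] := boolP (V w < b).
  by rewrite mem_set ?mule1//= in_itv.
by rewrite memNset ?mule0//= in_itv/= (negbTE Vb).
Qed.

(** Injectivity of the Fourier transform for the signed measure with density W, pushed forward by V.
    It vanishes on the open rays, which form a pi-system generating the Borel sets, and Dynkin's
    argument extends this. *)
Lemma trig_uniqueness (B : set R) : measurable B ->
  (\int[P]_(w in V @^-1` B) (W w)%:E = 0)%E.
Proof.
have mVB A : measurable A -> measurable (V @^-1` A).
  exact: measurable_preimage.
have iWA A : measurable A -> P.-integrable (V @^-1` A) (fun w => (W w)%:E).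
  by move=> mA; apply: integrableS iW => //; exact: mVB.
have I0 : (\int[P]_w (W w)%:E = 0)%E.
  have := cosW 0 0; under eq_integral do rewrite mul0r addr0 cos0 mulr1.
  by [].
have mE : @measurable _ (measurableTypeR R) = <<s @RGenInftyO.G R >>.
  exact: RGenInftyO.measurableE.
move=> mB; have : <<s @RGenInftyO.G R >> B by rewrite -mE.
apply: (@dynkin_induction _ (measurableTypeR R) (@RGenInftyO.G R)
   (fun A => \int[P]_(w in V @^-1` A) (W w)%:E = 0)%E) => //.
- move=> _ _ [x ->] [y ->]; exists (Num.min x y).
  apply/seteqP; split => z /=; rewrite !in_itv/= lt_min; last by move/andP.
  by move=> [-> ->].
- by move=> _ [x ->]; exact: ray.
- move=> A mA A0; have mA' : measurable (A : set R) by [].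
  have := I0; rewrite -(setUv (V @^-1` A)) integral_setU_EFin//.
  + by rewrite -preimage_setC A0 add0e.
  + exact: mVB.
  + by apply: measurableC; exact: mVB.
  + by rewrite setUv; apply/measurable_funTS.
  + by apply/disj_setPS; rewrite setICr.
- move=> F mF tF F0; rewrite preimage_bigcup integral_bigcup//.
  + by rewrite eseries0.
  + apply/trivIsetP => i j _ _ ij; rewrite -preimage_setI.
    by move/trivIsetP : tF => ->//; rewrite preimage_set0.
  + by move=> k; apply: mVB; exact: mF.
  + by rewrite -preimage_bigcup; apply: iWA; apply: bigcupT_measurable => k; exact: mF.
Qed.

End trig_uniqueness.

Lemma EFin_Rintegral d (T : measurableType d) (R : realType)
    (P : {measure set T -> \bar R}) (f : T -> R) :
  P.-integrable setT (EFin \o f) ->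
  (\int[P]_w (f w)%:E)%E = (\int[P]_w f w)%:E.
Proof. by move=> fi; rewrite /Rintegral fineK// integrable_fin_num. Qed.

(** * Independence from joint cosine integrals *)

Section gaussian_independence.
Context d (T : measurableType d) (R : realType) (P : probability T R).
Context (I : finType) (V : I -> T -> R).
Hypothesis mV : forall i, measurable_fun [set: T] (V i).
Hypothesis V0 : forall i x, P (V i @^-1` [set x]) = 0%E.
Hypothesis cosV : forall (t : I -> R) (phi : R),
  (\int[P]_w (cos (\sum_i t i * V i w + phi))%:E =
   (expR (- ((\sum_i t i ^+ 2) / 2)) * cos phi)%:E)%E.

Let lin (t : I -> R) w : R := \sum_i t i * V i w.
Let shift (t : I -> R) (e : I) (a : R) i := t i + a * (i == e)%:R.

Let mlin t : measurable_fun [set: T] (lin t).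
Proof. by apply: measurable_sum => i; exact: measurable_funM. Qed.

Let lin_shift t e a w : lin (shift t e a) w = lin t w + a * V e w.
Proof.
rewrite /lin /shift; under eq_bigr do rewrite mulrDl; rewrite big_split/=; congr (_ + _).
rewrite (bigD1 e)//= eqxx mulr1 big1 ?addr0// => i ie.
by rewrite (negbTE ie) mulr0 mul0r.
Qed.

Let sqr_shift t e a : t e = 0 ->
  \sum_i shift t e a i ^+ 2 = \sum_i t i ^+ 2 + a ^+ 2.
Proof.
move=> te; rewrite (bigD1 e)//= [in RHS](bigD1 e)//= {1}/shift te eqxx.
rewrite mulr1 add0r expr0n add0r addrC; congr (_ + _).
by apply: eq_bigr => i ie; rewrite /shift (negbTE ie) mulr0 addr0.
Qed.

Let mcos := @measurable_cos R.
Let norm_cos := @norm_cos_le1 R.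

Let ind (B : I -> set R) (s : seq I) w : R := \prod_(i <- s) \1_(V i @^-1` B i) w.

Let mVB (B : set R) i : measurable B -> measurable (V i @^-1` B).
Proof. exact: measurable_preimage. Qed.

Let mind B s : (forall i, measurable (B i)) -> measurable_fun [set: T] (ind B s).
Proof.
move=> mB; apply: measurable_prod => i _.
by apply: measurable_indic; exact: mVB.
Qed.

Let norm_ind B s w : `|ind B s w| <= 1.
Proof.
rewrite /ind; elim: s => [|i s IH]; first by rewrite big_nil normr1.
by rewrite big_cons normrM mulr_ile1// norm_indic_le1.
Qed.

(** Indicators and frequencies live on disjoint coordinates. The induction turns one coordinate at a
    time from a frequency into an indicator: by the hypothesis for [s], the product of indicators
    and cosine, minus its mean, has zero integral against every cos(a V_e + psi), so
    [trig_uniqueness] gives zero integral over every event of V_e. *)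
Let trig_indic (s : seq I) (B : I -> set R) (t : I -> R) (phi : R) :
  uniq s -> (forall i, measurable (B i)) -> (forall i, i \in s -> t i = 0) ->
  \int[P]_w (ind B s w * cos (lin t w + phi)) =
    (\prod_(i <- s) fine (P (V i @^-1` B i))) *
    expR (- ((\sum_i t i ^+ 2) / 2)) * cos phi.
Proof.
move=> + mB; elim: s t phi => [|e s IH] t phi /=.
  move=> _ _; under eq_Rintegral do rewrite /ind big_nil mul1r.
  by rewrite /Rintegral cosV big_nil mul1r.
move=> /andP[es us] t0.
have te : t e = 0 by apply: t0; rewrite inE eqxx.
have ts i : i \in s -> t i = 0 by move=> si; apply: t0; rewrite inE si orbT.
pose K := (\prod_(i <- s) fine (P (V i @^-1` B i))) * expR (- ((\sum_i t i ^+ 2) / 2)).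
have IHa a psi : \int[P]_w (ind B s w * cos (lin t w + a * V e w + psi)) =
    K * expR (- (a ^+ 2 / 2)) * cos psi.
  under eq_Rintegral do rewrite -lin_shift.
  rewrite IH// => [|i si]; last first.
    by rewrite /shift ts// (_ : i == e = false) ?mulr0 ?addr0//;
      apply: contraNF es => /eqP <-.
  by rewrite sqr_shift// -(mulrA _ (expR _) (expR _)) -expRD; congr (_ * expR _ * _); field.
have ib (f : T -> R) (C : R) : measurable_fun [set: T] f -> (forall w, `|f w| <= C) ->
    P.-integrable setT (EFin \o f).
  by move=> mf fC; exact: integrable_norm_le fC.
have mI := mind s mB.
have maV a psi : measurable_fun [set: T] (fun w => a * V e w + psi).
  by apply: measurable_funD => //; exact: measurable_funM.
have mS psi : measurable_fun [set: T] (fun w => lin t w + psi).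
  by apply: measurable_funD => //; exact: mlin.
have ic a psi : P.-integrable setT (EFin \o
    (fun w => ind B s w * cos (lin t w + a * V e w + psi))).
  apply: (ib _ 1); last by move=> w; rewrite normrM mulr_ile1.
  apply: measurable_funM => //; apply: measurableT_comp => //.
  apply: measurable_funD => //; apply: measurable_funD; first exact: mlin.
  exact: measurable_funM.
have cosV1 a psi : \int[P]_w cos (a * V e w + psi) = expR (- (a ^+ 2 / 2)) * cos psi.
  have := cosV (fun i => a * (i == e)%:R) psi.
  have sumd w : \sum_i a * (i == e)%:R * V i w = a * V e w.
    rewrite (bigD1 e)//= eqxx mulr1 big1 ?addr0// => i ie.
    by rewrite (negbTE ie) mulr0 mul0r.
  under eq_integral do rewrite sumd.
  rewrite (bigD1 e)//= eqxx mulr1 big1 ?addr0 => [|i ie].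
    by rewrite /Rintegral => ->.
  by rewrite (negbTE ie) mulr0 expr0n.
have ic1 a psi : P.-integrable setT (EFin \o (fun w => cos (a * V e w + psi))).
  by apply: (ib _ 1) => //; exact: measurableT_comp.
have mc1 : measurable_fun [set: T] (fun w => ind B s w * cos (lin t w + phi)).
  by apply: measurable_funM => //; exact: measurableT_comp.
have i1 : P.-integrable setT (EFin \o (fun w => ind B s w * cos (lin t w + phi))).
  by apply: (ib _ 1) => // w; rewrite normrM mulr_ile1.
pose p := fine (P (V e @^-1` B e)).
have indE w : ind B (e :: s) w = ind B s w * \1_(V e @^-1` B e) w.
  by rewrite /ind big_cons mulrC.
have mBe := mVB e (mB e).
have restrict_int (f : T -> R) :
    \int[P]_w (f w * \1_(V e @^-1` B e) w) = \int[P]_(w in V e @^-1` B e) f w.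
  rewrite [RHS]Rintegral_mkcond; apply: eq_Rintegral => w _.
  by rewrite patchE indicE; case: (_ \in _); rewrite ?mulr1 ?mulr0.
pose W w := ind B s w * cos (lin t w + phi) - K * cos phi.
have mW : measurable_fun [set: T] W by exact: measurable_funB.
have WC w : `|W w| <= 1 + `|K * cos phi|.
  by rewrite (le_trans (ler_normB _ _))// lerD// normrM mulr_ile1.
(* The product of the two cosines is the half-sum of cosines with frequency [a] and [- a] at
   coordinate [e]; [IHa] evaluates both. *)
have cosW a psi : (\int[P]_w (W w * cos (a * V e w + psi))%:E = 0)%E.
  pose f w := ind B s w * cos (lin t w + a * V e w + (phi + psi)).
  pose g w := ind B s w * cos (lin t w + (- a) * V e w + (phi - psi)).
  have iD : P.-integrable setT (EFin \o (fun w => f w + g w)).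
    exact: (integrableD measurableT (ic a (phi + psi)) (ic (- a) (phi - psi))).
  have iD2 : P.-integrable setT (EFin \o (fun w => 2^-1 * (f w + g w))).
    exact: (integrableZl measurableT 2^-1 iD).
  have iC : P.-integrable setT (EFin \o (fun w => K * cos phi * cos (a * V e w + psi))).
    exact: (integrableZl measurableT (K * cos phi) (ic1 a psi)).
  rewrite (eq_integral (fun w => (2^-1 * (f w + g w) -
      K * cos phi * cos (a * V e w + psi))%:E)); last first.
    move=> w _; congr (_%:E); rewrite /W /f /g mulrBl; congr (_ - _).
    rewrite (_ : _ + (phi + psi) = lin t w + phi + (a * V e w + psi)); last by ring.
    rewrite (_ : _ + (phi - psi) = lin t w + phi - (a * V e w + psi)); last by ring.
    by rewrite (cosB (_ + phi)) (cosD (_ + phi)); field.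
  rewrite EFin_Rintegral; last exact: (integrableB measurableT iD2 iC).
  rewrite (RintegralB measurableT iD2 iC) (RintegralZl _ measurableT iD)//.
  rewrite (RintegralD measurableT (ic _ _) (ic _ _)) !IHa RintegralZl// cosV1.
  by congr (_%:E); rewrite sqrrN cosB cosD; field.
have := trig_uniqueness (mV e) mW WC cosW (V0 e) (mB e).
have iS (f : T -> R) : P.-integrable setT (EFin \o f) ->
    P.-integrable (V e @^-1` B e) (EFin \o f).
  by move=> fi; exact: integrableS fi.
have iK : P.-integrable setT (EFin \o (fun _ : T => K * cos phi)).
  exact: finite_measure_integrable_cst.
rewrite -[LHS]fineK; last first.
  by apply: integrable_fin_num => //; apply: (iS W); apply: (ib _ _ mW WC).
move=> [] /eqP; rewrite -/(Rintegral _ _ _) RintegralB//; try exact: iS.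
rewrite subr_eq0 => /eqP e1.
under eq_Rintegral do rewrite indE mulrAC.
by rewrite restrict_int e1 Rintegral_cst// big_cons /K -/p; ring.
Qed.

Lemma gaussian_independence : mutually_independent P V.
Proof.
move=> B mB.
(* With zero frequencies and zero phase the cosine is 1, and only the indicators of all coordinates
   remain. *)
have H := trig_indic (t := fun=> 0) 0 (index_enum_uniq I) mB (fun _ _ => erefl).
set A := \bigcap_i _.
have mA : measurable A.
  by apply: fin_bigcap_measurable => // i _; exact: mVB.
have indA w : ind B (index_enum I) w = \1_A w.
  rewrite /ind [RHS]indicE; have [Aw|nAw] := boolP (w \in A).
    rewrite big1// => i _; rewrite indicE mem_set//.
    by move: Aw; rewrite inE; apply.
  have [i nB] : exists i, w \notin V i @^-1` B i.
    apply: contrapT => H'; move/negP: nAw; apply; rewrite inE => i _.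
    by apply: contrapT => nB; apply: H'; exists i; rewrite notin_setE.
  by rewrite (bigD1 i)//= indicE (negbTE nB) mul0r.
have lin0 w : lin (fun=> 0) w = 0 by rewrite /lin big1// => i _; rewrite mul0r.
move: H; under eq_Rintegral do rewrite lin0 addr0 cos0 mulr1 indA.
rewrite [X in expR (- (X / 2))]big1 => [|i _]; last by rewrite expr0n.
rewrite mul0r oppr0 expR0 cos0 !mulr1 /Rintegral integral_indic// setIT => e.
rewrite -[LHS]fineK ?fin_num_measure// e -prodEFin.
by apply: eq_bigr => i _; rewrite fineK// fin_num_measure//; exact: mVB.
Qed.

End gaussian_independence.

(** * Integrals of functions of two independent variables *)

Section independent_pair.
Context d d1 d2 (T : measurableType d) (U1 : measurableType d1)
  (U2 : measurableType d2) (R : realType) (P : probability T R).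
Variables (Z1 : T -> U1) (Z2 : T -> U2).
Hypothesis mZ1 : measurable_fun [set: T] Z1.
Hypothesis mZ2 : measurable_fun [set: T] Z2.
Hypothesis indZ : independent2 P Z1 Z2.
Local Open Scope ereal_scope.

Let Z1' : {mfun T >-> U1} := HB.pack Z1 (isMeasurableFun.Build _ _ _ _ _ mZ1).
Let Z2' : {mfun T >-> U2} := HB.pack Z2 (isMeasurableFun.Build _ _ _ _ _ mZ2).
Let D1 : probability U1 R := distribution P Z1'.
Let D2 : probability U2 R := distribution P Z2'.

Let mZ : measurable_fun [set: T] (fun w => (Z1 w, Z2 w)).
Proof. exact: measurable_fun_pair. Qed.

Let Z' : {mfun T >-> (U1 * U2)%type} :=
  HB.pack (fun w => (Z1 w, Z2 w)) (isMeasurableFun.Build _ _ _ _ _ mZ).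

Let law_pair (A : set (U1 * U2)) : measurable A ->
  pushforward P (fun w => (Z1 w, Z2 w)) A = (D1 \x D2) A.
Proof.
move=> mA; rewrite (@product_measure_unique _ _ _ _ R D1 D2 (distribution P Z'))//.
Qed.

(** The inner integral freezes [Z1], so it plays the role of a conditional expectation given
    [Z1]. *)
Lemma independent2_tonelli (F : U1 * U2 -> \bar R) :
  measurable_fun [set: U1 * U2] F -> (forall z, 0 <= F z) ->
  \int[P]_w F (Z1 w, Z2 w) = \int[P]_w \int[P]_w' F (Z1 w, Z2 w').
Proof.
move=> mF F0; rewrite (ge0_law_integral mZ (nu := (D1 \x D2)) law_pair mF F0).
rewrite fubini_tonelli1//.
rewrite -(ge0_law_integral mZ1 (nu := D1) (fun _ _ => erefl)); last 2 first.
- exact: measurable_fun_fubini_tonelli_F.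
- by move=> x; exact: integral_ge0.
apply: eq_integral => w _; rewrite /fubini_F.
rewrite -(ge0_law_integral mZ2 (nu := D2) (fun _ _ => erefl))//.
exact: (measurable_comp measurableT _ mF (measurable_pair1 (Z1 w))).
Qed.

Lemma measurable_integral_pair (F : U1 * U2 -> \bar R) :
  measurable_fun [set: U1 * U2] F -> (forall z, 0 <= F z) ->
  measurable_fun [set: T] (fun w => \int[P]_w' F (Z1 w, Z2 w')).
Proof.
move=> mF F0.
rewrite (_ : (fun _ => _) = fubini_F D2 F \o Z1).
  apply: measurableT_comp => //.
  exact: measurable_fun_fubini_tonelli_F.
apply/funext => w; rewrite /fubini_F/=.
rewrite -(ge0_law_integral mZ2 (nu := D2) (fun _ _ => erefl))//.
exact: (measurable_comp measurableT _ mF (measurable_pair1 (Z1 w))).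
Qed.

Lemma independent2_integrableM (f : U1 -> R) (g : U2 -> R) :
  measurable_fun [set: U1] f -> measurable_fun [set: U2] g ->
  P.-integrable setT (fun w => (f (Z1 w))%:E) ->
  P.-integrable setT (fun w => (g (Z2 w))%:E) ->
  P.-integrable setT (fun w => (f (Z1 w) * g (Z2 w))%:E) /\
  \int[P]_w (f (Z1 w) * g (Z2 w))%:E =
  \int[P]_w (f (Z1 w))%:E * \int[P]_w (g (Z2 w))%:E.
Proof.
move=> mf mg fi gi.
pose F (z : U1 * U2) := (f z.1 * g z.2)%:E.
have mF : measurable_fun [set: U1 * U2] F.
  apply/measurable_EFinP; apply: measurable_funM.
    by apply: measurableT_comp => //; exact: measurable_fst.
  by apply: measurableT_comp => //; exact: measurable_snd.
have mfE : measurable_fun [set: U1] (EFin \o f) by exact/measurable_EFinP.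
have mgE : measurable_fun [set: U2] (EFin \o g) by exact/measurable_EFinP.
have mgn : measurable_fun [set: U2] (fun y => `|g y|%:E).
  by apply/measurable_EFinP; exact: measurableT_comp.
have law1 (h : U1 -> \bar R) : measurable_fun [set: U1] h ->
    \int[P]_w h (Z1 w) = \int[D1]_x h x.
  exact: (law_integral mZ1 (nu := D1) (fun _ _ => erefl)).
have law2 (h : U2 -> \bar R) : measurable_fun [set: U2] h ->
    \int[P]_w h (Z2 w) = \int[D2]_x h x.
  exact: (law_integral mZ2 (nu := D2) (fun _ _ => erefl)).
have fi1 : D1.-integrable setT (EFin \o f).
  apply/integrableP; split => //; rewrite -(law1 (fun x => `|(EFin \o f) x|)).
    by case/integrableP : fi.
  exact: measurableT_comp.
have gi2 : D2.-integrable setT (EFin \o g).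
  apply/integrableP; split => //; rewrite -(law2 (fun x => `|(EFin \o g) x|)).
    by case/integrableP : gi.
  exact: measurableT_comp.
have iF : (D1 \x D2).-integrable setT F.
  apply/integrable12ltyP => //.
  have gy : \int[D2]_y `|g y|%:E \is a fin_num.
    rewrite ge0_fin_numE; first by case/integrableP : gi2.
    by apply: integral_ge0 => y _; rewrite lee_fin.
  have FE x : \int[D2]_y `|F (x, y)| = `|f x|%:E * (fine (\int[D2]_y `|g y|%:E))%:E.
    rewrite fineK// -ge0_integralZl//.
      by apply: eq_integral => y _; rewrite /F/= normrM EFinM.
  under eq_integral do rewrite FE.
  rewrite ge0_integralZr//; last 2 first.
  - by apply/measurable_EFinP; exact: measurableT_comp.
  - by rewrite lee_fin fine_ge0// integral_ge0.
  by rewrite lte_mul_pinfty ?integral_ge0//; [rewrite ge0_fin_numE ?integral_ge0//; case/integrableP : fi1|rewrite ltry].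
split.
  exact: (law_integrable mZ (nu := D1 \x D2) law_pair mF).
rewrite (law_integral mZ (nu := D1 \x D2) law_pair mF) -integral12_prod_meas1//.
rewrite (law1 _ mfE) (law2 _ mgE).
rewrite /fubini_F.
under eq_integral => x _.
  under eq_integral do rewrite /F/= EFinM.
  rewrite integralZl// -(fineK (integrable_fin_num measurableT gi2)); over.
rewrite integralZr//=; first by rewrite fineK ?integrable_fin_num.
Qed.

End independent_pair.

(** * Independence of complementary blocks of coordinates *)

Section blocks.
Context d (T : measurableType d) (R : realType) (P : probability T R).

Lemma independent_pi_lambda (G : set (set T)) (A : set T) :
  setI_closed G -> G `<=` measurable -> measurable A ->
  (forall X, G X -> P (X `&` A) = (P X * P A)%E) ->
  forall X, <<s G >> X -> P (X `&` A) = (P X * P A)%E.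
Proof.
move=> GI Gm mA GA.
have sGm X : <<s G >> X -> measurable X.
  by apply: smallest_sub => //; exact: sigma_algebra_measurable.
apply: (@dynkin_induction _ (g_sigma_algebraType G) G
  (fun X => P (X `&` A) = (P X * P A)%E)) => //.
- by rewrite setTI [P setT]probability_setT mul1e.
- move=> X /sGm mX PX.
  have -> : ~` X `&` A = A `\` (X `&` A).
    by apply/seteqP; split => w /= [a b]; split => //; [case|move=> c; apply: b].
  rewrite measureD//; last 2 first.
  + exact: measurableI.
  + by rewrite -ge0_fin_numE// fin_num_measure.
  transitivity (P A - P X * P A)%E.
    by congr (_ - _)%E; rewrite -PX setICA setIid.
  rewrite [P (~` X)]probability_setC// muleBl ?fin_num_adde_defr ?mul1e//; exact: fin_num_measure.
- move=> F mF tF FA; rewrite setI_bigcupl.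
  have mF' n : d.-measurable (F n : set T) by apply: sGm; exact: mF.
  rewrite measure_bigcup//; last 2 first.
  + by move=> n _; exact: measurableI.
  + by apply/trivIset_setIr.
  rewrite muleC (@measure_bigcup _ _ _ P setT F)//.
  rewrite -[P A]fineK ?fin_num_measure// -nneseriesZl//.
  by apply: eq_eseriesr => n _; rewrite fineK ?fin_num_measure// muleC; exact: FA.
Qed.

Context (I : finType) (V : I -> T -> R).
Hypothesis mV : forall i, measurable_fun [set: T] (V i).
Hypothesis indV : mutually_independent P V.

(** Cylinders over the coordinates in J, written over all of I so that mutual independence applies
    to them directly. *)
Definition rectangles (J : {set I}) : set (set T) :=
  [set A | exists B : I -> set R, [/\ forall i, measurable (B i),
     forall i, i \notin J -> B i = setT & A = \bigcap_i (V i @^-1` B i)]].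

(** The same sample space with the smaller sigma-algebra generated by the coordinates in J.
    Measurability on [block J] expresses dependence on these coordinates only, and the identity map
    plays the role of the subfamily. *)
Definition block (J : {set I}) := g_sigma_algebraType (rectangles J).

Let mVB (B : set R) i : measurable B -> measurable (V i @^-1` B).
Proof. exact: measurable_preimage. Qed.

Let rectanglesI J : setI_closed (rectangles J).
Proof.
move=> _ _ [B [mB BT ->]] [C [mC CT ->]]; exists (fun i => B i `&` C i); split.
- by move=> i; exact: measurableI.
- by move=> i iJ; rewrite BT// CT// setTI.
- apply/seteqP; split => [w [Bw Cw] i _|w BCw]; first by split; [exact: Bw|exact: Cw].
  by split => i _; have [] := BCw i Logic.I.
Qed.

Let rectanglesm J : rectangles J `<=` measurable.
Proof.
move=> _ [B [mB _ ->]]; apply: fin_bigcap_measurable => // i _.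
exact: mVB.
Qed.

Lemma measurable_block_id J : measurable_fun [set: T] (id : T -> block J).
Proof.
move=> _ A mA; rewrite setTI preimage_id.
move: A mA; apply: smallest_sub; first exact: sigma_algebra_measurable.
exact: rectanglesm.
Qed.

Lemma measurable_block (J : {set I}) i : i \in J ->
  measurable_fun [set: block J] (V i : block J -> R).
Proof.
move=> iJ _ B mB; rewrite setTI; apply: sub_sigma_algebra.
exists (fun k => if k == i then B else setT); split.
- by move=> k; case: ifP => // _; exact: measurableT.
- by move=> k; case: ifPn => // /eqP ->; rewrite iJ.
- apply/seteqP; split => [w Bw k _|w Bw].
    by rewrite /=; case: eqP => // ->.
  by have := Bw i Logic.I; rewrite /= eqxx.
Qed.

(** The pi-lambda argument is applied first to the event of J, then to that of its complement. On
    two rectangles the product rule holds because for each index one of the two factors is the full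
    line. *)
Lemma independent_blocks J :
  independent2 P (id : T -> block J) (id : T -> block (~: J)).
Proof.
move=> A B mA mB; rewrite !preimage_id.
have rm J' X : <<s rectangles J' >> X -> measurable X.
  by move=> mX; have := @measurable_block_id J' measurableT X mX; rewrite setTI.
apply: independent_pi_lambda mA => //; first exact: (rm _ _ mB).
move=> _ [B1 [mB1 B1T ->]]; set X := \bigcap_i _.
have mX : measurable X by apply: (@rectanglesm J); exists B1.
rewrite setIC [RHS]muleC; apply: independent_pi_lambda mB => //.
move=> _ [B2 [mB2 B2T ->]].
have -> : \bigcap_i (V i @^-1` B2 i) `&` X = \bigcap_i (V i @^-1` (B2 i `&` B1 i)).
  apply/seteqP; split => [w [Bw Cw] i _|w BCw]; first by split; [exact: Bw|exact: Cw].
  by split => i _; have [] := BCw i Logic.I.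
rewrite !indV//; last by move=> i; exact: measurableI.
rewrite -big_split/=; apply: eq_bigr => i _.
have [iJ|iJ] := boolP (i \in J).
  by rewrite B2T ?inE ?iJ// setTI preimage_setT [P setT]probability_setT mul1e.
by rewrite B1T// setIT preimage_setT [X in (_ * X)%E]probability_setT mule1.
Qed.

End blocks.

Lemma integrable_EFin_sum d (T : measurableType d) (R : realType)
    (P : {measure set T -> \bar R}) (I : Type) (r : seq I) (f : I -> T -> R) :
  (forall i, P.-integrable setT (EFin \o f i)) ->
  P.-integrable setT (EFin \o (fun w => \sum_(i <- r) f i w)).
Proof.
move=> fi.
have := integrable_sum measurableT r (P := xpredT) (fun i _ => fi i).
by apply: eq_integrable => // w _; rewrite /= sumEFin.
Qed.

Lemma Rintegral_sum d (T : measurableType d) (R : realType)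
    (P : {measure set T -> \bar R}) (I : Type) (r : seq I) (f : I -> T -> R) :
  (forall i, P.-integrable setT (EFin \o f i)) ->
  \int[P]_w (\sum_(i <- r) f i w) = \sum_(i <- r) \int[P]_w f i w.
Proof.
move=> fi; elim: r => [|i r IH].
  under eq_Rintegral do rewrite big_nil.
  by rewrite big_nil /Rintegral integral0.
under eq_Rintegral do rewrite big_cons.
rewrite RintegralD//; last exact: integrable_EFin_sum.
by rewrite big_cons IH.
Qed.

Lemma Rintegral_cst_probability d (T : measurableType d) (R : realType)
    (P : probability T R) (c : R) : \int[P]_w c = c.
Proof. by rewrite /Rintegral (integral_cst_probability P c). Qed.

Lemma normM_le_sqr (R : realFieldType) (x y : R) :
  `|x * y| <= 2^-1 * (x ^+ 2 + y ^+ 2).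
Proof.
rewrite ler_norml; have := sqr_ge0 (x + y); have := sqr_ge0 (x - y).
by move=> ? ?; apply/andP; split; nra.
Qed.

(** * Second moments of quadratic and linear forms *)

Section quadratic_forms.
Context d (T : measurableType d) (R : realType) (P : probability T R).
Context (I : finType) (xi : I -> T -> R) (s C4 : R).
Hypothesis mxi : forall i, measurable_fun [set: T] (xi i).
Hypothesis indxi : mutually_independent P xi.
Hypothesis xi4 : forall i, P.-integrable setT (fun w => (xi i w ^+ 4)%:E).
Hypothesis E1 : forall i, \int[P]_w xi i w = 0.
Hypothesis E2 : forall i, \int[P]_w (xi i w ^+ 2) = s ^+ 2.
Hypothesis E4 : forall i, \int[P]_w (xi i w ^+ 4) <= C4 * s ^+ 4.

(** A single integrable majorant, up to constants, for all products of degree at most four. *)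
Let S w : R := 1 + \sum_i xi i w ^+ 4.

Let X4 (x : R) : 0 <= x ^+ 4. Proof. exact: exprn_even_ge0. Qed.

Let S4 i w : xi i w ^+ 4 <= S w.
Proof. by rewrite /S (bigD1 i)//= addrCA lerDl addr_ge0// sumr_ge0. Qed.

Let S1 w : 1 <= S w.
Proof. by rewrite lerDl sumr_ge0. Qed.

Let S2 i w : xi i w ^+ 2 <= S w.
Proof.
rewrite /S (bigD1 i)//=; set r := \sum_(j | _) _.
have r0 : 0 <= r by exact: sumr_ge0.
by have := sqr_ge0 (xi i w ^+ 2 - 1); rewrite (exprM _ 2 2); set u := _ ^+ 2; nra.
Qed.

Let iS : P.-integrable setT (EFin \o S).
Proof.
exact: (integrableD measurableT (finite_measure_integrable_cst P 1 measurableT)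
  (integrable_EFin_sum (index_enum I) xi4)).
Qed.

Let dominated_int (f : T -> R) (C : R) : measurable_fun [set: T] f ->
  (forall w, `|f w| <= C * S w) -> P.-integrable setT (EFin \o f).
Proof.
move=> mf fC; apply: le_integrable (integrableZl measurableT C iS) => //.
  exact/measurable_EFinP.
by move=> w _ /=; rewrite lee_fin (le_trans (fC w))// ler_norm.
Qed.

Let xiD i w : `|xi i w| <= S w.
Proof.
rewrite ler_norml; have := S2 i w; have := S1 w; set u := S w; set x := xi i w.
by move=> u1 ux; apply/andP; split; nra.
Qed.

(** The centred products, indexed by pairs so that the square of a quadratic form is a sum over two
    pairs. Each is uncorrelated with all others except its own transpose. *)
Let zeta (a : I * I) w := xi a.1 w * xi a.2 w - (a.1 == a.2)%:R * s ^+ 2.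

Let mzeta a : measurable_fun [set: T] (zeta a).
Proof. by apply: measurable_funB => //; exact: measurable_funM. Qed.

Let zeta2 a w : zeta a w ^+ 2 <= xi a.1 w ^+ 4 + xi a.2 w ^+ 4 + 2 * s ^+ 4.
Proof.
rewrite /zeta; set x := xi _ w; set y := xi _ w.
have e0 : ((a.1 == a.2)%:R * s ^+ 2) ^+ 2 <= s ^+ 4.
  by case: eqP => _; rewrite ?mul1r ?mul0r ?expr0n//= -exprM.
have h1 : (x * y - (a.1 == a.2)%:R * s ^+ 2) ^+ 2 <=
    2 * (x * y) ^+ 2 + 2 * ((a.1 == a.2)%:R * s ^+ 2) ^+ 2.
  set v := _%:R * _; have := sqr_ge0 (x * y + v); nra.
have h2 : 2 * (x * y) ^+ 2 <= x ^+ 4 + y ^+ 4.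
  rewrite exprMn !(exprM _ 2 2).
  by have := sqr_ge0 (x ^+ 2 - y ^+ 2); set u := x ^+ 2; set v := y ^+ 2; nra.
lra.
Qed.

Let zetaD a b w : `|zeta a w * zeta b w| <= (2 + 2 * s ^+ 4) * S w.
Proof.
have s0 := X4 s.
  have h : `|zeta a w * zeta b w| <= 2^-1 * (zeta a w ^+ 2 + zeta b w ^+ 2) by exact: normM_le_sqr.
apply: (le_trans h).
have := zeta2 a w; have := zeta2 b w; have := S1 w.
have := S4 a.1 w; have := S4 a.2 w; have := S4 b.1 w; have := S4 b.2 w.
by move=> ? ? ? ? ? ? ?; nra.
Qed.

Let izeta a b : P.-integrable setT (EFin \o (fun w => zeta a w * zeta b w)).
Proof. by apply: dominated_int (zetaD a b); exact: measurable_funM. Qed.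

Let ixi i : P.-integrable setT (EFin \o xi i).
Proof. by apply: (dominated_int (C := 1)) => // w; rewrite mul1r. Qed.

Let ixzeta j b : P.-integrable setT (EFin \o (fun w => xi j w * zeta b w)).
Proof.
apply: (@dominated_int _ (2 + s ^+ 4)); first exact: measurable_funM.
move=> w; have s0 := X4 s.
  have h : `|xi j w * zeta b w| <= 2^-1 * (xi j w ^+ 2 + zeta b w ^+ 2) by exact: normM_le_sqr.
apply: (le_trans h).
have := zeta2 b w; have := S1 w; have := S2 j w.
have := S4 b.1 w; have := S4 b.2 w.
by move=> ? ? ? ? ?; nra.
Qed.

Let blockM (J : {set I}) i : i \in J ->
  measurable_fun [set: block xi J] (xi i : block xi J -> R).
Proof. exact: measurable_block. Qed.

Let indep_mean0 i (h : T -> R) :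
  measurable_fun [set: block xi (~: [set i])] (h : block xi (~: [set i]) -> R) ->
  P.-integrable setT (EFin \o h) -> \int[P]_w (xi i w * h w) = 0.
Proof.
move=> mh ih.
have ii : i \in [set i]%SET by rewrite inE.
have [_ e] := independent2_integrableM (measurable_block_id mxi (J := [set i]%SET))
  (measurable_block_id mxi (J := (~: [set i])%SET)) (independent_blocks mxi indxi (J := [set i]%SET))
  (blockM ii) mh (ixi i) ih.
by rewrite /Rintegral e EFin_Rintegral// E1 mul0e.
Qed.

(** The index i occurs exactly once among the four, so [xi i] factors out by independence with mean
    zero. *)
Let zeta_once i j b : j != i -> b.1 != i -> b.2 != i ->
  \int[P]_w (zeta (i, j) w * zeta b w) = 0.
Proof.
move=> ji b1 b2.
have -> : \int[P]_w (zeta (i, j) w * zeta b w) =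
    \int[P]_w (xi i w * (xi j w * zeta b w)).
  apply: eq_Rintegral => w _; rewrite {1}/zeta/= eq_sym (negbTE ji) mul0r subr0.
  by rewrite mulrA.
apply: indep_mean0; last exact: ixzeta.
have mk k : k != i -> measurable_fun [set: block xi (~: [set i])]
    (xi k : block xi (~: [set i]) -> R).
  by move=> ki; apply: measurable_block; rewrite !inE.
apply: measurable_funM; first exact: mk.
by apply: measurable_funB => //; apply: measurable_funM; exact: mk.
Qed.

(** Two centred squares at distinct indices are independent with mean zero. *)
Let zeta_diag i k : i != k -> \int[P]_w (zeta (i, i) w * zeta (k, k) w) = 0.
Proof.
move=> ik.
have i1 j : P.-integrable setT (EFin \o (zeta (j, j))).
  apply: (@dominated_int _ (1 + s ^+ 2)) => // w; rewrite /zeta/= eqxx mul1r -expr2.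
  have := S1 w; have := S2 j w; have := sqr_ge0 s; have := sqr_ge0 (xi j w).
  by move=> ? ? ? ?; rewrite ler_norml; apply/andP; split; nra.
have i2 j : P.-integrable setT (EFin \o (fun w => xi j w ^+ 2)).
  apply: (@dominated_int _ 1); first exact: measurable_funX.
  by move=> w; rewrite ger0_norm ?sqr_ge0// mul1r.
have z0 : \int[P]_w zeta (i, i) w = 0.
  rewrite /zeta/= eqxx mul1r; under eq_Rintegral do rewrite -expr2.
  rewrite RintegralB//; last exact: finite_measure_integrable_cst.
  by rewrite E2 Rintegral_cst_probability subrr.
have ii : i \in [set i]%SET by rewrite inE.
have mi : measurable_fun [set: block xi [set i]] (zeta (i, i) : block xi [set i] -> R).
  by apply: measurable_funB => //; apply: measurable_funM; exact: blockM.
have mk : measurable_fun [set: block xi (~: [set i])]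
    (zeta (k, k) : block xi (~: [set i]) -> R).
  apply: measurable_funB => //; apply: measurable_funM; apply: measurable_block;
    by rewrite !inE eq_sym.
have [_ e] := independent2_integrableM (measurable_block_id mxi (J := [set i]%SET))
  (measurable_block_id mxi (J := (~: [set i])%SET)) (independent_blocks mxi indxi (J := [set i]%SET))
  mi mk (i1 i) (i1 k).
by rewrite /Rintegral e EFin_Rintegral// z0 mul0e.
Qed.

Let zeta_sym i j w : zeta (i, j) w = zeta (j, i) w.
Proof. by rewrite /zeta/= mulrC eq_sym. Qed.

(** Unless b is a or its transpose, either both pairs are diagonal and distinct, or some index
    occurs exactly once among the four. *)
Let zeta_orth (a b : I * I) : b != a -> b != (a.2, a.1) ->
  \int[P]_w (zeta a w * zeta b w) = 0.
Proof.
case: a b => [i j] [k l] /= ba bs.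
have swapab x y : \int[P]_w (zeta x w * zeta y w) = \int[P]_w (zeta y w * zeta x w).
  by apply: eq_Rintegral => w _; rewrite mulrC.
have [ij|ij] := eqVneq i j.
  subst j; have [kl|kl] := eqVneq k l.
    subst l; apply: zeta_diag; apply: contraNneq ba => ->.
    by rewrite eqxx.
  rewrite swapab; have [ki|ki] := eqVneq k i.
    have li : l != i by rewrite -ki eq_sym.
    under eq_Rintegral do rewrite zeta_sym.
    by apply: zeta_once => //=; rewrite eq_sym.
  by apply: zeta_once => /=; rewrite eq_sym.
have [ik|ik] := eqVneq k i.
  have lj : l != j by apply: contraNneq ba => ->; rewrite ik.
  under eq_Rintegral do rewrite zeta_sym.
  by apply: zeta_once => //=; rewrite ik.
have [il|il] := eqVneq l i; last by apply: zeta_once => //; rewrite eq_sym.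
have kj : k != j by apply: contraNneq bs => ->; rewrite il.
under eq_Rintegral do rewrite zeta_sym.
by apply: zeta_once => //=; rewrite il.
Qed.

Let zeta_bound a b : `|\int[P]_w (zeta a w * zeta b w)| <= (2 * C4 + 2) * s ^+ 4.
Proof.
pose g w := 2^-1 * (xi a.1 w ^+ 4 + xi a.2 w ^+ 4 + (xi b.1 w ^+ 4 + xi b.2 w ^+ 4))
  + 2 * s ^+ 4.
have ig1 : P.-integrable setT (EFin \o (fun w => xi a.1 w ^+ 4 + xi a.2 w ^+ 4)).
  exact: (integrableD measurableT (xi4 a.1) (xi4 a.2)).
have ig2 : P.-integrable setT (EFin \o (fun w => xi b.1 w ^+ 4 + xi b.2 w ^+ 4)).
  exact: (integrableD measurableT (xi4 b.1) (xi4 b.2)).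
have ig3 : P.-integrable setT (EFin \o (fun w => xi a.1 w ^+ 4 + xi a.2 w ^+ 4 +
    (xi b.1 w ^+ 4 + xi b.2 w ^+ 4))).
  exact: (integrableD measurableT ig1 ig2).
have ig4 : P.-integrable setT (EFin \o (fun w => 2^-1 * (xi a.1 w ^+ 4 + xi a.2 w ^+ 4 +
    (xi b.1 w ^+ 4 + xi b.2 w ^+ 4)))).
  exact: (integrableZl measurableT 2^-1 ig3).
have ic : P.-integrable setT (EFin \o (fun _ : T => 2 * s ^+ 4)).
  exact: finite_measure_integrable_cst.
have ig : P.-integrable setT (EFin \o g) by exact: (integrableD measurableT ig4 ic).
rewrite (le_trans (le_normr_Rintegral measurableT (izeta a b)))//.
rewrite (le_trans (le_Rintegral (f2 := g) measurableT (integrable_norm (izeta a b)) ig _))//.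
  move=> w _; rewrite /g.
  have h : `|zeta a w * zeta b w| <= 2^-1 * (zeta a w ^+ 2 + zeta b w ^+ 2) by exact: normM_le_sqr.
  by apply: (le_trans h); have := zeta2 a w; have := zeta2 b w; lra.
rewrite (RintegralD measurableT ig4 ic) (RintegralZl _ measurableT ig3)//.
rewrite (RintegralD measurableT ig1 ig2) !(RintegralD measurableT (xi4 _) (xi4 _)).
rewrite Rintegral_cst_probability.
have := E4 a.1; have := E4 a.2; have := E4 b.1; have := E4 b.2; lra.
Qed.

(** Only pairs b equal to a or to its transpose survive, so the double sum over pairs is of the
    order of the squared Frobenius norm. *)
Lemma quadratic_form_variance (m : I -> I -> R) :
  (\int[P]_w ((\sum_i \sum_j m i j * (xi i w * xi j w - (i == j)%:R * s ^+ 2)) ^+ 2)%:E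
   <= ((4 * C4 + 4) * s ^+ 4 * \sum_i \sum_j m i j ^+ 2)%:E)%E.
Proof.
pose mm (a : I * I) := m a.1 a.2.
have E w : (\sum_i \sum_j m i j * (xi i w * xi j w - (i == j)%:R * s ^+ 2)) ^+ 2 =
    \sum_a \sum_b mm a * mm b * (zeta a w * zeta b w).
  rewrite pair_bigA/= expr2 mulr_suml; apply: eq_bigr => a _.
  by rewrite mulr_sumr; apply: eq_bigr => b _; rewrite /mm /zeta; ring.
have iab a b : P.-integrable setT (EFin \o (fun w => mm a * mm b * (zeta a w * zeta b w))).
  exact: (integrableZl measurableT _ (izeta a b)).
have ia a : P.-integrable setT
    (EFin \o (fun w => \sum_b mm a * mm b * (zeta a w * zeta b w))).
  by apply: integrable_EFin_sum => b; exact: (iab a b).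
have i0 : P.-integrable setT
    (EFin \o (fun w => \sum_a \sum_b mm a * mm b * (zeta a w * zeta b w))).
  by apply: integrable_EFin_sum => a; exact: (ia a).
under eq_integral do rewrite E.
rewrite EFin_Rintegral// lee_fin Rintegral_sum//.
under eq_bigr => a _.
  rewrite Rintegral_sum//; under eq_bigr do rewrite RintegralZl//.
  over.
pose K := (2 * C4 + 2) * s ^+ 4.
have K0 (a : I * I) : 0 <= K by exact: le_trans (normr_ge0 _) (zeta_bound a a).
(* The diagonal term gives m_a^2 and the transposed one is split by 2 |x y| <= x^2 + y^2. Summed
   over a, both halves give the Frobenius norm, hence the factor 2 K = (4 C4 + 4) s^4. *)
have rowb a : \sum_b mm a * mm b * \int[P]_w (zeta a w * zeta b w) <=
    K * (mm a ^+ 2 + 2^-1 * (mm a ^+ 2 + mm (a.2, a.1) ^+ 2)).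
  have term b : mm a * mm b * \int[P]_w (zeta a w * zeta b w) <=
      K * `|mm a * mm b|.
    rewrite (le_trans (ler_norm _))// [leLHS]normrM [leLHS]mulrC ler_wpM2r//.
  have aswap : `|mm a * mm (a.2, a.1)| <= 2^-1 * (mm a ^+ 2 + mm (a.2, a.1) ^+ 2).
    exact: normM_le_sqr.
  have aa : `|mm a * mm a| = mm a ^+ 2 by rewrite -expr2 ger0_norm ?sqr_ge0.
  rewrite (bigD1 a)//= mulrDr lerD//; first by rewrite -aa.
  have [sa|sa] := eqVneq (a.2, a.1) a.
    rewrite big1 => [|b ba]; last by rewrite zeta_orth ?mulr0// sa.
    by rewrite mulr_ge0 ?(K0 a)// mulr_ge0// addr_ge0// sqr_ge0.
  rewrite (bigD1 (a.2, a.1))//= big1 ?addr0 => [|b /andP[ba bs]].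
    by rewrite (le_trans (term _))// ler_wpM2l ?(K0 a).
  by rewrite zeta_orth ?mulr0.
rewrite (le_trans (ler_sum _ (fun a _ => rowb a)))//.
have sw : \sum_a mm (a.2, a.1) ^+ 2 = \sum_a mm a ^+ 2.
  rewrite (reindex_inj (h := fun a : I * I => (a.2, a.1)))/=; last first.
    by move=> [x y] [x' y'] /= [-> ->].
  by apply: eq_bigr => -[].
rewrite -mulr_sumr big_split/= -mulr_sumr big_split/= sw pair_bigA/=.
set q := \sum_a _; rewrite [leLHS](_ : _ = (4 * C4 + 4) * s ^+ 4 * q)//.
by rewrite /K; field.
Qed.

Lemma linear_form_variance (z : I -> R) :
  (\int[P]_w ((\sum_i z i * xi i w) ^+ 2)%:E = (s ^+ 2 * \sum_i z i ^+ 2)%:E)%E.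
Proof.
have E w : (\sum_i z i * xi i w) ^+ 2 = \sum_i \sum_j z i * z j * (xi i w * xi j w).
  rewrite expr2 mulr_suml; apply: eq_bigr => i _.
  by rewrite mulr_sumr; apply: eq_bigr => j _; ring.
have ixx i j : P.-integrable setT (EFin \o (fun w => xi i w * xi j w)).
  apply: (@dominated_int _ 1); first exact: measurable_funM.
  move=> w; have := S2 i w; have := S2 j w; set x := xi i w; set y := xi j w.
  move=> ? ?; rewrite ler_norml; have := sqr_ge0 (x + y); have := sqr_ge0 (x - y).
  by move=> ? ?; apply/andP; split; nra.
have iij i j : P.-integrable setT (EFin \o (fun w => z i * z j * (xi i w * xi j w))).
  exact: (integrableZl measurableT _ (ixx i j)).
have ii i : P.-integrable setT
    (EFin \o (fun w => \sum_j z i * z j * (xi i w * xi j w))).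
  by apply: integrable_EFin_sum => b; exact: (iij i b).
have i0 : P.-integrable setT
    (EFin \o (fun w => \sum_i \sum_j z i * z j * (xi i w * xi j w))).
  by apply: integrable_EFin_sum => a; exact: (ii a).
under eq_integral do rewrite E.
rewrite EFin_Rintegral// Rintegral_sum// mulr_sumr; congr (_%:E).
apply: eq_bigr => i _.
rewrite Rintegral_sum// (bigD1 i)//= big1 ?addr0 => [|j ji].
  by rewrite RintegralZl//; under eq_Rintegral do rewrite -expr2; rewrite E2; ring.
rewrite RintegralZl// indep_mean0 ?mulr0//.
by apply: measurable_block; rewrite !inE.
Qed.

End quadratic_forms.

(** * Forms whose coefficients are independent of the noise *)

Section random_quadratic_form.
Context d d1 d2 (T : measurableType d) (U1 : measurableType d1)
  (U2 : measurableType d2) (R : realType) (P : probability T R).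
Variables (Z1 : T -> U1) (Z2 : T -> U2).
Hypothesis mZ1 : measurable_fun [set: T] Z1.
Hypothesis mZ2 : measurable_fun [set: T] Z2.
Hypothesis indZ : independent2 P Z1 Z2.
Context (n : nat) (xi : 'I_n -> U2 -> R) (s C4 : R).
Hypothesis mxi : forall i, measurable_fun [set: U2] (xi i).
Hypothesis indxi : mutually_independent P (fun i => xi i \o Z2).
Hypothesis xi4 : forall i, P.-integrable setT (fun w => (xi i (Z2 w) ^+ 4)%:E).
Hypothesis E1 : forall i, \int[P]_w xi i (Z2 w) = 0.
Hypothesis E2 : forall i, \int[P]_w (xi i (Z2 w) ^+ 2) = s ^+ 2.
Hypothesis E4 : forall i, \int[P]_w (xi i (Z2 w) ^+ 4) <= C4 * s ^+ 4.
Hypothesis C40 : 0 <= C4.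

(** With [Z1] frozen the coefficients are constants, and the deterministic bound is uniform in [Z1]
    because b is. *)
Lemma random_quadratic_form_variance (M : 'I_n -> 'I_n -> U1 -> R) (b : R) :
  (forall i j, measurable_fun [set: U1] (M i j)) ->
  (forall x, \sum_i \sum_j M i j x ^+ 2 <= b) ->
  (\int[P]_w ((\sum_i \sum_j M i j (Z1 w) *
     (xi i (Z2 w) * xi j (Z2 w) - (i == j)%:R * s ^+ 2)) ^+ 2)%:E
   <= ((4 * C4 + 4) * s ^+ 4 * b)%:E)%E.
Proof.
move=> mM Mb.
pose F (z : U1 * U2) := ((\sum_i \sum_j M i j z.1 *
     (xi i z.2 * xi j z.2 - (i == j)%:R * s ^+ 2)) ^+ 2)%:E.
have mF : measurable_fun [set: U1 * U2] F.
  apply/measurable_EFinP; apply: measurable_funX.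
  apply: measurable_sum => i; apply: measurable_sum => j.
  have m1 k : measurable_fun [set: U1 * U2] (fun z => xi k z.2).
    by apply: measurableT_comp => //; exact: measurable_snd.
  apply: measurable_funM.
    by apply: measurableT_comp => //; exact: measurable_fst.
  by apply: measurable_funB => //; exact: measurable_funM.
have F0 z : (0 <= F z)%E by rewrite lee_fin sqr_ge0.
rewrite (independent2_tonelli mZ1 mZ2 indZ mF F0).
rewrite -(integral_cst_probability P).
apply: ge0_le_integral => //.
- by move=> w _; exact: integral_ge0.
- exact: (measurable_integral_pair P mZ1 mZ2 mF F0).
- move=> w _.
  have h := @quadratic_form_variance _ T R P _ (fun i => xi i \o Z2) s C4
    (fun i => measurableT_comp (mxi i) mZ2) indxi xi4 E1 E2 E4
    (fun i j => M i j (Z1 w)).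
  apply: (le_trans h); rewrite lee_fin ler_wpM2l//.
  by rewrite mulr_ge0 ?exprn_even_ge0// addr_ge0// mulr_ge0.
Qed.

Lemma random_linear_form_variance (z : 'I_n -> U1 -> R) :
  (forall i, measurable_fun [set: U1] (z i)) ->
  (\int[P]_w ((\sum_i z i (Z1 w) * xi i (Z2 w)) ^+ 2)%:E =
   (s ^+ 2)%:E * \int[P]_w (\sum_i z i (Z1 w) ^+ 2)%:E)%E.
Proof.
move=> mz.
pose F (x : U1 * U2) := ((\sum_i z i x.1 * xi i x.2) ^+ 2)%:E.
have mF : measurable_fun [set: U1 * U2] F.
  apply/measurable_EFinP; apply: measurable_funX.
  apply: measurable_sum => i; apply: measurable_funM.
    by apply: measurableT_comp => //; exact: measurable_fst.
  by apply: measurableT_comp => //; exact: measurable_snd.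
have F0 x : (0 <= F x)%E by rewrite lee_fin sqr_ge0.
rewrite (independent2_tonelli mZ1 mZ2 indZ mF F0).
rewrite -ge0_integralZl//.
- apply: eq_integral => w _.
  rewrite (@linear_form_variance _ T R P _ (fun i => xi i \o Z2) s
    (fun i => measurableT_comp (mxi i) mZ2) indxi xi4 E1 E2 (fun i => z i (Z1 w))).
  by rewrite EFinM.
- apply/measurable_EFinP; apply: measurable_sum => i; apply: measurable_funX.
  exact: measurableT_comp.
- by move=> w _; rewrite lee_fin sumr_ge0// => i _; exact: sqr_ge0.
- by rewrite lee_fin sqr_ge0.
Qed.

End random_quadratic_form.

(** * Nondegenerate minors of independent atomless entries *)

Section atomless_affine.
Context d d1 d2 (T : measurableType d) (U1 : measurableType d1)
  (U2 : measurableType d2) (R : realType) (P : probability T R).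
Variables (Z1 : T -> U1) (Z2 : T -> U2).
Hypothesis mZ1 : measurable_fun [set: T] Z1.
Hypothesis mZ2 : measurable_fun [set: T] Z2.
Hypothesis indZ : independent2 P Z1 Z2.

(** For frozen [Z1] with nonzero slope the equation forces v to take the single value - b / a, which
    has probability zero. *)
Lemma atomless_affine_eq0 (a b : U1 -> R) (v : U2 -> R) :
  measurable_fun [set: U1] a -> measurable_fun [set: U1] b ->
  measurable_fun [set: U2] v -> (forall x, P ((v \o Z2) @^-1` [set x]) = 0%E) ->
  P [set w | a (Z1 w) != 0 /\ v (Z2 w) * a (Z1 w) + b (Z1 w) = 0] = 0%E.
Proof.
move=> ma mb mv v0.
pose G : set (U1 * U2) := [set z | a z.1 != 0 /\ v z.2 * a z.1 + b z.1 = 0].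
have ma1 : measurable_fun [set: U1 * U2] (fun z => a z.1).
  by apply: measurableT_comp => //; exact: measurable_fst.
have mab : measurable_fun [set: U1 * U2] (fun z => v z.2 * a z.1 + b z.1).
  apply: measurable_funD.
    apply: measurable_funM => //.
    by apply: measurableT_comp => //; exact: measurable_snd.
  by apply: measurableT_comp => //; exact: measurable_fst.
have mG : measurable G.
  have -> : G = ~` ((fun z => a z.1) @^-1` [set 0]) `&`
      (fun z => v z.2 * a z.1 + b z.1) @^-1` [set 0].
    by apply/seteqP; split => z /= [h1 h2]; split => //; apply/eqP.
  apply: measurableI.
    by apply: measurableC; exact: measurable_preimage.
  exact: measurable_preimage.
set A := [set w | _].
have -> : A = (fun w => (Z1 w, Z2 w)) @^-1` G by [].
have mA : measurable ((fun w => (Z1 w, Z2 w)) @^-1` G).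
  by apply: measurable_preimage => //; exact: measurable_fun_pair.
rewrite -[X in P X]setIT -integral_indic//.
have := @independent2_tonelli _ _ _ T U1 U2 R P Z1 Z2 mZ1 mZ2 indZ
  (fun z => (\1_G z : R)%:E).
rewrite (_ : (fun w => (\1_G (Z1 w, Z2 w))%:E) =
  (fun w => (\1_((fun w => (Z1 w, Z2 w)) @^-1` G) w)%:E)); last first.
  by apply/funext => w; rewrite !indicE.
move=> ->//; last first.
  by apply/measurable_EFinP; exact: measurable_indic.
apply: integral0_eq => w _.
have [aw|aw] := eqVneq (a (Z1 w)) 0.
  apply: integral0_eq => w' _; rewrite indicE memNset//= => -[].
  by rewrite aw eqxx.
have mvx : measurable ((v \o Z2) @^-1` [set - b (Z1 w) / a (Z1 w)]).
  by apply: measurable_preimage => //; exact: measurableT_comp.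
transitivity (P ((v \o Z2) @^-1` [set - b (Z1 w) / a (Z1 w)] `&` setT)); last first.
  by rewrite setIT; exact: v0.
rewrite -(integral_indic P measurableT mvx).
apply: eq_integral => w' _; rewrite !indicE; congr ((nat_of_bool _)%:R%:E).
apply/idP/idP => h; apply/mem_set; move/set_mem: h => /=.
  by case=> _ /eqP; rewrite addr_eq0 => /eqP h; rewrite -h mulfK.
by move=> h; split => //; rewrite h divfK// addNr.
Qed.

End atomless_affine.

Lemma measurable_det d (U : measurableType d) (R : realType) k
    (A : U -> 'M[R]_k) :
  (forall i j, measurable_fun [set: U] (fun w => A w i j)) ->
  measurable_fun [set: U] (fun w => \det (A w)).
Proof.
move=> mA; rewrite /determinant; apply: measurable_sum => s.
by apply: measurable_funM => //; apply: measurable_prod => i _.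
Qed.

Section leading_minors.
Context d (T : measurableType d) (R : realType) (P : probability T R).
Context (I : finType) (V : I -> T -> R).
Hypothesis mV : forall i, measurable_fun [set: T] (V i).
Hypothesis indV : mutually_independent P V.
Hypothesis V0 : forall i x, P (V i @^-1` [set x]) = 0%E.
Context (N : nat) (e : nat -> nat -> I).
Hypothesis e_inj : forall i j i' j', (i < N)%N -> (j < N)%N -> (i' < N)%N -> (j' < N)%N ->
  e i j = e i' j' -> (i, j) = (i', j').

Let A k w : 'M[R]_k := \matrix_(i < k, j < k) V (e i j) w.

(** Induction on k. Expanded along its last row, the determinant is affine in the corner entry, with
    the previous leading minor as slope. The corner is atomless and independent of all other
    entries, and the slope is almost surely nonzero. *)
Lemma leading_minor_neq0 k : (k <= N)%N ->
  P [set w | \det (\matrix_(i < k, j < k) V (e i j) w) = 0] = 0%E.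
Proof.
rewrite -/(A k _); elim: k => [_|k IH kN].
  rewrite (_ : [set _ | _] = set0) ?measure0//.
  apply/seteqP; split => // w /=; rewrite det_mx00 => /eqP.
  by rewrite oner_eq0.
have mdet k' : measurable_fun [set: T] (fun w => \det (A k' w)).
  apply: measurable_det => i j; rewrite (_ : (fun w => _) = V (e i j))//.
  by apply/funext => w; rewrite mxE.
pose b w := \sum_(j < k.+1 | j != ord_max) A k.+1 w ord_max j * cofactor (A k.+1 w) ord_max j.
have cofE w : cofactor (A k.+1 w) ord_max ord_max = \det (A k w).
  rewrite /cofactor addnn -signr_odd odd_double expr0 mul1r; congr (\det _).
  by apply/matrixP => i j; rewrite !mxE !lift_max.
have detE w : \det (A k.+1 w) = V (e k k) w * \det (A k w) + b w.
  by rewrite (expand_det_row _ ord_max) (bigD1 ord_max)//= cofE mxE.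
(* All entries but the corner. The slope and the intercept [b] are measurable for this block because
   the cofactors in the last row delete that row, and [b] skips the corner. *)
pose J := (~: [set e k k])%SET.
have mZ1 := measurable_block_id mV (J := J).
have mZ2 := measurable_block_id mV (J := (~: J)%SET).
have indZ := independent_blocks mV indV (J := J).
have mVb i j : (i < N)%N -> (j < N)%N -> (i, j) != (k, k) ->
    measurable_fun [set: block V J] (V (e i j) : block V J -> R).
  move=> iN jN ij; apply: measurable_block; rewrite !inE.
  by apply: contraNneq ij => /e_inj ->.
have mdetk : measurable_fun [set: block V J] (fun w : block V J => \det (A k w)).
  apply: measurable_det => i j; rewrite (_ : (fun w => _) = V (e i j)); last first.
    by apply/funext => w; rewrite mxE.
  apply: mVb; rewrite ?(leq_trans (ltn_ord _))// ?(ltnW kN)//.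
  by rewrite xpair_eqE ltn_eqF.
have mA i j : (i, j) != (ord_max, ord_max) -> measurable_fun [set: block V J]
    (fun w : block V J => A k.+1 w i j).
  move=> ij; rewrite (_ : (fun w => _) = V (e i j)); last first.
    by apply/funext => w; rewrite mxE.
  apply: mVb; rewrite ?(leq_trans (ltn_ord _))//.
have mb : measurable_fun [set: block V J] (b : block V J -> R).
  rewrite (_ : b = fun w => \sum_(j < k.+1) (if j != ord_max then
      A k.+1 w ord_max j * cofactor (A k.+1 w) ord_max j else 0)); last first.
    by apply/funext => w; rewrite /b big_mkcond.
  apply: measurable_sum => j; have [jm|jm] := boolP (j != ord_max) => //.
  apply: measurable_funM; first by apply: mA; rewrite xpair_eqE eqxx.
  apply: measurable_funM => //; apply: measurable_det => i l.
  rewrite (_ : (fun w => _) = (fun w : block V J => A k.+1 w (lift ord_max i) (lift j l))).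
    by apply: mA; rewrite xpair_eqE negb_and eq_sym neq_lift.
  by apply/funext => w; rewrite !mxE.
have mv : measurable_fun [set: block V (~: J)] (V (e k k) : block V (~: J) -> R).
  by apply: measurable_block; rewrite !inE negbK.
have h0 := atomless_affine_eq0 mZ1 mZ2 indZ mdetk mb mv (V0 (e k k)).
apply/eqP; rewrite eq_le measure_ge0 andbT.
(* The event is covered by a vanishing slope, null by induction, and by the corner being the root of
   an affine equation with nonzero slope. *)
rewrite -[leRHS](adde0 0%E) -{1}(IH (ltnW kN)) -[in leRHS]h0.
have m1 : measurable [set w | \det (A k w) = 0] by exact: measurable_eq_cst.
have m2 : measurable [set w | \det (A k w) != 0 /\ V (e k k) w * \det (A k w) + b w = 0].
  rewrite (_ : [set _ | _] = ~` [set w | \det (A k w) = 0] `&` [set w | \det (A k.+1 w) = 0]).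
    by apply: measurableI; [exact: measurableC|exact: measurable_eq_cst].
  by apply/seteqP; split => w /=; rewrite detE => -[h1 h2]; split => //; apply/eqP.
apply: le_trans (measureU2 P m1 m2).
apply: le_measure; rewrite ?inE.
- exact: measurable_eq_cst.
- exact: measurableU.
move=> w /= h; have [|h1] := eqVneq (\det (A k w)) 0; first by left.
by right; split => //; rewrite -detE.
Qed.

End leading_minors.

(** * Least squares and the residual projection *)

Section least_squares.
Context (R : realFieldType).

Definition sqn n (v : 'cV[R]_n) : R := \sum_i v i 0 ^+ 2.

Lemma sqnE n (v : 'cV[R]_n) : sqn v = (v^T *m v) 0 0.
Proof. by rewrite mxE; apply: eq_bigr => i _; rewrite mxE expr2. Qed.

Lemma sqn_ge0 n (v : 'cV[R]_n) : 0 <= sqn v.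
Proof. by apply: sumr_ge0 => i _; exact: sqr_ge0. Qed.

Lemma sqn_eq0 n (v : 'cV[R]_n) : sqn v = 0 -> v = 0.
Proof.
move=> /eqP; rewrite psumr_eq0 => [/allP h|i _]; last exact: sqr_ge0.
apply/colP => i; rewrite !mxE; apply/eqP.
by have := h i (mem_index_enum i); rewrite /= sqrf_eq0.
Qed.

Lemma sqnD n (u v : 'cV[R]_n) : sqn (u + v) = sqn u + 2 * (u^T *m v) 0 0 + sqn v.
Proof.
rewrite /sqn mxE mulr_sumr -!big_split/=; apply: eq_bigr => i _.
by rewrite !mxE; ring.
Qed.

Context (n k : nat) (A : 'M[R]_(n, k)).

(* At a singular Gram matrix the inverse of the determinant is 0, so that the
   residual projection is the identity there; it is total and measurable. *)
Definition gram_inv : 'M[R]_k := (\det (A^T *m A))^-1 *: \adj (A^T *m A).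

Definition resid_proj : 'M[R]_n := 1%:M - A *m gram_inv *m A^T.

Lemma gram_inv_tr : gram_inv^T = gram_inv.
Proof. by rewrite /gram_inv linearZ/= trmx_adj trmx_mul trmxK. Qed.

Lemma resid_proj_tr : resid_proj^T = resid_proj.
Proof.
by rewrite /resid_proj linearB/= trmx1 !trmx_mul trmxK gram_inv_tr mulmxA.
Qed.

Lemma gram_inv_eq0 : \det (A^T *m A) = 0 -> gram_inv = 0.
Proof. by move=> h; rewrite /gram_inv h invr0 scale0r. Qed.

Lemma mul_gram_inv : \det (A^T *m A) != 0 -> gram_inv *m (A^T *m A) = 1%:M.
Proof.
by move=> h; rewrite /gram_inv -scalemxAl mul_adj_mx scale_scalar_mx mulVf.
Qed.

Lemma resid_proj_mul : \det (A^T *m A) != 0 -> resid_proj *m A = 0.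
Proof.
move=> h; rewrite /resid_proj mulmxBl mul1mx -!mulmxA mul_gram_inv// mulmx1.
by rewrite subrr.
Qed.

Lemma resid_proj_idem : resid_proj *m resid_proj = resid_proj.
Proof.
have [h|h] := eqVneq (\det (A^T *m A)) 0.
  by rewrite /resid_proj gram_inv_eq0// mulmx0 mul0mx subr0 mulmx1.
by rewrite {2}/resid_proj mulmxBr mulmx1 !mulmxA resid_proj_mul// !mul0mx subr0.
Qed.

Lemma resid_proj_trace : \det (A^T *m A) != 0 -> \tr resid_proj = n%:R - k%:R.
Proof.
move=> h; rewrite /resid_proj linearB/= !mxtrace1 -mulmxA mxtrace_mulC -mulmxA.
by rewrite mul_gram_inv// mxtrace1.
Qed.

(** The squared Frobenius norm of a symmetric idempotent matrix is its trace. It is the factor in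
    the variance of the quadratic form. *)
Lemma resid_proj_sum_sqr : \sum_i \sum_j resid_proj i j ^+ 2 = \tr resid_proj.
Proof.
rewrite -[in RHS]resid_proj_idem; apply: eq_bigr => i _.
rewrite mxE; apply: eq_bigr => j _.
by rewrite expr2; congr (_ * _); rewrite -[in LHS]resid_proj_tr mxE.
Qed.

Lemma resid_proj_sum_sqr_le : \sum_i \sum_j resid_proj i j ^+ 2 <= n%:R.
Proof.
rewrite resid_proj_sum_sqr; have [h|h] := eqVneq (\det (A^T *m A)) 0.
  by rewrite /resid_proj gram_inv_eq0// mulmx0 mul0mx subr0 mxtrace1.
by rewrite resid_proj_trace// lerBlDr lerDl.
Qed.

Lemma resid_proj_sqn (v : 'cV[R]_n) :
  sqn (resid_proj *m v) = \sum_i \sum_j resid_proj i j * (v i 0 * v j 0).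
Proof.
rewrite sqnE trmx_mul resid_proj_tr -mulmxA (mulmxA resid_proj) resid_proj_idem.
rewrite mxE; apply: eq_bigr => i _; rewrite !mxE mulr_sumr.
by apply: eq_bigr => j _; ring.
Qed.

Lemma resid_proj_sqn_le (v : 'cV[R]_n) : sqn (resid_proj *m v) <= sqn v.
Proof.
pose r := v - resid_proj *m v.
have e : v = resid_proj *m v + r by rewrite addrC subrK.
rewrite [in leRHS]e sqnD [X in 2 * X](_ : _ = 0).
  by rewrite mulr0 addr0 lerDl sqn_ge0.
rewrite trmx_mul resid_proj_tr mulmxBr -!mulmxA (mulmxA resid_proj) resid_proj_idem.
by rewrite subrr mxE.
Qed.

Lemma least_squares_ge (v : 'cV[R]_n) (b : 'cV[R]_k) : \det (A^T *m A) != 0 ->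
  sqn (resid_proj *m v) <= sqn (v - A *m b).
Proof.
move=> h; apply: le_trans (resid_proj_sqn_le (v - A *m b)).
by rewrite mulmxBr mulmxA resid_proj_mul// mul0mx subr0.
Qed.

Lemma least_squares_attained (v : 'cV[R]_n) :
  exists b : 'cV[R]_k, sqn (v - A *m b) = sqn (resid_proj *m v).
Proof.
exists (gram_inv *m A^T *m v); congr sqn.
by rewrite /resid_proj mulmxBl mul1mx !mulmxA.
Qed.

(** A null vector of the Gram matrix is a null vector of A, since its quadratic form is |A v|^2, and
    hence of any square matrix formed by rows of A. *)
Lemma gram_det_neq0 (f : 'I_k -> 'I_n) :
  \det (\matrix_(i, j) A (f i) j) != 0 -> \det (A^T *m A) != 0.
Proof.
apply: contra_neq => /eqP/det0P[v v0 vG]; apply/eqP; rewrite -det_tr.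
apply/det0P; exists v => //.
have Av : A *m v^T = 0.
  apply: sqn_eq0.
  by rewrite sqnE trmx_mul trmxK !mulmxA -(mulmxA v) vG mul0mx mxE.
apply/rowP => i; rewrite !mxE.
move/matrixP/(_ (f i) 0) : Av; rewrite !mxE => Av.
rewrite -[RHS]Av; apply: eq_bigr => j _; rewrite !mxE mulrC//.
Qed.

End least_squares.

Lemma measurable_invr (R : realType) : measurable_fun [set: R] (fun x : R => x^-1).
Proof.
rewrite -(setvU [set 0 : R]).
apply/measurable_funU => //; first exact: measurableC.
split; last exact: measurable_fun_set1.
apply: open_continuous_measurable_fun.
  by rewrite openC; exact: closed_eq.
by move=> x; rewrite inE/= => /eqP x0; exact: inv_continuous.
Qed.

Lemma measurable_resid_proj d (U : measurableType d) (R : realType) n k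
    (A : U -> 'M[R]_(n, k)) :
  (forall i j, measurable_fun [set: U] (fun w => A w i j)) ->
  forall i j, measurable_fun [set: U] (fun w => resid_proj (A w) i j).
Proof.
move=> mA i j.
have mM m1 m2 m3 (B : U -> 'M[R]_(m1, m2)) (C : U -> 'M[R]_(m2, m3)) :
    (forall i j, measurable_fun [set: U] (fun w => B w i j)) ->
    (forall i j, measurable_fun [set: U] (fun w => C w i j)) ->
    forall i j, measurable_fun [set: U] (fun w => (B w *m C w) i j).
  move=> mB mC i' j'; under eq_fun do rewrite mxE.
  by apply: measurable_sum => l; exact: measurable_funM.
have mT i' j' : measurable_fun [set: U] (fun w => (A w)^T i' j').
  by rewrite (_ : (fun _ => _) = fun w => A w j' i')//; apply/funext => w; rewrite mxE.
have mG := mM _ _ _ _ _ mT mA.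
have mI i' j' : measurable_fun [set: U] (fun w => gram_inv (A w) i' j').
  rewrite (_ : (fun _ => _) = fun w =>
      (\det ((A w)^T *m A w))^-1 * cofactor ((A w)^T *m A w) j' i'); last first.
    by apply/funext => w; rewrite 2!mxE.
  apply: measurable_funM.
    by apply: measurableT_comp; [exact: measurable_invr|exact: measurable_det].
  apply: measurable_funM => //; apply: measurable_det => a b.
  rewrite (_ : (fun _ => _) = fun w => ((A w)^T *m A w) (lift j' a) (lift i' b))//.
  by apply/funext => w; rewrite 2!mxE.
have h := mM _ _ _ _ _ (mM _ _ _ _ _ mA mI) mT i j.
rewrite (_ : (fun w => _) = (fun w => (1%:M : 'M[R]_n) i j - (A w *m gram_inv (A w) *m (A w)^T) i j)).
  exact: measurable_funB.
by apply/funext => w; rewrite /resid_proj !mxE.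
Qed.

(** * Independence of functions of disjoint blocks *)

Section disjoint_blocks.
Context d (T : measurableType d) (R : realType) (P : probability T R).
Context (I : finType) (V : I -> T -> R).
Hypothesis mV : forall i, measurable_fun [set: T] (V i).
Hypothesis indV : mutually_independent P V.

Lemma measurable_block_sub (J J' : {set I}) (f : T -> R) : J \subset J' ->
  measurable_fun [set: block V J] (f : block V J -> R) ->
  measurable_fun [set: block V J'] (f : block V J' -> R).
Proof.
move=> JJ mf _ B mB; have := mf measurableT B mB; rewrite !setTI.
apply: sub_sigma_algebra2 => _ [C [mC CT ->]]; exists C; split => // i iJ'.
by apply: CT; apply: contra iJ'; exact: (fintype.subsetP JJ).
Qed.

(** Induction on a list of indices: the event of the remaining functions lies in the block
    complementary to [J k], so one factor splits off at a time. *)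
Lemma independent_disjoint_blocks (K : finType) (J : K -> {set I}) (f : K -> T -> R) :
  (forall k l, k != l -> J k \subset (~: J l)%SET) ->
  (forall k, measurable_fun [set: block V (J k)] (f k : block V (J k) -> R)) ->
  mutually_independent P f.
Proof.
move=> dJ mf B mB.
suff h r : uniq r -> P [set w | forall k, k \in r -> B k (f k w)] =
    (\prod_(k <- r) P (f k @^-1` B k))%E.
  rewrite -(h (index_enum K) (index_enum_uniq K)); congr (P _).
  apply/seteqP; split => [w Bw k _|w Bw k _]; first exact: Bw.
  by apply: Bw; exact: mem_index_enum.
elim: r => [_|k r IH /= /andP[kr ur]].
  rewrite big_nil (_ : [set _ | _] = setT); first exact: probability_setT.
  by apply/seteqP; split => // w _ k; rewrite in_nil.
rewrite big_cons -IH//.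
rewrite (_ : [set _ | _] = f k @^-1` B k `&` [set w | forall k, k \in r -> B k (f k w)]).
  have mA : measurable (f k @^-1` B k : set (block V (J k))).
    exact: measurable_preimage.
  suff mA' : measurable ([set w | forall k, k \in r -> B k (f k w)] : set (block V (~: J k))).
    exact: (independent_blocks mV indV mA mA').
  have : {subset r <= r} by [].
  move: {-2}r => r'; elim: r' => [_|l r' IHr sub].
    by rewrite (_ : [set _ | _] = setT)//; apply/seteqP; split.
  rewrite (_ : [set _ | _] = f l @^-1` B l `&` [set w | forall k, k \in r' -> B k (f k w)]).
    apply: measurableI; last first.
      by apply: IHr => x xr; apply: sub; rewrite inE xr orbT.
    have lk : k != l by apply: contraNneq kr => ->; apply: sub; rewrite mem_head.
    have := @measurable_block_sub (J l) (~: J k)%SET (f l) _ (mf l) measurableT _ (mB l).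
    rewrite setTI; apply.
    by apply: dJ; rewrite eq_sym.
  apply/seteqP; split => [w h|w [h1 h2] x].
    by split => [|x xr]; apply: h; rewrite inE ?eqxx// xr orbT.
  by rewrite inE => /orP[/eqP ->|]; [exact: h1|exact: h2].
apply/seteqP; split => [w h|w [h1 h2] x].
  by split => [|x xr]; apply: h; rewrite inE ?eqxx// xr orbT.
by rewrite inE => /orP[/eqP ->|]; [exact: h1|exact: h2].
Qed.

End disjoint_blocks.

(** * Moments of a linear form in independent variables *)

Section linear_forms.
Context d (T : measurableType d) (R : realType) (P : probability T R).
Context (I : finType) (V : I -> T -> R) (C4 : R).
Hypothesis mV : forall i, measurable_fun [set: T] (V i).
Hypothesis indV : mutually_independent P V.
Hypothesis V4 : forall i, P.-integrable setT (fun w => (V i w ^+ 4)%:E).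
Hypothesis E1 : forall i, \int[P]_w V i w = 0.
Hypothesis E2 : forall i, \int[P]_w (V i w ^+ 2) = 1.
Hypothesis E4 : forall i, \int[P]_w (V i w ^+ 4) <= C4.
Variable a : I -> R.

Let L w := \sum_i a i * V i w.
Let s2 := \sum_i a i ^+ 2.

Lemma measurable_linear_form : measurable_fun [set: T] L.
Proof. by apply: measurable_sum => i; exact: measurable_funM. Qed.

Let mL := measurable_linear_form.

Lemma linear_form_mean : \int[P]_w L w = 0.
Proof.
have iV i : P.-integrable setT (EFin \o V i).
  apply: (@le_integrable _ _ _ P setT measurableT _ (fun w => (1 + V i w ^+ 4)%:E)).
  - exact/measurable_EFinP.
  - move=> w _ /=; rewrite lee_fin [leRHS]ger0_norm; last first.
      by rewrite addr_ge0// exprn_even_ge0.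
    rewrite (exprM _ 2 2); set x := V i w.
    have h1 : 0 <= (x ^+ 2 - 1) ^+ 2 by exact: sqr_ge0.
    have h2 : 0 <= (x - 1) ^+ 2 by exact: sqr_ge0.
    have h3 : 0 <= (x + 1) ^+ 2 by exact: sqr_ge0.
    have h4 : 0 <= x ^+ 2 by exact: sqr_ge0.
    move: h1 h2 h3 h4; rewrite !expr2 => h1 h2 h3 h4.
    by rewrite ler_norml; apply/andP; split; nra.
  - exact: (integrableD measurableT (finite_measure_integrable_cst P 1 measurableT) (V4 i)).
rewrite Rintegral_sum => [|i]; last exact: (integrableZl measurableT _ (iV i)).
by apply: big1 => i _; rewrite RintegralZl// E1 mulr0.
Qed.

Let var1 : forall i, \int[P]_w (V i w ^+ 2) = 1 ^+ 2.
Proof. by move=> i; rewrite expr1n. Qed.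

Let kurt1 : forall i, \int[P]_w (V i w ^+ 4) <= C4 * 1 ^+ 4.
Proof. by move=> i; rewrite expr1n mulr1. Qed.

Lemma linear_form_moment2 : \int[P]_w (L w ^+ 2) = s2.
Proof.
rewrite /Rintegral (linear_form_variance mV indV V4 E1 var1 a).
by rewrite expr1n mul1r.
Qed.

Let K := 2 * (4 * C4 + 4) + 2.

(** The difference L^2 - s2 is the centred quadratic form of the matrix a_i a_j, whose squared norm
    is s2^2, and L^4 <= 2 (L^2 - s2)^2 + 2 s2^2. The ratio of the fourth moment to the squared
    variance is thus bounded whatever the number of terms. *)
Let int4 : (\int[P]_w (L w ^+ 4)%:E <= (K * s2 ^+ 2)%:E)%E.
Proof.
have h := quadratic_form_variance mV indV V4 E1 var1 kurt1 (fun i j => a i * a j).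
have e w : \sum_i \sum_j a i * a j * (V i w * V j w - (i == j)%:R * 1 ^+ 2) = L w ^+ 2 - s2.
  rewrite [L w ^+ 2]expr2 mulr_suml -sumrB; apply: eq_bigr => i _.
  rewrite /L (bigD1 i)//= [in RHS](bigD1 i)//= eqxx.
  rewrite (eq_bigr (fun j => a i * V i w * (a j * V j w))) => [|j ji].
    by rewrite -mulr_sumr mulr1n; ring.
  by rewrite eq_sym (negbTE ji) mulr0n; ring.
have e2 : \sum_i \sum_j (a i * a j) ^+ 2 = s2 ^+ 2.
  rewrite [RHS]expr2 mulr_suml; apply: eq_bigr => i _; rewrite mulr_sumr.
  by apply: eq_bigr => j _; rewrite exprMn.
rewrite e2 (expr1n _ 4) mulr1 in h.
have mq : measurable_fun [set: T] (fun w => ((L w ^+ 2 - s2) ^+ 2)%:E).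
  by apply/measurable_EFinP; apply: measurable_funX; apply: measurable_funB => //; exact: measurable_funX.
have : (\int[P]_w (L w ^+ 4)%:E <=
    \int[P]_w ((2 * (L w ^+ 2 - s2) ^+ 2)%:E + (2 * s2 ^+ 2)%:E))%E.
  apply: ge0_le_integral => //.
  - by move=> w _; rewrite lee_fin exprn_even_ge0.
  - by apply/measurable_EFinP; exact: measurable_funX.
  - apply: emeasurable_funD => //; apply/measurable_EFinP.
    by apply: measurable_funM => //; exact/measurable_EFinP.
  - move=> w _; rewrite -EFinD lee_fin (exprM _ 2 2).
    by have := sqr_ge0 (L w ^+ 2 - 2 * s2); rewrite !expr2; nra.
move=> /le_trans; apply.
rewrite ge0_integralD//; first last.
- by move=> w _; rewrite lee_fin mulr_ge0// sqr_ge0.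
- by apply/measurable_EFinP; apply: measurable_funM => //; exact/measurable_EFinP.
- by move=> w _; rewrite lee_fin mulr_ge0// sqr_ge0.
rewrite integral_cst_probability; under eq_integral do rewrite EFinM.
rewrite ge0_integralZl//; last by move=> w _; rewrite lee_fin sqr_ge0.
under eq_integral do rewrite -e.
apply: (@le_trans _ _ (2%:E * ((4 * C4 + 4) * s2 ^+ 2)%:E + (2 * s2 ^+ 2)%:E)%E).
  by rewrite leeD2r// lee_wpmul2l// lee_fin.
by rewrite -EFinM -EFinD lee_fin /K; lra.
Qed.

Lemma linear_form_integrable4 : P.-integrable setT (fun w => (L w ^+ 4)%:E).
Proof.
apply/integrableP; split; first by apply/measurable_EFinP; exact: measurable_funX.
under eq_integral do rewrite gee0_abs ?lee_fin ?exprn_even_ge0//.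
by apply: le_lt_trans int4 _; rewrite ltry.
Qed.

Lemma linear_form_moment4 : \int[P]_w (L w ^+ 4) <= K * s2 ^+ 2.
Proof. by have := int4; rewrite EFin_Rintegral ?lee_fin//; exact: linear_form_integrable4. Qed.

End linear_forms.

(** * Gram-Schmidt for the covariance form *)

Section gram_schmidt.
Context (R : rcfType) (p : nat) (Sigma : 'M[R]_p).
Hypothesis Sigma_sym : Sigma^T = Sigma.
Hypothesis Sigma_pos : forall a : 'cV[R]_p, a != 0 -> 0 < (a^T *m Sigma *m a) 0 0.

Definition ip (S : 'M[R]_p) (u v : 'cV[R]_p) : R := (u^T *m S *m v) 0 0.

Let ipS := ip Sigma.

Lemma ipC u v : ipS u v = ipS v u.
Proof.
rewrite /ipS /ip; transitivity ((u^T *m Sigma *m v)^T 0 0); first by rewrite [RHS]mxE.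
by rewrite !trmx_mul trmxK Sigma_sym mulmxA.
Qed.

Lemma ipDl u v w : ipS (u + v) w = ipS u w + ipS v w.
Proof. by rewrite /ipS /ip linearD/= !mulmxDl mxE. Qed.

Lemma ipZl a u w : ipS (a *: u) w = a * ipS u w.
Proof. by rewrite /ipS /ip linearZ/= -!scalemxAl mxE. Qed.

Lemma ipBl u v w : ipS (u - v) w = ipS u w - ipS v w.
Proof. by rewrite ipDl -scaleN1r ipZl mulN1r. Qed.

Lemma ip_suml (I : Type) (r : seq I) (F : I -> 'cV[R]_p) w :
  ipS (\sum_(i <- r) F i) w = \sum_(i <- r) ipS (F i) w.
Proof.
elim: r => [|i r IH]; last by rewrite !big_cons ipDl IH.
by rewrite !big_nil -(scale0r 0) ipZl mul0r.
Qed.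

Definition below k (u : 'cV[R]_p) := forall j : 'I_p, (k <= j)%N -> u j 0 = 0.

(** The last clause holds for every l, so a single basis is adapted to all nested models at once. *)
Definition orthonormal_flag (c : nat -> 'cV[R]_p) k :=
  [/\ forall i j, (i < k)%N -> (j < k)%N -> ipS (c i) (c j) = (i == j)%:R,
      forall j, (j < k)%N -> below j.+1 (c j) &
      forall l u, (l <= k)%N -> below l u -> u = \sum_(j < l) ipS u (c j) *: c j].

Lemma belowW k l u : (k <= l)%N -> below k u -> below l u.
Proof. by move=> kl h j lj; apply: h; exact: leq_trans lj. Qed.

Lemma below_sum l (c : nat -> 'cV[R]_p) (t : nat -> R) :
  (forall j, (j < l)%N -> below j.+1 (c j)) -> below l (\sum_(j < l) t j *: c j).
Proof.
move=> h i li; rewrite summxE big1// => j _.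
by rewrite mxE h ?mulr0// (leq_trans _ li).
Qed.

Lemma gram_schmidt k : (k <= p)%N -> exists c, orthonormal_flag c k.
Proof.
elim: k => [_|k IH kp].
  exists (fun=> 0); split => // l u; rewrite leqn0 => /eqP -> u0.
  by rewrite big_ord0; apply/colP => j; rewrite u0// mxE.
have [c [orth cb span]] := IH (ltnW kp).
pose ek : 'cV[R]_p := delta_mx (Ordinal kp) 0.
pose proj := \sum_(j < k) ipS ek (c j) *: c j.
(* The projection lives on the earlier coordinates, so v keeps the entry 1 at coordinate k and
   cannot vanish. *)
pose v := ek - proj.
have projk : below k proj by apply: (below_sum (fun j => ipS ek (c j))).
have vk : v (Ordinal kp) 0 = 1.
  by rewrite !mxE !eqxx/= -/proj projk// subr0.
have v0 : v != 0 by apply: contra_eq_neq vk => ->; rewrite mxE eq_sym oner_eq0.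
have vb : below k.+1 v.
  move=> j kj; rewrite !mxE projk ?(ltnW kj)// subr0 [j == _](_ : _ = false)//.
  by apply/negbTE; rewrite -val_eqE/= gtn_eqF.
have vc i : (i < k)%N -> ipS v (c i) = 0.
  move=> ik; rewrite ipBl ip_suml (bigD1 (Ordinal ik))//= ipZl orth// eqxx mulr1.
  rewrite big1 ?addr0 ?subrr// => j ji.
  by rewrite ipZl orth// (_ : (j == i :> nat) = false) ?mulr0//; exact: negbTE ji.
pose q : R := Num.sqrt (ipS v v).
have q0 : q != 0 by rewrite gt_eqF// sqrtr_gt0 Sigma_pos.
have qq : q ^+ 2 = ipS v v by rewrite sqr_sqrtr// ltW// Sigma_pos.
pose c' j := if j == k then q^-1 *: v else c j.
have c'lt j : (j < k)%N -> c' j = c j by rewrite /c' => jk; rewrite ltn_eqF.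
have c'k : c' k = q^-1 *: v by rewrite /c' eqxx.
exists c'; split.
- move=> i j; rewrite !ltnS leq_eqVlt => /predU1P[->|ik]; rewrite leq_eqVlt => /predU1P[->|jk].
  + by rewrite c'k ipZl ipC ipZl eqxx -qq expr2 mulKf// mulVf.
  + by rewrite c'k ipZl c'lt// vc// mulr0 gtn_eqF.
  + by rewrite c'k c'lt// ipC ipZl vc// mulr0 ltn_eqF.
  + by rewrite !c'lt// orth.
- move=> j; rewrite ltnS leq_eqVlt => /predU1P[->|jk]; last by rewrite c'lt//; exact: cb.
  by move=> i ki; rewrite c'k mxE vb// mulr0.
- move=> l u; rewrite leq_eqVlt => /predU1P[->|]; last first.
    rewrite ltnS => lk ub; rewrite [LHS](span l)//; apply: eq_bigr => j _.
    by rewrite c'lt// (leq_trans _ lk).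
  (* As v has entry 1 at coordinate k, subtracting u_k v leaves a vector on the first k coordinates,
     which the induction hypothesis expands. *)
  move=> ub; pose w := u - u (Ordinal kp) 0 *: v.
  have wE (z : 'cV[R]_p) (a : R) (j : 'I_p) : (u - a *: z) j 0 = u j 0 - a * z j 0.
    by rewrite !mxE.
  have wb : below k w.
    move=> j; rewrite leq_eqVlt => /predU1P[kj|kj].
      have -> : j = Ordinal kp by apply: val_inj.
      by rewrite wE vk mulr1 subrr.
    by rewrite wE ub// vb// mulr0 subrr.
  have ue : u = w + u (Ordinal kp) 0 *: v by rewrite subrK.
  rewrite big_ord_recr/= c'k.
  have wv : ipS w v = 0.
    rewrite (span k w)// ip_suml big1// => j _.
    by rewrite ipZl (ipC (c j) v) vc// mulr0.
  have uv : ipS u v = u (Ordinal kp) 0 * ipS v v by rewrite {1}ue ipDl wv ipZl add0r.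
  rewrite [ipS u (q^-1 *: v)]ipC ipZl [ipS v u]ipC uv scalerA -qq.
  rewrite [X in _ + X *: _](_ : _ = u (Ordinal kp) 0); last by field.
  rewrite {1}ue; congr (_ + _); rewrite {1}(span k w)//; apply: eq_bigr => j _.
  by rewrite c'lt// [in RHS]ue ipDl ipZl vc// mulr0 addr0.
Qed.

Context (c : nat -> 'cV[R]_p).
Hypothesis cp : orthonormal_flag c p.

Lemma flag_expand u : u = \sum_(j < p) ipS u (c j) *: c j.
Proof. by case: cp => _ _ h; apply: h => // j; rewrite leqNgt ltn_ord. Qed.

Lemma flag_parseval u : ipS u u = \sum_(j < p) ipS u (c j) ^+ 2.
Proof.
rewrite {1}(flag_expand u) ip_suml; apply: eq_bigr => j _.
by rewrite ipZl ipC expr2.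
Qed.

Lemma flag_coord l (t : nat -> R) j : (l <= p)%N -> (j < p)%N ->
  ipS (\sum_(i < l) t i *: c i) (c j) = if (j < l)%N then t j else 0.
Proof.
move=> lp jp; have [orth _ _] := cp; rewrite ip_suml; case: ifPn => jl.
  rewrite (bigD1 (Ordinal jl))//= ipZl orth// eqxx mulr1 big1 ?addr0// => i ij.
  rewrite ipZl orth ?(leq_trans (ltn_ord _))// (_ : (i == j :> nat) = false) ?mulr0//.
  exact: negbTE ij.
rewrite big1// => i _; rewrite ipZl orth ?(leq_trans (ltn_ord _))//.
by rewrite ltn_eqF ?mulr0// (leq_trans (ltn_ord i))// leqNgt.
Qed.

Lemma flag_below_coord l u j : (l <= p)%N -> below l u -> (l <= j)%N -> (j < p)%N ->
  ipS u (c j) = 0.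
Proof.
move=> lp ub lj jp; have [_ _ span] := cp; rewrite (span l u lp ub).
by rewrite (flag_coord (fun j => ipS u (c j)))// ltnNge lj.
Qed.

End gram_schmidt.

Lemma dotpE (R : realType) p (x : p.-tuple R) (a : 'cV[R]_p) :
  dotp x a = \sum_j a j 0 * tnth x j.
Proof. by rewrite /dotp mxE; apply: eq_bigr => j _; rewrite mxE mulrC. Qed.

Lemma dotpB (R : realType) p (x : p.-tuple R) (a b : 'cV[R]_p) :
  dotp x (a - b) = dotp x a - dotp x b.
Proof. by rewrite /dotp mulmxBr mxE [X in _ + X]mxE. Qed.

Lemma dotp_sum (R : realType) p (x : p.-tuple R) n (t : 'I_n -> R) (c : 'I_n -> 'cV[R]_p) :
  dotp x (\sum_i t i *: c i) = \sum_i t i * dotp x (c i).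
Proof.
rewrite /dotp mulmx_sumr summxE; apply: eq_bigr => i _.
by rewrite -scalemxAr mxE.
Qed.

Lemma measurable_dotp (R : realType) p (a : 'cV[R]_p) :
  measurable_fun [set: p.-tuple R] (fun x => dotp x a).
Proof.
rewrite (_ : (fun _ => _) = fun x => \sum_j a j 0 * tnth x j).
  by apply: measurable_sum => j; apply: measurable_funM => //; exact: measurable_tnth.
by apply/funext => x; rewrite dotpE.
Qed.

(** * Law of the linear forms of the design *)

Section design_law.
Context d (T : measurableType d) (R : realType) (P : probability T R).
Context (p : nat) (X : T -> p.-tuple R) (Sigma : 'M[R]_p).
Hypothesis mX : measurable_fun [set: T] X.
Hypothesis gX : gaussian_vector P X.
Hypothesis zX : zero_mean P X.
Hypothesis cX : has_covariance P X Sigma.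

Lemma measurable_dotp_design a : measurable_fun [set: T] (fun w => dotp (X w) a).
Proof. exact: (measurableT_comp (@measurable_dotp R p a) mX). Qed.
Let mD := measurable_dotp_design.

Let coordE j w : dotp (X w) (delta_mx j 0) = tnth (X w) j.
Proof.
rewrite dotpE (bigD1 j)//= mxE !eqxx mul1r big1 ?addr0// => i ij.
by rewrite mxE (negbTE ij) mul0r.
Qed.


Let integrable_dotp a : P.-integrable setT (EFin \o (fun w => dotp (X w) a)).
Proof.
have [m [v [v0 gV]]] := gX a.
have h := gaussian_integrable_exprn (mD a) v0 gV (k := 1) isT.
have := integrableD measurableT h (finite_measure_integrable_cst P m measurableT).
by apply: eq_integrable => // w _ /=; rewrite expr1 -EFinD subrK.
Qed.

Let coord_mean j : \int[P]_w tnth (X w) j = 0.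
Proof.
have := zX j; rewrite expectation.unlock EFin_Rintegral; first by case.
by have := integrable_dotp (delta_mx j 0); apply: eq_integrable => // w _ /=; rewrite coordE.
Qed.

Let dotp_mean a : \int[P]_w dotp (X w) a = 0.
Proof.
under eq_Rintegral do rewrite dotpE.
have iX j : P.-integrable setT (EFin \o (fun w => tnth (X w) j)).
  by have := integrable_dotp (delta_mx j 0); apply: eq_integrable => // w _ /=; rewrite coordE.
rewrite Rintegral_sum => [|j]; last exact: (integrableZl measurableT _ (iX j)).
by rewrite big1// => j _; rewrite RintegralZl// coord_mean mulr0.
Qed.

Let dotp_gaussian0 a : exists2 v, 0 <= v & is_gaussian P (fun w => dotp (X w) a) 0 v.
Proof.
have [m [v [v0 gV]]] := gX a; exists v => //.
suff -> : 0 = m by [].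
have := gaussian_mean (mD a) v0 gV.
have ic := finite_measure_integrable_cst P m measurableT.
rewrite EFin_Rintegral; last exact: (integrableB measurableT (integrable_dotp a) ic).
rewrite (RintegralB measurableT (integrable_dotp a) ic) dotp_mean.
rewrite Rintegral_cst_probability => -[] /eqP.
by rewrite subr_eq0 => /eqP.
Qed.

Let integrable_sqr a : P.-integrable setT (EFin \o (fun w => dotp (X w) a ^+ 2)).
Proof.
have [v v0 gV] := dotp_gaussian0 a.
have := gaussian_integrable_exprn (mD a) v0 gV (k := 2) isT.
by apply: eq_integrable => // w _ /=; rewrite subr0.
Qed.

Lemma integrable_dotpM a b :
  P.-integrable setT (EFin \o (fun w => dotp (X w) a * dotp (X w) b)).
Proof.
apply: le_integrable (integrableZl measurableT 2^-1 (integrableD measurableT (integrable_sqr a) (integrable_sqr b))) => //.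
  by apply/measurable_EFinP; exact: measurable_funM.
move=> w _ /=; rewrite lee_fin [leRHS]ger0_norm ?normM_le_sqr//.
by rewrite mulr_ge0// addr_ge0// sqr_ge0.
Qed.

Let coord_cov i j : \int[P]_w (tnth (X w) i * tnth (X w) j) = Sigma i j.
Proof.
have := cX i j; rewrite covariance.unlock !zX/= expectation.unlock.
rewrite (eq_integral (fun w => (tnth (X w) i * tnth (X w) j)%:E)); last first.
  move=> w _; congr (_%:E).
  by rewrite -[LHS]/((tnth (X w) i - 0) * (tnth (X w) j - 0)) !subr0.
rewrite EFin_Rintegral; first by case.
have := integrable_dotpM (delta_mx i 0) (delta_mx j 0).
by apply: eq_integrable => // w _ /=; rewrite !coordE.
Qed.

Lemma dotp_cov a b : \int[P]_w (dotp (X w) a * dotp (X w) b) = ip Sigma a b.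
Proof.
have iXX i j : P.-integrable setT (EFin \o (fun w => tnth (X w) i * tnth (X w) j)).
  have := integrable_dotpM (delta_mx i 0) (delta_mx j 0).
  by apply: eq_integrable => // w _ /=; rewrite !coordE.
have E w : dotp (X w) a * dotp (X w) b =
    \sum_i \sum_j a i 0 * b j 0 * (tnth (X w) i * tnth (X w) j).
  rewrite !dotpE mulr_suml; apply: eq_bigr => i _.
  by rewrite mulr_sumr; apply: eq_bigr => j _; ring.
under eq_Rintegral do rewrite E.
have i1 i j : P.-integrable setT (EFin \o (fun w => a i 0 * b j 0 * (tnth (X w) i * tnth (X w) j))).
  exact: (integrableZl measurableT _ (iXX i j)).
have i2 i : P.-integrable setT (EFin \o (fun w => \sum_j a i 0 * b j 0 * (tnth (X w) i * tnth (X w) j))).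
  by apply: integrable_EFin_sum => j; exact: i1.
rewrite Rintegral_sum// /ip -mulmxA mxE; apply: eq_bigr => i _.
rewrite Rintegral_sum// !mxE mulr_sumr; apply: eq_bigr => j _.
by rewrite RintegralZl// coord_cov; ring.
Qed.

(** The mean and variance in [gaussian_vector] are existential; comparing the first two moments
    identifies them. *)
Lemma dotp_gaussian a : is_gaussian P (fun w => dotp (X w) a) 0 (ip Sigma a a).
Proof.
have [v v0 gV] := dotp_gaussian0 a.
suff -> : ip Sigma a a = v by [].
have := gaussian_variance (mD a) v0 gV; rewrite EFin_Rintegral.
  move=> -[] <-; rewrite -dotp_cov; apply: eq_Rintegral => w _.
  by rewrite subr0 expr2.
exact: (gaussian_integrable_exprn (mD a) v0 gV (k := 2) isT).
Qed.

Lemma design_cov_ge0 a : 0 <= ip Sigma a a.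
Proof. by rewrite -dotp_cov; apply: Rintegral_ge0 => w _; rewrite -expr2 sqr_ge0. Qed.

Lemma design_cov_sym : Sigma^T = Sigma.
Proof. by apply/matrixP => i j; rewrite mxE -!coord_cov; apply: eq_Rintegral => w _; rewrite mulrC. Qed.

Lemma loss_design a b : loss P X a b = (ip Sigma (a - b) (a - b))%:E.
Proof.
rewrite /loss expectation.unlock -dotp_cov -EFin_Rintegral; last exact: integrable_dotpM.
by apply: eq_integral => w _ /=; rewrite dotpB expr2.
Qed.

Hypothesis uSigma : Sigma \in unitmx.

(** The form is a variance, hence semidefinite. An isotropic vector is orthogonal to every vector by
    the argument of Cauchy-Schwarz, so it lies in the kernel of Sigma, which is trivial. *)
Lemma design_cov_pos (a : 'cV[R]_p) : a != 0 -> 0 < (a^T *m Sigma *m a) 0 0.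
Proof.
move=> a0; rewrite lt_neqAle design_cov_ge0 andbT eq_sym.
apply: contra_neq a0 => aa.
have ab b : ip Sigma a b = 0.
  set x := ip Sigma a b; set q := ip Sigma b b.
  have q0 : 0 <= q by exact: design_cov_ge0.
  have ht (t : R) : 0 <= 2 * t * x + t ^+ 2 * q.
    have := design_cov_ge0 (a + t *: b).
    rewrite (ipDl Sigma) (ipC design_cov_sym a (a + _)) (ipC design_cov_sym (t *: b) (a + _)).
    rewrite !(ipDl Sigma) (ipC design_cov_sym a (t *: b)) !(ipZl Sigma).
    rewrite (ipC design_cov_sym b (t *: b)) !(ipZl Sigma) (ipC design_cov_sym b a) -/x -/q /ip aa => h.
    by apply: le_trans h _; rewrite le_eqVlt; apply/orP; left; apply/eqP; ring.
  apply/eqP; rewrite -sqrf_eq0; apply/eqP; apply/le_anti; rewrite sqr_ge0 andbT.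
  (* This t makes the quadratic polynomial negative unless x = 0; the denominator q + 1 also serves
     when q = 0. *)
  have := ht (- x / (q + 1)).
  have q1 : q + 1 != 0 by rewrite gt_eqF// ltr_wpDl.
  have -> : 2 * (- x / (q + 1)) * x + (- x / (q + 1)) ^+ 2 * q =
      - (x ^+ 2 * ((q + 2) / (q + 1) ^+ 2)) by field.
  rewrite oppr_ge0 pmulr_lle0// divr_gt0 ?exprn_gt0// ltr_wpDl//.
have : a^T *m Sigma = 0.
  apply/rowP => j; have := ab (delta_mx j 0); rewrite /ip -colE.
  by rewrite mxE => ->; rewrite mxE.
move/(congr1 (fun M => M *m invmx Sigma)); rewrite mulmxK// mul0mx.
by move/(congr1 trmx); rewrite trmxK trmx0.
Qed.

End design_law.

(** * Standardized variables *)

Section standardized.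
Context d (T : measurableType d) (R : realType) (P : probability T R).

(** What the scores retain of normality: centring, unit variance, the Gaussian fourth-moment bound
    for the deviations, and absence of atoms for the full rank of the design. *)
Definition standardized (U : T -> R) : Prop :=
  [/\ measurable_fun [set: T] U,
      P.-integrable setT (fun w => (U w ^+ 4)%:E),
      \int[P]_w U w = 0, \int[P]_w (U w ^+ 2) = 1 &
      \int[P]_w (U w ^+ 4) <= 3 /\ forall x, P (U @^-1` [set x]) = 0%E].

Lemma gaussian_standardized (V : T -> R) (s : R) : measurable_fun [set: T] V ->
  0 < s -> is_gaussian P V 0 (s ^+ 2) -> standardized (fun w => V w / s).
Proof.
move=> mV s0 gV; have v0 : 0 <= s ^+ 2 by exact: sqr_ge0.
have sn : s != 0 by rewrite gt_eqF.
have iV k : (k <= 4)%N -> P.-integrable setT (EFin \o (fun w => V w ^+ k)).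
  move=> k4; have := gaussian_integrable_exprn mV v0 gV k4.
  by apply: eq_integrable => // w _ /=; rewrite subr0.
have scale k : (k <= 4)%N ->
    \int[P]_w ((V w / s) ^+ k) = s ^- k * \int[P]_w (V w ^+ k).
  move=> k4; rewrite -RintegralZl//; last exact: iV.
  by apply: eq_Rintegral => w _; rewrite exprMn exprVn mulrC.
split.
- exact: measurable_funM.
- have := integrableZl measurableT (s ^- 4) (iV 4 isT).
  by apply: eq_integrable => // w _ /=; rewrite -EFinM exprMn exprVn mulrC.
- have := scale 1%N isT; under eq_Rintegral do rewrite expr1; move=> ->.
  have := gaussian_mean mV v0 gV; under eq_integral do rewrite subr0.
  rewrite EFin_Rintegral; last by have := iV 1%N isT; apply: eq_integrable => // w _ /=; rewrite expr1.
  move=> -[] h; rewrite (_ : \int[P]_w (V w ^+ 1) = \int[P]_w V w) ?h ?mulr0//.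
- rewrite scale//; have := gaussian_variance mV v0 gV; under eq_integral do rewrite subr0.
  rewrite EFin_Rintegral; last exact: (iV 2%N isT).
  by move=> -[] ->; rewrite mulVf// expf_neq0.
- split.
    rewrite scale//; have := gaussian_moment4 mV v0 gV; under eq_integral do rewrite subr0.
    rewrite EFin_Rintegral; last exact: (iV 4%N isT).
    move=> -[] ->; rewrite -exprM mulrCA mulVf ?expf_neq0//.
    by rewrite mulr1.
  move=> x; rewrite -(gaussian_atomless gV (x * s)) ?expf_neq0//.
  congr (P _); apply/seteqP; split => w /=.
    by move=> <-; rewrite divfK.
  by move=> ->; rewrite mulfK.
Qed.

Lemma equal_law_standardized (U U' : T -> R) : measurable_fun [set: T] U' ->
  (forall B, measurable B -> P (U' @^-1` B) = P (U @^-1` B)) ->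
  standardized U -> standardized U'.
Proof.
move=> mU' lawU [mU i4 e1 e2 [e4 at0]].
pose Um : {mfun T >-> R} := HB.pack U (isMeasurableFun.Build _ _ _ _ _ mU).
pose D : {measure set R -> \bar R} := distribution P Um.
have law1 (f : R -> \bar R) : measurable_fun [set: R] f ->
    (\int[P]_w f (U' w) = \int[P]_w f (U w))%E.
  move=> mf; rewrite (law_integral mU' (nu := D) lawU mf).
  by rewrite -(law_integral mU (nu := D) (fun _ _ => erefl) mf).
have mk k : measurable_fun [set: R] (fun x : R => (x ^+ k)%:E).
  by apply/measurable_EFinP; exact: measurable_funX.
have R1 k : \int[P]_w (U' w ^+ k) = \int[P]_w (U w ^+ k).
  by rewrite /Rintegral (law1 _ (mk k)).
split => //.
- apply/integrableP; split; first by apply/measurable_EFinP; exact: measurable_funX.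
  rewrite (law1 (fun x => `|(x ^+ 4)%:E|)%E); last exact: measurableT_comp.
  by case/integrableP : i4.
- by have := R1 1%N; rewrite /Rintegral => h; rewrite -[RHS]e1 /Rintegral -h.
- by rewrite R1.
- by split; [rewrite R1|move=> x; rewrite lawU].
Qed.

End standardized.

Lemma sum_sum_unit (R : nmodType) (I : finType) (F : (I + unit)%type -> R) :
  \sum_e F e = \sum_i F (inl i) + F (inr tt).
Proof.
rewrite big_sumType/=; congr (_ + _).
by rewrite (bigD1 tt)//= big1 ?addr0// => -[].
Qed.

(** * Scores of the regression model and of the observations *)

Section regression_law.
Context d (T : measurableType d) (R : realType) (P : probability T R).
Context (p : nat) (X : T -> p.-tuple R) (Sigma : 'M[R]_p) (eps : T -> R) (sigma : R).
Hypothesis mX : measurable_fun [set: T] X.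
Hypothesis gX : gaussian_vector P X.
Hypothesis zX : zero_mean P X.
Hypothesis cX : has_covariance P X Sigma.
Hypothesis meps : measurable_fun [set: T] eps.
Hypothesis sigma0 : 0 < sigma.
Hypothesis geps : is_gaussian P eps 0 (sigma ^+ 2).
Hypothesis indXe : independent2 P X eps.
Variable theta : 'cV[R]_p.

Let v0 : 0 <= sigma ^+ 2. Proof. exact: sqr_ge0. Qed.

Let mD a : measurable_fun [set: T] (fun w => dotp (X w) a).
Proof. exact: measurable_dotp_design. Qed.

Lemma pred_risk_design theta' : pred_risk P (response X eps theta) X theta' =
  (ip Sigma (theta - theta') (theta - theta') + sigma ^+ 2)%:E.
Proof.
rewrite /pred_risk expectation.unlock; set a := theta - theta'.
have gD := dotp_gaussian mX gX zX cX a.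
have i1 : P.-integrable setT (EFin \o (fun w => dotp (X w) a * dotp (X w) a)).
  exact: (integrable_dotpM mX gX zX).
have i2 : P.-integrable setT (EFin \o (fun w => eps w ^+ 2)).
  have := gaussian_integrable_exprn meps v0 geps (k := 2) isT.
  by apply: eq_integrable => // w _ /=; rewrite subr0.
have ie : P.-integrable setT (fun w => (eps w)%:E).
  have := gaussian_integrable_exprn meps v0 geps (k := 1) isT.
  by apply: eq_integrable => // w _ /=; rewrite subr0.
have q0 := design_cov_ge0 mX gX zX cX a.
have iD : P.-integrable setT (fun w => (dotp (X w) a)%:E).
  have := gaussian_integrable_exprn (mD a) q0 gD (k := 1) isT.
  by apply: eq_integrable => // w _ /=; rewrite subr0.
have [i3 e3] := independent2_integrableM mX meps indXe (@measurable_dotp R p a)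
  (@measurable_id _ _ _) iD ie.
have e0 : (\int[P]_w (eps w)%:E = 0)%E.
  by rewrite -[RHS](gaussian_mean meps v0 geps); apply: eq_integral => w _; rewrite subr0.
rewrite e0 mule0 in e3.
have i3' : P.-integrable setT (EFin \o (fun w => 2 * (dotp (X w) a * eps w))).
  exact: (integrableZl measurableT 2 i3).
have i12 : P.-integrable setT (EFin \o (fun w => dotp (X w) a * dotp (X w) a + 2 * (dotp (X w) a * eps w))).
  exact: (integrableD measurableT i1 i3').
rewrite (eq_integral (fun w => (dotp (X w) a * dotp (X w) a +
    2 * (dotp (X w) a * eps w) + eps w ^+ 2)%:E)); last first.
  by move=> w _; rewrite /response dotpB; congr (_%:E); ring.
rewrite EFin_Rintegral; last exact: (integrableD measurableT i12 i2).
congr (_%:E); rewrite (RintegralD measurableT i12 i2) (RintegralD measurableT i1 i3').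
rewrite RintegralZl// (dotp_cov mX gX zX cX) {1}/Rintegral e3 mulr0 addr0.
congr (_ + _); apply: EFin_inj; rewrite -EFin_Rintegral// -(gaussian_variance meps v0 geps).
by apply: eq_integral => w _; rewrite subr0.
Qed.

Context (c : nat -> 'cV[R]_p).
Hypothesis cp : orthonormal_flag Sigma c p.

(** The noise score is rebuilt from the pair (Y, X), because only this pair is replicated; the
    observed scores are then the same functions of the observed rows. *)
Definition design_score (e : 'I_p + unit) (z : R * p.-tuple R) : R :=
  match e with
  | inl j => dotp z.2 (c j)
  | inr _ => (z.1 - dotp z.2 theta) / sigma
  end.

Lemma measurable_design_score e :
  measurable_fun [set: R * p.-tuple R] (design_score e).
Proof.
case: e => [j|u] /=.
  exact: (measurableT_comp (@measurable_dotp R p (c j)) measurable_snd).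
apply: measurable_funM => //; apply: measurable_funB; first exact: measurable_fst.
exact: (measurableT_comp (@measurable_dotp R p theta) measurable_snd).
Qed.

Let W e w := design_score e (response X eps theta w, X w).

Let WlE j w : W (inl j) w = dotp (X w) (c j). Proof. by []. Qed.

Let WrE u w : W (inr u) w = eps w / sigma.
Proof. by rewrite /W /= /response addrAC subrr add0r. Qed.

Lemma master_standardized e : standardized P (W e).
Proof.
case: e => [j|u]; last first.
  have -> : W (inr u) = fun w => eps w / sigma by apply/funext => w; exact: WrE.
  exact: (gaussian_standardized meps sigma0 geps).
have -> : W (inl j) = fun w => dotp (X w) (c j) / 1.
  by apply/funext => w; rewrite WlE divr1.
apply: (gaussian_standardized (mD (c j)) ltr01).
have e1 : ip Sigma (c j) (c j) = 1 ^+ 2.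
  by case: cp => h _ _; rewrite h// eqxx expr1n.
by rewrite -e1; exact: (dotp_gaussian mX gX zX cX).
Qed.

Let trig_product (f g : R -> R) (a : 'cV[R]_p) :
  measurable_fun [set: R] f -> measurable_fun [set: R] g ->
  (forall x, `|f x| <= 1) -> (forall x, `|g x| <= 1) ->
  P.-integrable setT (EFin \o (fun w => f (dotp (X w) a) * g (eps w))) /\
  \int[P]_w (f (dotp (X w) a) * g (eps w)) =
  \int[P]_w f (dotp (X w) a) * \int[P]_w g (eps w).
Proof.
move=> mf mg f1 g1.
have mfX : measurable_fun [set: p.-tuple R] (fun x => f (dotp x a)).
  exact: (measurableT_comp mf (@measurable_dotp R p a)).
have i1 : P.-integrable setT (fun w => (f (dotp (X w) a))%:E).
  apply: (@integrable_norm_le _ _ _ P _ 1) => //.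
  exact: (measurableT_comp mf (mD a)).
have i2 : P.-integrable setT (fun w => (g (eps w))%:E).
  apply: (@integrable_norm_le _ _ _ P _ 1) => //.
  exact: (measurableT_comp mg meps).
have [i3 e3] := independent2_integrableM mX meps indXe mfX mg i1 i2.
split; first exact: i3.
by rewrite /Rintegral e3 !EFin_Rintegral.
Qed.

(** By orthonormality the scores of X combine into one Gaussian form of variance the sum of the
    squared t_j. The addition formula separates it from the noise: the cosine parts multiply by
    independence, and the sine part vanishes as the noise is symmetric. *)
Let master_trig (t : 'I_p + unit -> R) phi :
  (\int[P]_w (cos (\sum_e t e * W e w + phi))%:E =
   (expR (- ((\sum_e t e ^+ 2) / 2)) * cos phi)%:E)%E.
Proof.
pose a := \sum_(j < p) t (inl j) *: c j; pose r := t (inr tt) / sigma.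
have lin w : \sum_e t e * W e w = dotp (X w) a + r * eps w.
  by rewrite sum_sum_unit WrE dotp_sum /r; congr (_ + _); ring.
have q0 := design_cov_ge0 mX gX zX cX a.
have qE : ip Sigma a a = \sum_(j < p) t (inl j) ^+ 2.
  rewrite (flag_parseval (design_cov_sym mX gX zX cX) cp).
  (* The coefficients extended by 0 to natural numbers, the indexing that [flag_coord] expects. *)
  pose tt0 (j : nat) := if insub j is Some j' then t (inl j') else 0.
  have aE : a = \sum_(j < p) tt0 j *: c j by apply: eq_bigr => j _; rewrite /tt0 valK.
  by apply: eq_bigr => j _; rewrite aE (flag_coord cp)// ltn_ord /tt0 valK.
have gD := dotp_gaussian mX gX zX cX a.
have cD : \int[P]_w cos (dotp (X w) a + phi) = cos phi * expR (- (ip Sigma a a / 2)).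
  have h : \int[P]_w cos (1 * (dotp (X w) a - 0) + phi) =
      cos phi * expR (- (ip Sigma a a / 2)).
    by rewrite /Rintegral (gaussian_cos (mD a) q0 gD) expr1n mulr1.
  by rewrite -h; apply: eq_Rintegral => w _; rewrite mul1r subr0.
have ce : \int[P]_w cos (r * eps w) = expR (- (sigma ^+ 2 * r ^+ 2 / 2)).
  have h : \int[P]_w cos (r * (eps w - 0) + 0) = expR (- (sigma ^+ 2 * r ^+ 2 / 2)).
    by rewrite /Rintegral (gaussian_cos meps v0 geps) cos0 mul1r.
  by rewrite -h; apply: eq_Rintegral => w _; rewrite subr0 addr0.
(* The phase pi/2 turns the cosine into minus the sine and makes the right-hand side of
   [gaussian_cos] zero. *)
have se : \int[P]_w - sin (r * eps w) = 0.
  have h : \int[P]_w cos (r * (eps w - 0) + pi / 2) = 0.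
    by rewrite /Rintegral (gaussian_cos meps v0 geps) cos_pihalf mul0r.
  by rewrite -h; apply: eq_Rintegral => w _; rewrite subr0 cosDpihalf.
have mc := @measurable_cos R; have ms := @measurable_sin R.
have c1 := @norm_cos_le1 R; have s1 := @norm_sin_le1 R.
have mcr : measurable_fun [set: R] (fun x : R => cos (r * x)).
  by apply: measurableT_comp => //; exact: measurable_funM.
have msr : measurable_fun [set: R] (fun x : R => - sin (r * x)).
  by do 2 apply: measurableT_comp => //; exact: measurable_funM.
have mcp : measurable_fun [set: R] (fun x : R => cos (x + phi)).
  by apply: measurableT_comp => //; exact: measurable_funD.
have msp : measurable_fun [set: R] (fun x : R => sin (x + phi)).
  by apply: measurableT_comp => //; exact: measurable_funD.
have [icc ecc] := trig_product a mcp mcr (fun x => c1 _) (fun x => c1 _).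
have ns1 (x : R) : `|- sin (r * x)| <= 1 by rewrite normrN.
have [iss ess] := trig_product a msp msr (fun x => s1 _) ns1.
rewrite (eq_integral (fun w => (cos (dotp (X w) a + phi) * cos (r * eps w) +
    sin (dotp (X w) a + phi) * - sin (r * eps w))%:E)); last first.
  by move=> w _; rewrite lin addrAC (cosD (_ + phi)) mulrN.
rewrite EFin_Rintegral; last exact: (integrableD measurableT icc iss).
rewrite (RintegralD measurableT icc iss) ecc ess cD ce se mulr0 addr0 -(mulrA (cos phi)) -expRD mulrC.
congr ((expR _ * _)%:E); rewrite sum_sum_unit qE /r.
have s0 : sigma != 0 by rewrite gt_eqF.
by field.
Qed.

Lemma master_independent : mutually_independent P W.
Proof.
apply: gaussian_independence.
- by move=> e; have [] := master_standardized e.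
- by move=> e x; have [_ _ _ _ [_ ->]] := master_standardized e.
- exact: master_trig.
Qed.

Context (n : nat) (bY : 'I_n -> T -> R) (bX : 'I_n -> T -> p.-tuple R).
Hypothesis mbY : forall i, measurable_fun [set: T] (bY i).
Hypothesis mbX : forall i, measurable_fun [set: T] (bX i).
Hypothesis iid : iid_replications P (response X eps theta) X bY bX.

Definition obs_score (a : 'I_n * ('I_p + unit)) (w : T) : R :=
  design_score a.2 (bY a.1 w, bX a.1 w).

Let law_row i (A : set (R * p.-tuple R)) : measurable A ->
  P ((fun w => (bY i w, bX i w)) @^-1` A) = P ((fun w => (response X eps theta w, X w)) @^-1` A).
Proof. by case: iid => h _ mA; exact: (h i A mA). Qed.

Let score_preimage e (B : set R) : measurable B -> measurable (design_score e @^-1` B).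
Proof. by move=> mB; apply: measurable_preimage => //; exact: measurable_design_score. Qed.

Lemma obs_standardized a : standardized P (obs_score a).
Proof.
have mrow : measurable_fun [set: T] (fun w => (bY a.1 w, bX a.1 w)).
  exact: measurable_fun_pair.
apply: equal_law_standardized (master_standardized a.2).
  exact: (measurableT_comp (measurable_design_score a.2) mrow).
move=> B mB; exact: (law_row a.1 (score_preimage a.2 mB)).
Qed.

(** The rows factor by the replication hypothesis; inside a row the law is that of (Y, X), whose
    scores are independent. *)
Lemma obs_independent : mutually_independent P obs_score.
Proof.
move=> B mB; pose A i := \bigcap_e (design_score e @^-1` B (i, e)).
have mA i : measurable (A i).
  by apply: fin_bigcap_measurable => // e _; exact: score_preimage.
rewrite (_ : \bigcap_a _ = \bigcap_i ((fun w => (bY i w, bX i w)) @^-1` A i)); last first.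
  apply/seteqP; split => [w Bw i _ e _|w Aw [i e] _]; first exact: (Bw (i, e) Logic.I).
  exact: (Aw i Logic.I e Logic.I).
rewrite (proj2 iid A mA).
transitivity (\prod_i \prod_e P (obs_score (i, e) @^-1` B (i, e)))%E; last first.
  by rewrite pair_bigA; apply: eq_bigr => -[].
apply: eq_bigr => i _; rewrite (law_row i (mA i)).
transitivity (\prod_e P (W e @^-1` B (i, e)))%E.
  by rewrite -master_independent.
by apply: eq_bigr => e _; rewrite -(law_row i (score_preimage e (mB (i, e)))).
Qed.

End regression_law.

Lemma ler_norm_sqr (R : realDomainType) (e x : R) : 0 < e ->
  (e <= `|x|) = (e ^+ 2 <= x ^+ 2).
Proof.
by move=> e0; rewrite -(real_normK (num_real x)) ler_pXn2r ?nnegrE ?normr_ge0// ltW.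
Qed.

(** * Full rank and deviations for the Gaussian design *)

Section gaussian_design.
Context d (T : measurableType d) (R : realType) (P : probability T R).
Context (n p : nat) (V : 'I_n * ('I_p + unit) -> T -> R).
Hypothesis stdV : forall a, standardized P (V a).
Hypothesis indV : mutually_independent P V.
Variables (tau : nat -> R) (sigma : R).

Let mV a : measurable_fun [set: T] (V a). Proof. by case: (stdV a). Qed.

Definition noise_coef k (e : 'I_p + unit) : R :=
  match e with
  | inl j => if (k <= j)%N then tau j else 0
  | inr _ => sigma
  end.

Definition noise k (w : T) : 'cV[R]_n := \col_i \sum_e noise_coef k e * V (i, e) w.

Definition noise_var k : R := \sum_e noise_coef k e ^+ 2.

(** Indexed by natural numbers, with default 0 from p on, so that the designs of all sizes share one
    formula. *)
Definition score (i : 'I_n) (j : nat) (w : T) : R :=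
  if insub j is Some j' then V (i, inl j') w else 0.

Definition design k (w : T) : 'M[R]_(n, k) := \matrix_(i, j) score i j w.

(** The first k scores of every row. They determine the design of size k, and the noise of the model
    of size k uses only the complement. *)
Definition low k : {set 'I_n * ('I_p + unit)} :=
  [set a : 'I_n * ('I_p + unit) | if a.2 is inl j then (j < k)%N else false]%SET.

Let xi k i w := noise k w i 0.

Let xiE k i w : xi k i w = \sum_e noise_coef k e * V (i, e) w.
Proof. by rewrite /xi mxE. Qed.

Let mblock_xi k i (J : {set 'I_n * ('I_p + unit)}) :
  (forall e : 'I_p + unit, (if e is inl j then (k <= j)%N else true) -> (i, e) \in J) ->
  measurable_fun [set: block V J] (xi k i : block V J -> R).
Proof.
move=> iJ; rewrite (_ : xi k i = fun w => \sum_e noise_coef k e * V (i, e) w).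
  apply: measurable_sum => e.
  have [eJ|eJ] := boolP ((i, e) \in J).
    by apply: measurable_funM => //; exact: measurable_block.
  rewrite (_ : (fun _ => _) = fun=> 0)//; apply/funext => w.
  case: e eJ => [j|u] eJ /=; last by rewrite iJ in eJ.
  case: (boolP (k <= j)%N) => [kj|_]; last by rewrite mul0r.
  by rewrite (iJ (inl j) kj) in eJ.
by apply/funext => w; rewrite xiE.
Qed.

Let mxi k i : measurable_fun [set: block V (~: low k)] (xi k i : block V (~: low k) -> R).
Proof.
apply: mblock_xi => -[j|u] kj; rewrite !inE//=.
by rewrite -leqNgt.
Qed.

Let mscore k i j : (j < k)%N -> measurable_fun [set: block V (low k)]
  (score i j : block V (low k) -> R).
Proof.
move=> jk; rewrite /score; case: insubP => [j' _ j'j|_] //.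
by apply: measurable_block; rewrite inE /= j'j.
Qed.

Lemma measurable_noise k i : measurable_fun [set: T] (fun w => noise k w i 0).
Proof.
rewrite (_ : (fun _ => _) = fun w => \sum_e noise_coef k e * V (i, e) w).
  by apply: measurable_sum => e; exact: measurable_funM.
by apply/funext => w; rewrite mxE.
Qed.

Lemma measurable_score i j : measurable_fun [set: T] (score i j).
Proof. by rewrite /score; case: insubP. Qed.

Lemma measurable_gram_det k :
  measurable_fun [set: T] (fun w => \det ((design k w)^T *m design k w)).
Proof.
apply: measurable_det => i j.
rewrite (_ : (fun _ => _) = fun w => \sum_l score l i w * score l j w).
  by apply: measurable_sum => l; apply: measurable_funM; exact: measurable_score.
by apply/funext => w; rewrite mxE; apply: eq_bigr => l _; rewrite !mxE.
Qed.

Lemma noise_independent k : mutually_independent P (xi k).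
Proof.
pose J i : {set 'I_n * ('I_p + unit)} := [set a | a.1 == i]%SET.
apply: (independent_disjoint_blocks mV indV (J := J)).
  move=> i i' ii'; apply/fintype.subsetP => a; rewrite !inE => /eqP ->.
  exact: ii'.
by move=> i; apply: mblock_xi => e _; rewrite inE.
Qed.

Let row_independent i : mutually_independent P (fun e => V (i, e)).
Proof.
apply: (independent_disjoint_blocks mV indV (f := fun e => V (i, e)) (J := fun e => [set (i, e)]%SET)).
  move=> e e' ee'; apply/fintype.subsetP => a; rewrite !inE => /eqP ->.
  by apply: contra ee' => /eqP[->].
by move=> e; apply: measurable_block; rewrite inE.
Qed.

(** The constant 34 of [linear_form_moment4] for fourth moments at most 3. *)
Let K : R := 2 * (4 * 3 + 4) + 2.

Let noise_moments k i :
  [/\ P.-integrable setT (fun w => (xi k i w ^+ 4)%:E), \int[P]_w xi k i w = 0,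
      \int[P]_w (xi k i w ^+ 2) = noise_var k &
      \int[P]_w (xi k i w ^+ 4) <= K * noise_var k ^+ 2].
Proof.
have i4 e : P.-integrable setT (fun w => (V (i, e) w ^+ 4)%:E) by case: (stdV (i, e)).
have e1 e : \int[P]_w V (i, e) w = 0 by case: (stdV (i, e)).
have e2 e : \int[P]_w (V (i, e) w ^+ 2) = 1 by case: (stdV (i, e)).
have e4 e : \int[P]_w (V (i, e) w ^+ 4) <= 3 by case: (stdV (i, e)) => _ _ _ _ [].
have m e : measurable_fun [set: T] (V (i, e)) by [].
have -> : xi k i = fun w => \sum_e noise_coef k e * V (i, e) w.
  by apply/funext => w; rewrite xiE.
split.
- exact: (linear_form_integrable4 m (row_independent i) i4 e1 e2 e4).
- exact: (linear_form_mean m i4 e1).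
- exact: (linear_form_moment2 m (row_independent i) i4 e1 e2).
- exact: (linear_form_moment4 m (row_independent i) i4 e1 e2 e4).
Qed.

Lemma noise_var_ge0 k : 0 <= noise_var k.
Proof. by apply: sumr_ge0 => e _; exact: sqr_ge0. Qed.

Let s k := Num.sqrt (noise_var k).
Let s2 k : s k ^+ 2 = noise_var k. Proof. by rewrite sqr_sqrtr ?noise_var_ge0. Qed.
Let s4 k : s k ^+ 4 = noise_var k ^+ 2. Proof. by rewrite (exprM _ 2 2) s2. Qed.

Let E2 k i : \int[P]_w (xi k i w ^+ 2) = s k ^+ 2.
Proof. by rewrite s2; case: (noise_moments k i). Qed.
Let E4 k i : \int[P]_w (xi k i w ^+ 4) <= K * s k ^+ 4.
Proof. by rewrite s4; case: (noise_moments k i). Qed.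
Let E1 k i : \int[P]_w xi k i w = 0.
Proof. by case: (noise_moments k i). Qed.
Let I4 k i : P.-integrable setT (fun w => (xi k i w ^+ 4)%:E).
Proof. by case: (noise_moments k i). Qed.

Let K0 : 0 <= K. Proof. by rewrite /K addr_ge0// mulr_ge0// addr_ge0// mulr_ge0. Qed.

(** The first k rows of the design form a square matrix of distinct scores, almost surely
    invertible, and this makes the Gram matrix invertible. The case k = 0 is apart because it
    provides no default row or column. *)
Lemma design_full_rank k : (k <= n)%N -> (k <= p)%N ->
  P [set w | \det ((design k w)^T *m design k w) = 0] = 0%E.
Proof.
move=> kn kp.
have [->|k0] := posnP k.
  rewrite (_ : [set _ | _] = set0) ?measure0//.
  by apply/seteqP; split => // w /=; rewrite det_mx00 => /eqP; rewrite oner_eq0.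
have n0 : (0 < n)%N by exact: leq_trans kn.
have p0 : (0 < p)%N by exact: leq_trans kp.
pose e i j : 'I_n * ('I_p + unit) :=
  (insubd (Ordinal n0) i, inl (insubd (Ordinal p0) j)).
have eE i j : (i < k)%N -> (j < k)%N -> val (insubd (Ordinal n0) i) = i /\ val (insubd (Ordinal p0) j) = j.
  move=> ik jk; rewrite !val_insubd.
  by rewrite (leq_trans ik kn) (leq_trans jk kp).
have V0 a x : P (V a @^-1` [set x]) = 0%E by case: (stdV a) => _ _ _ _ [_ ->].
have e_inj i j i' j' : (i < k)%N -> (j < k)%N -> (i' < k)%N -> (j' < k)%N ->
    e i j = e i' j' -> (i, j) = (i', j').
  move=> ik jk i'k j'k [/(congr1 val) + /(congr1 val)].
  have [-> ->] := eE i j ik jk; have [-> ->] := eE i' j' i'k j'k.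
  by move=> /= -> ->.
have minor0 := leading_minor_neq0 mV indV V0 e_inj (leqnn k).
apply/eqP; rewrite eq_le measure_ge0 andbT -[leRHS]minor0.
apply: le_measure; rewrite ?inE.
- by apply: measurable_eq_cst; exact: measurable_gram_det.
- apply: measurable_eq_cst; apply: measurable_det => i j.
  by rewrite (_ : (fun _ => _) = V (e i j))//; apply/funext => w; rewrite mxE.
move=> w /= /eqP det0; apply/eqP; apply: contraTT det0 => det1.
apply: (gram_det_neq0 (f := fun i : 'I_k => insubd (Ordinal n0) i)).
rewrite (_ : \matrix_(i, j) _ = \matrix_(i < k, j < k) V (e i j) w)//.
apply/matrixP => i j; rewrite !mxE /score /e; case: insubP => [j' _ j'j|].
  congr (V (_, inl _) w); apply: val_inj.
  by rewrite val_insubd (leq_trans (ltn_ord j) kp) j'j.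
by rewrite (leq_trans (ltn_ord j) kp).
Qed.

Let mid1 k := measurable_block_id mV (J := low k).
Let mid2 k := measurable_block_id mV (J := (~: low k)%SET).
Let ind12 k := independent_blocks mV indV (J := low k).

Lemma projected_noise_deviation k (e : R) : (k <= n)%N -> (k <= p)%N -> 0 < e ->
  (P [set w | (e <= `|sqn (resid_proj (design k w) *m noise k w) -
      (n%:R - k%:R) * noise_var k|)%R] <=
   ((4 * K + 4) * noise_var k ^+ 2 * n%:R / e ^+ 2)%:E)%E.
Proof.
move=> kn kp e0.
pose M i j (w : block V (low k)) := resid_proj (design k w) i j.
have mM i j : measurable_fun [set: block V (low k)] (M i j).
  apply: measurable_resid_proj => i' j'.
  rewrite (_ : (fun _ => _) = (score i' j' : block V (low k) -> R)); first exact: mscore.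
  by apply/funext => w; rewrite mxE.
have Mn x : \sum_i \sum_j M i j x ^+ 2 <= n%:R by exact: resid_proj_sum_sqr_le.
have := random_quadratic_form_variance (@mid1 k) (@mid2 k) (@ind12 k) (@mxi k)
  (@noise_independent k) (I4 k) (E1 k) (E2 k) (E4 k) K0 mM Mn.
rewrite s2 s4.
pose q (w : T) := \sum_i \sum_j M i j w * (xi k i w * xi k j w - (i == j)%:R * noise_var k).
rewrite -[X in (X <= _)%E -> _]/(\int[P]_w (q w ^+ 2)%:E)%E => h.
have mq : measurable_fun [set: T] q.
  apply: measurable_sum => i; apply: measurable_sum => j; apply: measurable_funM.
    exact: (measurableT_comp (mM i j) (@mid1 k)).
  by apply: measurable_funB => //; apply: measurable_funM; exact: measurable_noise.
have h2 := markov_ge0 (measurable_funX 2 mq) (fun w => sqr_ge0 (q w)) (exprn_gt0 2 e0) h.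
apply: le_trans h2.
pose D := [set w | \det ((design k w)^T *m design k w) = 0].
have md := measurable_gram_det k.
have mD : measurable D by exact: measurable_eq_cst.
have mQ : measurable [set w : T | e ^+ 2 <= q w ^+ 2] by apply: measurable_ge; exact: measurable_funX.
(* The form [q] is centred by the trace, which equals n - k only when the Gram determinant is
   nonzero; the null event [D] is added to the cover at no cost. *)
rewrite -[leRHS]add0e -{1}(design_full_rank kn kp).
apply: le_trans (measureU2 P mD mQ).
have sqE w : sqn (resid_proj (design k w) *m noise k w) =
    \sum_i \sum_j M i j w * (xi k i w * xi k j w) by rewrite resid_proj_sqn.
apply: le_measure; rewrite ?inE.
- apply: measurable_ge; apply: measurableT_comp => //; apply: measurable_funB => //.
  rewrite (_ : (fun _ => _) = fun w => \sum_i \sum_j M i j w * (xi k i w * xi k j w)).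
    apply: measurable_sum => i; apply: measurable_sum => j; apply: measurable_funM.
      exact: (measurableT_comp (mM i j) (@mid1 k)).
    by apply: measurable_funM; exact: measurable_noise.
  by apply/funext => w; rewrite sqE.
- exact: measurableU.
move=> w /= hw; have [|detw] := eqVneq (\det ((design k w)^T *m design k w)) 0; first by left.
right => /=.
have qE : q w = sqn (resid_proj (design k w) *m noise k w) - (n%:R - k%:R) * noise_var k.
  rewrite sqE -(resid_proj_trace detw) /q /mxtrace mulr_suml -sumrB.
  apply: eq_bigr => i _; rewrite (bigD1 i)//= [in RHS](bigD1 i)//= eqxx mul1r mulrBr.
  rewrite addrAC; congr (_ + _ - _); apply: eq_bigr => j ji.
  by rewrite eq_sym (negbTE ji) mul0r subr0.
by rewrite -ler_norm_sqr// qE.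
Qed.

Lemma noise_deviation k (e : R) : 0 < e ->
  (P [set w | (e <= `|sqn (noise k w) - n%:R * noise_var k|)%R] <=
   ((4 * K + 4) * noise_var k ^+ 2 * n%:R / e ^+ 2)%:E)%E.
Proof.
move=> e0.
have mn := measurable_noise k.
have := quadratic_form_variance mn (@noise_independent k) (I4 k) (E1 k) (E2 k) (E4 k)
  (fun i j => (i == j)%:R).
rewrite s2 s4 (_ : \sum_i \sum_j (i == j)%:R ^+ 2 = n%:R); last first.
  rewrite -[in RHS](card_ord n) -sum1_card natr_sum; apply: eq_bigr => i _.
  rewrite (bigD1 i)//= eqxx expr1n big1 ?addr0// => j ji.
  by rewrite eq_sym (negbTE ji) expr0n.
pose q w := sqn (noise k w) - n%:R * noise_var k.
rewrite (eq_integral (fun w => (q w ^+ 2)%:E)); last first.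
  move=> w _; congr ((_ ^+ 2)%:E).
  rewrite /q -[n in n%:R](card_ord n) -sum1_card natr_sum mulr_suml -sumrB.
  apply: eq_bigr => i _; rewrite (bigD1 i)//= eqxx !mul1r -expr2 big1 ?addr0// => j ji.
  by rewrite eq_sym (negbTE ji) mul0r.
move=> h.
have mq : measurable_fun [set: T] q.
  by apply: measurable_funB => //; apply: measurable_sum => i; exact: measurable_funX.
have h2 := markov_ge0 (measurable_funX 2 mq) (fun w => sqr_ge0 (q w)) (exprn_gt0 2 e0) h.
apply: le_trans h2; rewrite le_eqVlt; apply/orP; left; apply/eqP; congr (P _).
by apply/seteqP; split => w /=; rewrite -ler_norm_sqr.
Qed.

Lemma score_noise_moment k (e : R) : (k <= p)%N -> 0 < e ->
  (P [set w | (e <= \sum_(j < k) (\sum_i score i j w * noise k w i 0) ^+ 2)%R] <=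
   (k%:R * n%:R * noise_var k / e)%:E)%E.
Proof.
move=> kp e0.
have mn := measurable_noise k.
have mu j : measurable_fun [set: T] (fun w => \sum_i score i j w * noise k w i 0).
  by apply: measurable_sum => i; apply: measurable_funM => //; exact: measurable_score.
apply: markov_ge0 => //.
- by apply: measurable_sum => j; exact: measurable_funX.
- by move=> w; apply: sumr_ge0 => j _; exact: sqr_ge0.
under eq_integral do rewrite -sumEFin.
rewrite ge0_integral_sum//; last 2 first.
- by move=> j; apply/measurable_EFinP; exact: measurable_funX.
- by move=> j w _; rewrite lee_fin sqr_ge0.
rewrite (eq_bigr (fun=> (n%:R * noise_var k)%:E)) => [|j _].
  by rewrite sumEFin sumr_const card_ord lee_fin -(mulr_natl (n%:R * _) k) mulrA.
rewrite (random_linear_form_variance (@mid1 k) (@mid2 k) (@ind12 k) (@mxi k)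
  (@noise_independent k) (I4 k) (E1 k) (E2 k) (fun i => @mscore k i j (ltn_ord j))).
rewrite s2 mulrC EFinM; congr (_ * _)%E.
have jp := leq_trans (ltn_ord j) kp.
have sE i w : score i j w = V (i, inl (Ordinal jp)) w.
  rewrite /score; case: insubP => [j' _ j'j|]; last by rewrite jp.
  by congr (V (_, inl _) w); apply: val_inj.
rewrite (eq_integral (fun w => (\sum_i V (i, inl (Ordinal jp)) w ^+ 2)%:E)); last first.
  by move=> w _; congr (_%:E); apply: eq_bigr => i _; rewrite sE.
under eq_integral do rewrite -sumEFin.
rewrite ge0_integral_sum//; last 2 first.
- by move=> i; apply/measurable_EFinP; exact: measurable_funX.
- by move=> i w _; rewrite lee_fin sqr_ge0.
rewrite (eq_bigr (fun=> 1%:E)) => [|i _].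
  by rewrite sumEFin sumr_const card_ord.
have [_ _ _ + _] := stdV (i, inl (Ordinal jp)); rewrite /Rintegral.
by case: (\int[P]_w _)%E => [r /= ->//|/eqP|/eqP]; rewrite /= eq_sym oner_eq0.
Qed.



End gaussian_design.

(** * Arithmetic of the criterion *)

Section selection_arith.
Context (R : realFieldType) (x nu v : R).
Hypothesis x100 : 100 <= x.
Hypothesis nu0 : 0 < nu.
Hypothesis nu1 : nu <= 1.
Hypothesis v0 : 0 < v.

(** Here x stands for n, y for N and v for the noise variance at N. As x is at least 100, y is at
    least 99 x / 200, which is the origin of 99/200. *)
Lemma crit_upper (y r : R) : (x - 1) / 2 <= y -> y <= x / 2 ->
  r < (1 + nu / 40) * ((x - y) * v) ->
  r * (x - nu * y) / (x - y) <= (1 + nu / 40) * (1 - 99 / 200 * nu) * (x * v).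
Proof.
have [x1 nu0' nu1' v0'] := And4 x100 nu0 nu1 v0.
move=> hl hN hr; have d0 : 0 < x - y by lra.
rewrite ler_pdivrMr//.
have h1 : x - nu * y <= (1 - 99 / 200 * nu) * x.
  have : 0 <= nu * (y - 99 / 200 * x) by rewrite mulr_ge0//; lra.
  lra.
have h2 : 0 <= x - nu * y.
  have : nu * y <= y by rewrite ler_piMl//; lra.
  lra.
apply: (@le_trans _ _ ((1 + nu / 40) * ((x - y) * v) * (x - nu * y))).
  by apply: ler_wpM2r => //; exact: ltW.
rewrite [leRHS](_ : _ = (1 + nu / 40) * ((x - y) * v) * ((1 - 99 / 200 * nu) * x)); last by ring.
apply: ler_wpM2l => //; rewrite !mulr_ge0//; lra.
Qed.

(** The residual r at k is compared with the residual rl at a grid point l at most g further on. As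
    x - k exceeds 3 x / 4, a step of nu x / 50 costs at most the factor 1 - 4 nu / 150. *)
Lemma crit_lower (k l g wl rl r : R) : 0 <= k -> k < x / 4 -> l <= k + g ->
  g <= nu / 50 * x -> v <= wl -> rl <= r ->
  (1 - nu / 40) * ((x - l) * wl) < rl ->
  (1 + nu / 40) * (1 - 99 / 200 * nu) * (x * v) < r * (x - nu * k) / (x - k).
Proof.
have [x1 nu0' nu1' v0'] := And4 x100 nu0 nu1 v0.
move=> k0 kn lkg gn wl0 mono hr.
have d0 : 0 < x - k by lra.
have e1 : (1 - 4 / 150 * nu) * (x - k) <= x - l.
  have : nu * (3 / 4 * x) <= nu * (x - k) by rewrite ler_wpM2l//; lra.
  lra.
have n1 : 0 < 1 - 4 / 150 * nu by lra.
have e2 : (1 - 4 / 150 * nu) * (x - k) * v <= (x - l) * wl.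
  by apply: ler_pM => //; [rewrite mulr_ge0// ltW|exact: ltW].
have h1 : (1 - nu / 40) * ((1 - 4 / 150 * nu) * (x - k) * v) <= r.
  apply: le_trans mono; apply: ltW; apply: le_lt_trans hr.
  by rewrite ler_wpM2l//; lra.
rewrite ltr_pdivlMr//.
have h3 : (1 - nu / 4) * x <= x - nu * k.
  have : nu * k <= nu * (x / 4) by rewrite ler_wpM2l//; lra.
  lra.
apply: (@lt_le_trans _ _ ((1 - nu / 40) * ((1 - 4 / 150 * nu) * (x - k) * v) * ((1 - nu / 4) * x))).
  (* To first order, the losses 1/40 + 4/150 + 1/4 on one side stay below 99/200 - 1/40 on the
     other; the cubic term is absorbed by the quadratic one. *)
  rewrite [ltLHS](_ : _ = (1 + nu / 40) * (1 - 99 / 200 * nu) * (x * v * (x - k))); last by ring.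
  rewrite [ltRHS](_ : _ = (1 - nu / 40) * (1 - 4 / 150 * nu) * (1 - nu / 4) * (x * v * (x - k))); last by ring.
  rewrite ltr_pM2r; last by rewrite !mulr_gt0//; lra.
  have s0 : 0 < nu * nu by rewrite mulr_gt0.
  have s2 : nu * nu * nu <= nu * nu by rewrite ler_piMr// ltW.
  lra.
apply: ler_pM => //; rewrite !mulr_ge0//; lra.
Qed.

Lemma grid_step_bound (k g : R) : k < x / 4 -> g <= nu / 50 * x -> k + g <= (x - 1) / 2.
Proof.
have [x1 nu0' nu1' v0'] := And4 x100 nu0 nu1 v0.
move=> kx gx; have : nu * x <= x by rewrite ler_piMl//; lra.
lra.
Qed.

Lemma rss_le_crit (k r : R) : 0 <= k -> k <= x / 2 -> 0 <= r ->
  r <= r * (x - nu * k) / (x - k).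
Proof.
have [x1 nu0' nu1' v0'] := And4 x100 nu0 nu1 v0.
move=> k0 kx r0; rewrite ler_pdivlMr; last lra.
by rewrite ler_wpM2l// lerD2l lerN2 ler_piMl.
Qed.

(* AM-GM with weight [20 y / nu] on each product [2 D_j u_j]. *)
Lemma score_lower (I : finType) (D u : I -> R) (y e r : R) : 0 < y -> y <= x ->
  \sum_j u j ^+ 2 <= 4 * (x * y * v) ->
  e - 2 * \sum_j D j * u j <= r ->
  (1 - nu / 40) * (x * v) <= e ->
  r <= (1 + nu / 40) * (1 - 99 / 200 * nu) * (x * v) ->
  nu ^+ 2 / 100 * v <= \sum_j D j ^+ 2.
Proof.
have [x1 nu0' nu1' v0'] := And4 x100 nu0 nu1 v0.
move=> y0 yx hu hr he hr'.
have y1 : y != 0 by rewrite gt_eqF.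
have nu2 : nu != 0 by rewrite gt_eqF.
pose l := 20 * y / nu; have l0 : 0 < l by rewrite divr_gt0// mulr_gt0.
have h1 : 2 * \sum_j D j * u j <= l * \sum_j D j ^+ 2 + l^-1 * \sum_j u j ^+ 2.
  rewrite !mulr_sumr -big_split/=; apply: ler_sum => j _.
  have := sqr_ge0 (l * D j - u j); rewrite -(pmulr_rge0 _ (_ : 0 < l^-1)) ?invr_gt0// => h.
  rewrite -subr_ge0; apply: (le_trans h); rewrite le_eqVlt; apply/orP; left; apply/eqP.
  by field; rewrite gt_eqF.
have h2 : l^-1 * \sum_j u j ^+ 2 <= nu * (x * v) / 5.
  apply: (@le_trans _ _ (l^-1 * (4 * (x * y * v)))).
    by rewrite ler_wpM2l// invr_ge0 ltW.
  by rewrite le_eqVlt; apply/orP; left; apply/eqP; rewrite /l; field; apply/andP.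
have xv0 : 0 < x * v by rewrite mulr_gt0//; lra.
have nxv : 0 < nu * (x * v) by rewrite mulr_gt0.
have nnxv : 0 < nu * (nu * (x * v)) by rewrite mulr_gt0.
(* The gap e - r is at least (99/200 - 1/20) nu x v, more than twice the nu x v / 5 taken by the
   term in u. *)
have h3 : nu * (x * v) / 5 <= l * \sum_j D j ^+ 2 by lra.
have h4 : nu ^+ 2 / 100 * v * y <= y * \sum_j D j ^+ 2.
  have : nu * (nu * (x * v) / 5) <= nu * (l * \sum_j D j ^+ 2) by rewrite ler_wpM2l// ltW.
  rewrite [X in _ <= X -> _](_ : _ = 20 * (y * \sum_j D j ^+ 2)); last by rewrite /l; field.
  have : nu * nu * v * y <= nu * nu * v * x by rewrite ler_wpM2l// !mulr_ge0// ltW.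
  lra.
by rewrite -(ler_pM2l y0) [leLHS]mulrC.
Qed.

End selection_arith.

(** * Selection from the values on the grid *)

Section selection.
Context (R : realFieldType) (n N Q g : nat) (nu v : R) (rss w : nat -> R).
Hypothesis nu0 : 0 < nu.
Hypothesis nu1 : nu <= 1.
Hypothesis v0 : 0 < v.
Hypothesis n100 : (100 <= n)%N.
Hypothesis Nn : N = n./2.
Hypothesis g0 : (0 < g)%N.
Hypothesis gn : g%:R <= nu / 50 * n%:R.
Hypothesis Qg : (n <= 2 * Q * g)%N.
Hypothesis rss_ge0 : forall k, 0 <= rss k.
Hypothesis rss_decr : forall k l, (k <= l <= N)%N -> rss l <= rss k.
Hypothesis w_ge : forall k, (k <= N)%N -> v <= w k.
Hypothesis wN : w N = v.

(** Truncation at N makes N itself a grid point, reached at a = 2 Q. *)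
Definition grid (N g a : nat) : nat := minn (a * g) N.

Hypothesis rss_conc : forall a, (a <= 2 * Q)%N ->
  `|rss (grid N g a) - (n%:R - (grid N g a)%:R) * w (grid N g a)| <
  nu / 40 * ((n%:R - (grid N g a)%:R) * w (grid N g a)).

Definition crit (n : nat) (nu r : R) (k : nat) : R :=
  n%:R^-1 * r * (1 + (1 - nu) * (k%:R / (n%:R - k%:R))).

Let x100 : 100 <= n%:R :> R. Proof. by rewrite (ler_nat R 100). Qed.

Let n0 : 0 < n%:R :> R.
Proof. by rewrite ltr0n (leq_trans _ n100). Qed.

Let half k : (k <= N)%N -> k%:R <= n%:R / 2 :> R.
Proof.
move=> kN; rewrite ler_pdivlMr// -natrM ler_nat muln2 -geq_half_double.
by rewrite -Nn.
Qed.

Let Nlow : (n%:R - 1) / 2 <= N%:R :> R.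
Proof.
rewrite ler_pdivrMr// lerBlDr -natrM natr1 ler_nat Nn muln2.
by rewrite -{1}(odd_double_half n) -addn1 addnC leq_add2l; case: (odd n).
Qed.

Let critE k : (k <= N)%N ->
  n%:R * crit n nu (rss k) k = rss k * (n%:R - nu * k%:R) / (n%:R - k%:R).
Proof.
move=> /half kn.
have nn : n%:R != 0 :> R by rewrite gt_eqF.
have d0 : n%:R - k%:R != 0 :> R.
  rewrite subr_eq0 gt_eqF// (le_lt_trans kn)// ltr_pdivrMr// ltr_pMr//.
  by rewrite ltr1n.
by rewrite /crit; field; apply/andP.
Qed.

Let gridN : grid N g (2 * Q) = N.
Proof.
apply/minn_idPr; apply: leq_trans Qg; rewrite Nn.
by rewrite -{2}(odd_double_half n) -addnn addnA leq_addl.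
Qed.

Let critN : n%:R * crit n nu (rss N) N <= (1 + nu / 40) * (1 - 99 / 200 * nu) * (n%:R * v).
Proof.
rewrite critE//; apply: crit_upper => //; first exact: half.
have := rss_conc (leqnn _); rewrite gridN wN => /ltr_distlDr h.
by rewrite mulrDl mul1r.
Qed.

Lemma selection_dimension k : (k <= N)%N ->
  crit n nu (rss k) k <= crit n nu (rss N) N -> n%:R / 4 <= k%:R :> R.
Proof.
move=> kN kc; rewrite leNgt; apply/negP => kn.
(* The first multiple of g beyond k. It is at most k + g, hence below N, so no truncation occurs. *)
pose a := (k %/ g).+1; have kg := divn_eq k g; have rg := ltn_pmod k g0.
have ka : (k <= a * g)%N by rewrite /a mulSn {1}kg addnC leq_add2r ltnW.
have agk : (a * g <= k + g)%N by rewrite /a mulSn addnC leq_add2r leq_trunc_div.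
have lkg : (a * g)%:R <= k%:R + g%:R :> R by rewrite -natrD ler_nat.
have agN : (a * g <= N)%N.
  rewrite -(ler_nat R); apply: le_trans lkg _; apply: le_trans Nlow.
  exact: (grid_step_bound x100 nu0 nu1 v0 kn gn).
have gE : grid N g a = (a * g)%N by exact/minn_idPl.
have aQ : (a <= 2 * Q)%N.
  rewrite -(leq_pmul2r g0) (leq_trans agN)// (leq_trans _ Qg)// Nn.
  by rewrite -{2}(odd_double_half n) -addnn addnA leq_addl.
have := rss_conc aQ; rewrite gE => /ltr_distlCDr hr.
have h2 : n%:R * crit n nu (rss N) N < n%:R * crit n nu (rss k) k.
  apply: (le_lt_trans critN); rewrite critE//.
  apply: (@crit_lower _ _ _ _ x100 nu0 nu1 v0 _ (a * g)%:R g%:R (w (a * g)%N) (rss (a * g)%N)) => //.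
  - exact: w_ge.
  - by apply: rss_decr; rewrite ka.
  - by rewrite mulrBl mul1r ltrBlDr.
by move: h2; rewrite ltr_pM2l// ltNge kc.
Qed.

(** The penalty is nonnegative, so the residual sum of squares is at most n times the criterion,
    which does not exceed its value at N. *)
Lemma selection_rss k : (k <= N)%N -> crit n nu (rss k) k <= crit n nu (rss N) N ->
  rss k <= (1 + nu / 40) * (1 - 99 / 200 * nu) * (n%:R * v).
Proof.
move=> kN kc; apply: le_trans critN; apply: (@le_trans _ _ (n%:R * crit n nu (rss k) k)); last first.
  by rewrite ler_pM2l.
by rewrite critE//; apply: rss_le_crit => //; exact: half.
Qed.

End selection.

Lemma sum_below (V : nmodType) N p (F : nat -> V) : (N <= p)%N ->
  \sum_(j < p) F j = \sum_(j < N) F j + \sum_(j < p) (if (N <= j)%N then F j else 0).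
Proof.
move=> Np; rewrite (big_ord_widen _ F Np) (bigID (fun j : 'I_p => (j < N)%N))/=.
congr (_ + _); rewrite [LHS]big_mkcond/=; apply: eq_bigr => j _.
by rewrite -leqNgt.
Qed.

Lemma model_space_nested (R : realType) p k (u : 'cV[R]_p) :
  model_space R (nested_model p k) u <-> below k u.
Proof.
split=> h j; first by move=> kj; apply: h; rewrite inE -leqNgt.
by rewrite inE -leqNgt; exact: h.
Qed.

Lemma card_nested_model p k : (k <= p)%N -> #|nested_model p k| = k.
Proof.
move=> kp; rewrite /nested_model cardsE -sum1_card -(big_ord_widen p (fun=> 1%N) kp).
by rewrite sum_nat_const card_ord muln1.
Qed.

Lemma subcvE (R : zmodType) n (u v : 'cV[R]_n) i : (u - v) i 0 = u i 0 - v i 0.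
Proof. by rewrite !mxE. Qed.

Lemma sqnB (R : realFieldType) n (u v : 'cV[R]_n) :
  sqn (u - v) = sqn u - 2 * (u^T *m v) 0 0 + sqn v.
Proof.
rewrite /sqn mxE mulr_sumr -sumrB -big_split/=; apply: eq_bigr => i _.
by rewrite subcvE mxE; ring.
Qed.

(** * Residuals and loss in the score coordinates *)

Section residuals.
Context d (T : measurableType d) (R : realType).
Context (p : nat) (Sigma : 'M[R]_p) (c : nat -> 'cV[R]_p).
Hypothesis Sigma_sym : Sigma^T = Sigma.
Hypothesis cp : orthonormal_flag Sigma c p.
Context (theta : 'cV[R]_p) (sigma : R).
Hypothesis sigma0 : sigma != 0.
Context (n : nat) (bY : 'I_n -> T -> R) (bX : 'I_n -> T -> p.-tuple R).

Let V := obs_score sigma theta c bY bX.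
Let tau j := ip Sigma theta (c j).

Lemma score_obs i j w : (j < p)%N -> score V i j w = dotp (bX i w) (c j).
Proof.
move=> jp; rewrite /score; case: insubP => [j' _ j'j|]; last by rewrite jp.
by rewrite /V /obs_score /= j'j.
Qed.

Lemma noise_obs k i w : noise V tau sigma k w i 0 =
  \sum_(j < p) (if (k <= j)%N then tau j * dotp (bX i w) (c j) else 0) +
  (bY i w - dotp (bX i w) theta).
Proof.
rewrite mxE sum_sum_unit /= /V /obs_score /=; congr (_ + _); last first.
  by rewrite mulrC divfK.
by apply: eq_bigr => j _; case: ifP => // _; rewrite mul0r.
Qed.

Lemma dotp_below k u i w : (k <= p)%N -> below k u ->
  dotp (bX i w) u = \sum_(j < k) ip Sigma u (c j) * dotp (bX i w) (c j).
Proof. by move=> kp ub; case: cp => _ _ /(_ k u kp ub) {1}->; rewrite dotp_sum. Qed.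

(** The first k coordinates of theta are absorbed into the unknown. Least squares for the response
    on the model is thereby least squares for its noise on the first k scores. *)
Lemma residual_below k u w : (k <= p)%N -> below k u ->
  obs_response bY w - obs_design bX w *m u =
  noise V tau sigma k w - design V k w *m (\col_j (ip Sigma u (c j) - tau j)).
Proof.
move=> kp ub; apply/colP => i.
have -> : (obs_response bY w - obs_design bX w *m u) i 0 = bY i w - dotp (bX i w) u.
  rewrite subcvE !mxE; congr (_ - _); rewrite dotpE.
  by apply: eq_bigr => j _; rewrite mxE mulrC.
rewrite subcvE noise_obs mxE.
have -> : \sum_j design V k w i j * (\col_j (ip Sigma u (c j) - tau j)) j 0 =
    dotp (bX i w) u - \sum_(j < k) tau j * dotp (bX i w) (c j).
  rewrite (dotp_below i w kp ub) -sumrB; apply: eq_bigr => j _.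
  by rewrite !mxE score_obs ?(leq_trans (ltn_ord j))//; ring.
have -> : dotp (bX i w) theta = \sum_(j < p) tau j * dotp (bX i w) (c j).
  by rewrite {1}(flag_expand cp theta) dotp_sum.
rewrite (sum_below (fun j => tau j * dotp (bX i w) (c j)) kp).
by ring.
Qed.

Lemma argmin_rss k u w : (0 < n)%N -> (k <= p)%N ->
  \det ((design V k w)^T *m design V k w) != 0 ->
  is_argmin (model_space R (nested_model p k))
    (emp_risk (obs_response bY w) (obs_design bX w)) u ->
  sqn (obs_response bY w - obs_design bX w *m u) =
  sqn (resid_proj (design V k w) *m noise V tau sigma k w).
Proof.
move=> n0 kp det0 [/model_space_nested ub umin]; apply/le_anti/andP; split; last first.
  by rewrite (residual_below w kp ub); exact: least_squares_ge.
have [b <-] := least_squares_attained (design V k w) (noise V tau sigma k w).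
(* The coordinates are shifted by those of theta so that the coordinate error of [u'] is exactly
   [b]. *)
pose t (j : nat) := (if insub j is Some j' then b j' 0 else 0) + tau j.
pose u' := \sum_(j < k) t j *: c j.
have u'b : below k u'.
  by apply: below_sum => j jk; case: cp => _ h _; apply: h; exact: leq_trans kp.
have := umin u'; rewrite /emp_risk /sqnorm_n => /(_ (proj2 (model_space_nested k u') u'b)).
rewrite ler_pM2l ?invr_gt0 ?ltr0n// => /le_trans; apply.
rewrite -/(sqn _) (residual_below w kp u'b) le_eqVlt; apply/orP; left; apply/eqP.
congr (sqn (_ - _ *m _)); apply/colP => j; rewrite mxE (flag_coord cp)//; last first.
  exact: leq_trans kp.
by rewrite ltn_ord /t valK addrK.
Qed.

(** The residual is the noise minus the design applied to the coordinate error; expanding the square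
    and dropping the square of the fitted part leaves this bound. *)
Lemma rss_decomposition N u w : (N <= p)%N -> below N u ->
  sqn (noise V tau sigma N w) - 2 * \sum_(j < N) (ip Sigma u (c j) - tau j) *
    \sum_i score V i j w * noise V tau sigma N w i 0 <=
  sqn (obs_response bY w - obs_design bX w *m u).
Proof.
move=> Np ub; rewrite (residual_below w Np ub); set D := \col_j _.
rewrite sqnB.
rewrite (_ : (_ *m _) 0 0 = \sum_(j < N) (ip Sigma u (c j) - tau j) *
    \sum_i score V i j w * noise V tau sigma N w i 0); first by rewrite lerDl sqn_ge0.
rewrite mulmxA mxE; apply: eq_bigr => j _; rewrite mulrC mxE; congr (_ * _).
by rewrite mxE; apply: eq_bigr => i _; rewrite mulrC mxE [X in _ * X]mxE.
Qed.

Lemma noise_varE N : noise_var p tau sigma N =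
  \sum_(j < p) (if (N <= j)%N then tau j ^+ 2 else 0) + sigma ^+ 2.
Proof.
rewrite /noise_var sum_sum_unit; congr (_ + _); apply: eq_bigr => j _ /=.
by case: ifP => // _; rewrite expr0n.
Qed.

Lemma noise_var_decr k N : (k <= N)%N ->
  noise_var p tau sigma N <= noise_var p tau sigma k.
Proof.
move=> kN; rewrite !noise_varE lerD2r; apply: ler_sum => j _.
case: ifP => [Nj|_]; first by rewrite (leq_trans kN Nj).
by case: ifP => // _; exact: sqr_ge0.
Qed.

Lemma loss_below N u : (N <= p)%N -> below N u ->
  ip Sigma (u - theta) (u - theta) =
  \sum_(j < N) (ip Sigma u (c j) - tau j) ^+ 2 + (noise_var p tau sigma N - sigma ^+ 2).
Proof.
move=> Np ub; rewrite (flag_parseval Sigma_sym cp) noise_varE addrK.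
under eq_bigr do rewrite ipBl -/(tau _).
rewrite (sum_below (fun j => (ip Sigma u (c j) - tau j) ^+ 2) Np); congr (_ + _).
apply: eq_bigr => j _; case: ifP => // Nj.
by rewrite (flag_below_coord cp Np ub)// sub0r sqrrN.
Qed.

Lemma best_approximation N : (N <= p)%N -> exists2 u, below N u &
  ip Sigma (u - theta) (u - theta) = noise_var p tau sigma N - sigma ^+ 2.
Proof.
move=> Np; exists (\sum_(j < N) tau j *: c j).
  by apply: below_sum => j jN; case: cp => _ h _; apply: h; exact: leq_trans Np.
rewrite (@loss_below N)//; last first.
  by apply: below_sum => j jN; case: cp => _ h _; apply: h; exact: leq_trans Np.
rewrite big1 ?add0r// => j _.
by rewrite (flag_coord cp) ?ltn_ord ?subrr ?expr0n ?(leq_trans _ Np).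
Qed.

End residuals.

(** * The selected model at an outcome without deviations *)

Section selected_model.
Context d (T : measurableType d) (R : realType).
Context (p : nat) (Sigma : 'M[R]_p) (c : nat -> 'cV[R]_p).
Hypothesis Sigma_sym : Sigma^T = Sigma.
Hypothesis cp : orthonormal_flag Sigma c p.
Context (theta : 'cV[R]_p) (sigma : R).
Hypothesis sigma0 : 0 < sigma.
Context (n : nat) (bY : 'I_n -> T -> R) (bX : 'I_n -> T -> p.-tuple R).
Context (nu : R) (N Q g : nat).
Hypothesis nu0 : 0 < nu.
Hypothesis nu1 : nu <= 1.
Hypothesis n100 : (100 <= n)%N.
Hypothesis Nn : N = n./2.
Hypothesis Np : (N <= p)%N.
Hypothesis g0 : (0 < g)%N.
Hypothesis gn : g%:R <= nu / 50 * n%:R.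
Hypothesis Qg : (n <= 2 * Q * g)%N.

Local Notation V := (obs_score sigma theta c bY bX).
Local Notation tau := (fun j => ip Sigma theta (c j)).
Local Notation var := (noise_var p tau sigma).

Context (w : T) (th : nat -> 'cV[R]_p) (kh : nat).
Hypothesis full_rank : forall k, (k <= N)%N ->
  \det ((design V k w)^T *m design V k w) != 0.
Hypothesis th_min : forall k, (k <= N)%N ->
  is_argmin (model_space R (nested_model p k))
    (emp_risk (obs_response bY w) (obs_design bX w)) (th k).
Hypothesis conc : forall a, (a <= 2 * Q)%N ->
  `|sqn (resid_proj (design V (grid N g a) w) *m noise V tau sigma (grid N g a) w) -
    (n%:R - (grid N g a)%:R) * var (grid N g a)| <
  nu / 40 * ((n%:R - (grid N g a)%:R) * var (grid N g a)).

Let rss k := sqn (obs_response bY w - obs_design bX w *m th k).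

Hypothesis khN : (kh <= N)%N.
Hypothesis kh_min : crit n nu (rss kh) kh <= crit n nu (rss N) N.

Let n0 : (0 < n)%N. Proof. exact: leq_trans n100. Qed.

Let sigma_neq0 : sigma != 0. Proof. by rewrite gt_eqF. Qed.

Lemma noise_var_ge_sqr k : sigma ^+ 2 <= var k.
Proof.
by rewrite noise_varE lerDr; apply: sumr_ge0 => j _; case: ifP => // _; exact: sqr_ge0.
Qed.

Lemma noise_var_gt0 k : 0 < var k.
Proof. by apply: lt_le_trans (noise_var_ge_sqr k); rewrite exprn_gt0. Qed.

Let rssE k : (k <= N)%N -> rss k = sqn (resid_proj (design V k w) *m noise V tau sigma k w).
Proof.
move=> kN; apply: (argmin_rss cp) => //; first exact: leq_trans Np.
- exact: full_rank.
- exact: th_min.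
Qed.

Let rss_decr k l : (k <= l <= N)%N -> rss l <= rss k.
Proof.
move=> /andP[kl lN]; have [_ lmin] := th_min lN.
have [/model_space_nested kb _] := th_min (leq_trans kl lN).
have := lmin (th k) (proj2 (model_space_nested l (th k)) (belowW kl kb)).
by rewrite /emp_risk /sqnorm_n ler_pM2l// invr_gt0 ltr0n.
Qed.

Let rss_conc a : (a <= 2 * Q)%N ->
  `|rss (grid N g a) - (n%:R - (grid N g a)%:R) * var (grid N g a)| <
  nu / 40 * ((n%:R - (grid N g a)%:R) * var (grid N g a)).
Proof. by move=> aQ; rewrite rssE ?geq_minr//; exact: conc. Qed.

Let rss_ge0 k : 0 <= rss k. Proof. exact: sqn_ge0. Qed.

Lemma selected_dimension : n%:R / 4 <= kh%:R :> R.
Proof.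
apply: (selection_dimension nu0 nu1 (noise_var_gt0 N) n100 Nn g0 gn Qg rss_decr _ erefl rss_conc) => //.
by move=> k kN; exact: noise_var_decr.
Qed.

Hypothesis noise_conc :
  `|sqn (noise V tau sigma N w) - n%:R * var N| < nu / 40 * (n%:R * var N).
Hypothesis score_small :
  \sum_(j < N) (\sum_i score V i j w * noise V tau sigma N w i 0) ^+ 2 <=
  4 * (n%:R * N%:R * var N).

Lemma selected_loss :
  var N - sigma ^+ 2 + nu ^+ 2 / 100 * sigma ^+ 2 <=
  ip Sigma (th kh - theta) (th kh - theta).
Proof.
have [/model_space_nested khb _] := th_min khN.
(* The models are nested, so the selected estimator has coordinates in the largest model whatever
   the selected size. *)
have thb := belowW khN khb.
rewrite (loss_below Sigma_sym cp theta sigma Np thb) addrC lerD2r.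
have N0 : 0 < N%:R :> R.
  rewrite ltr0n Nn; apply: leq_trans (half_leq n100); exact: isT.
have hr := selection_rss nu0 nu1 (noise_var_gt0 N) n100 Nn Qg rss_ge0 erefl rss_conc khN kh_min.
have he : (1 - nu / 40) * (n%:R * var N) <= sqn (noise V tau sigma N w).
  by have /ltr_distlCDr/ltW := noise_conc; rewrite mulrBl mul1r lerBlDr.
have Nlen : N%:R <= n%:R :> R.
  by rewrite ler_nat Nn -{2}(odd_double_half n) -addnn addnA leq_addl.
have x100 : 100 <= n%:R :> R by rewrite (ler_nat R 100).
have hd := rss_decomposition cp theta sigma_neq0 bY bX w Np thb.
have h := score_lower x100 nu0 nu1 (noise_var_gt0 N) N0 Nlen score_small hd he hr.
apply: le_trans h.
by rewrite ler_wpM2l ?noise_var_ge_sqr// divr_ge0// sqr_ge0.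
Qed.

End selected_model.

(** * Union bound over the deviation events *)

Section deviation_events.
Context d (T : measurableType d) (R : realType) (P : probability T R).
Context (n p : nat) (V : 'I_n * ('I_p + unit) -> T -> R).
Hypothesis stdV : forall a, standardized P (V a).
Hypothesis indV : mutually_independent P V.
Variables (tau : nat -> R) (sigma : R).
Variables (N Q g : nat) (eta : R).
Hypothesis n0 : (0 < n)%N.
Hypothesis Nn : N = n./2.
Hypothesis Np : (N <= p)%N.
Hypothesis eta0 : 0 < eta.
Hypothesis var0 : forall k, 0 < noise_var p tau sigma k.

Lemma measurable_projected_noise k : measurable_fun [set: T]
  (fun w => sqn (resid_proj (design V k w) *m noise V tau sigma k w)).
Proof.
rewrite (_ : (fun _ => _) = fun w => \sum_i \sum_j resid_proj (design V k w) i j *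
    (noise V tau sigma k w i 0 * noise V tau sigma k w j 0)); last first.
  by apply/funext => w; rewrite resid_proj_sqn.
apply: measurable_sum => i; apply: measurable_sum => j; apply: measurable_funM.
  apply: measurable_resid_proj => i' j'.
  rewrite (_ : (fun _ => _) = score V i' j'); first exact: (measurable_score stdV).
  by apply/funext => w; rewrite mxE.
by apply: measurable_funM; exact: (measurable_noise stdV).
Qed.

Lemma measurable_noise_sqn k : measurable_fun [set: T] (fun w => sqn (noise V tau sigma k w)).
Proof.
by apply: measurable_sum => i; apply: measurable_funX; exact: (measurable_noise stdV).
Qed.

(** The indices up to 2 Q are the grid points; the next one carries the unprojected noise at N, so
    that one union over 2 Q + 2 indices covers everything. *)
Definition deviation (a : nat) : set T :=
  if (a <= 2 * Q)%N then
    [set w | eta * ((n%:R - (grid N g a)%:R) * noise_var p tau sigma (grid N g a)) <=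
      `|sqn (resid_proj (design V (grid N g a) w) *m noise V tau sigma (grid N g a) w) -
        (n%:R - (grid N g a)%:R) * noise_var p tau sigma (grid N g a)|]
  else
    [set w | eta * (n%:R * noise_var p tau sigma N) <=
      `|sqn (noise V tau sigma N w) - n%:R * noise_var p tau sigma N|].

Lemma measurable_deviation a : measurable (deviation a).
Proof.
rewrite /deviation; case: ifP => _; apply: measurable_ge; apply: measurableT_comp => //.
  by apply: measurable_funB => //; exact: measurable_projected_noise.
by apply: measurable_funB => //; exact: measurable_noise_sqn.
Qed.

Let n0R : 0 < n%:R :> R. Proof. by rewrite ltr0n. Qed.

(** The numerator constant is 4 * 34 + 4 = 140. The variance cancels, and x at least n / 2
    multiplies by 4. *)
Let bound (x v : R) : n%:R / 2 <= x -> 0 < v ->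
  (4 * (2 * (4 * 3 + 4) + 2) + 4) * v ^+ 2 * n%:R / (eta * (x * v)) ^+ 2 <=
  560 / (eta ^+ 2 * n%:R).
Proof.
move=> nx v0; have x0 : 0 < x by apply: lt_le_trans nx; rewrite divr_gt0.
rewrite [leLHS](_ : _ = 140 * n%:R / (eta ^+ 2 * x ^+ 2)); last first.
  by field; rewrite !gt_eqF.
rewrite ler_pdivrMr ?mulr_gt0 ?exprn_gt0// mulrAC ler_pdivlMr ?mulr_gt0 ?exprn_gt0//.
have h : n%:R ^+ 2 <= 4 * x ^+ 2.
  have : n%:R ^+ 2 <= (2 * x) ^+ 2.
    have h2 : n%:R <= 2 * x by lra.
    by apply: lerXn2r => //; rewrite nnegrE ?ler0n// mulr_ge0// ltW.
  by rewrite [leRHS](_ : _ = 4 * x ^+ 2)//; ring.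
have e2 : 0 <= eta ^+ 2 by exact: sqr_ge0.
rewrite [leLHS](_ : _ = 140 * eta ^+ 2 * n%:R ^+ 2); last by ring.
rewrite [leRHS](_ : _ = 140 * eta ^+ 2 * (4 * x ^+ 2)); last by ring.
by rewrite ler_wpM2l// mulr_ge0.
Qed.

Lemma deviation_measure a : (P (deviation a) <= (560 / (eta ^+ 2 * n%:R))%:E)%E.
Proof.
have half k : (k <= N)%N -> n%:R / 2 <= n%:R - k%:R :> R.
  move=> kN; have : k%:R <= n%:R / 2 :> R.
    by rewrite ler_pdivlMr// -natrM ler_nat muln2 -geq_half_double -Nn.
  by have := n0R; lra.
rewrite /deviation; case: ifP => _.
  have kN : (grid N g a <= N)%N by exact: geq_minr.
  have hk := half _ kN; have x0 : 0 < n%:R - (grid N g a)%:R :> R.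
    by apply: lt_le_trans hk; rewrite divr_gt0.
  apply: (le_trans (projected_noise_deviation stdV indV tau sigma _ _ _)).
  - by apply: leq_trans kN _; rewrite Nn -{2}(odd_double_half n) -addnn addnA leq_addl.
  - exact: leq_trans Np.
  - by rewrite !mulr_gt0.
  - by rewrite lee_fin; exact: bound.
apply: (le_trans (noise_deviation stdV indV tau sigma N _)).
  by rewrite !mulr_gt0.
by rewrite lee_fin; apply: bound => //; have := n0R; lra.
Qed.

Definition deviations : set T := \big[setU/set0]_(a < (2 * Q).+2) deviation a.

Lemma measurable_deviations : measurable deviations.
Proof. by apply: bigsetU_measurable => a _; exact: measurable_deviation. Qed.

Lemma deviations_measure :
  (P deviations <= ((2 * Q).+2%:R * (560 / (eta ^+ 2 * n%:R)))%:E)%E.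
Proof.
apply: (le_trans (Boole_inequality _ _)); first by move=> a _; exact: measurable_deviation.
rewrite mulr_natl -[in leRHS](card_ord (2 * Q).+2) -sumr_const -sumEFin.
by apply: lee_sum => a _; exact: deviation_measure.
Qed.

Lemma deviations_small w a : ~ deviations w -> (a < (2 * Q).+2)%N -> ~ deviation a w.
Proof.
move=> h aQ da; apply: h; rewrite /deviations -bigcup_mkord.
by exists a.
Qed.

End deviation_events.

(* The integral of a nonnegative function is a supremum over the simple functions
   below it. *)
Lemma ge0_le_integral_nonmeasurable d (T : measurableType d) (R : realType)
    (mu : {measure set T -> \bar R}) (f g : T -> \bar R) :
  (forall w, 0 <= f w)%E -> (forall w, f w <= g w)%E ->
  (\int[mu]_w f w <= \int[mu]_w g w)%E.
Proof.
move=> f0 fg; rewrite !ge0_integralTE// => [|w]; last exact: le_trans (fg w).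
apply: le_ereal_sup => _ [h hf <-]; exists h => // w.
by apply: le_trans (fg w); exact: hf.
Qed.

(** The function is compared with a on F plus b on G, a simple function whose integral is a + b
    P(G). *)
Lemma integral_two_levels_le d (T : measurableType d) (R : realType)
    (P : probability T R) (f : T -> \bar R) (F G : set T) (a b : R) :
  measurable F -> measurable G -> 0 <= a -> 0 <= b -> (forall w, 0 <= f w)%E ->
  P F = 1%E -> (2^-1%:E <= P G)%E -> G `<=` F ->
  (forall w, F w -> (a%:E <= f w)%E) -> (forall w, G w -> ((a + b)%:E <= f w)%E) ->
  ((a + b / 2)%:E <= \int[P]_w f w)%E.
Proof.
move=> mF mG a0 b0 f0 PF PG GF fF fG.
pose h w : \bar R := (a%:E * (\1_F w : R)%:E + b%:E * (\1_G w : R)%:E)%E.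
apply: (@le_trans _ _ (\int[P]_w h w)%E).
  rewrite /h ge0_integralD//; first last.
  - apply: emeasurable_funM => //; apply/measurable_EFinP; exact: measurable_indic.
  - by move=> w _; rewrite -EFinM lee_fin mulr_ge0.
  - apply: emeasurable_funM => //; apply/measurable_EFinP; exact: measurable_indic.
  - by move=> w _; rewrite -EFinM lee_fin mulr_ge0.
  rewrite !ge0_integralZl//; first last.
  - by apply/measurable_EFinP; exact: measurable_indic.
  - by apply/measurable_EFinP; exact: measurable_indic.
  have -> : (\int[P]_w (\1_F w)%:E = 1)%E by rewrite integral_indic// setIT; exact: PF.
  have -> : (\int[P]_w (\1_G w)%:E = P G)%E by rewrite integral_indic// setIT.
  rewrite mule1 EFinD leeD2l// EFinM.
  by rewrite lee_wpmul2l// lee_fin.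
apply: ge0_le_integral_nonmeasurable.
  by move=> w; rewrite /h -!EFinM -EFinD lee_fin addr_ge0// mulr_ge0.
move=> w; rewrite /h !indicE; have [Gw|Gw] := boolP (w \in G).
  have Gw' := set_mem Gw; rewrite mem_set; last exact: GF.
  by rewrite !mule1 -EFinD; exact: fG.
have [Fw|Fw] := boolP (w \in F); rewrite ?mule1 ?mule0 ?adde0 ?add0e//.
by apply: fF; exact: set_mem.
Qed.

Lemma probability_avoid d (T : measurableType d) (R : realType) (P : probability T R)
    (A C : set T) (e : R) : measurable A -> measurable C -> P A = 0%E ->
  (P C <= e%:E)%E -> ((1 - e)%:E <= P (~` (A `|` C)))%E.
Proof.
move=> mA mC PA PC; rewrite probability_setC; last exact: measurableU.
rewrite EFinB leeB// (le_trans (measureU2 P mA mC))//.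
by rewrite [X in (X + _)%E]PA add0e.
Qed.

(** * Choice of the constants and conclusion *)

Theorem proposition3p3 (R : realType) (nu delta : R)
    (hnu0 : 0 < nu) (hnu1 : nu <= 1) (hdelta0 : 0 < delta) (hdelta1 : delta < 1) :
  exists (n0 : nat) (L : R), 0 < L /\
  forall (n p : nat) (Sigma : 'M[R]_p) (theta : 'cV[R]_p) (sigma : R)
    (d : measure_display) (Omega : measurableType d) (P : probability Omega R)
    (X : {RV P >-> p.-tuple R}) (eps : {RV P >-> R})
    (bY : 'I_n -> {RV P >-> R}) (bX : 'I_n -> {RV P >-> p.-tuple R})
    (theta_ : {set 'I_p} -> 'cV[R]_p)
    (thetahat : {set 'I_p} -> Omega -> 'cV[R]_p)
    (pen : {set 'I_p} -> R) (mhat : Omega -> {set 'I_p}),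
  (* the distribution of (Y, X) *)
  gaussian_vector P X -> zero_mean P X -> has_covariance P X Sigma ->
  Sigma \in unitmx ->
  0 < sigma -> is_gaussian P eps 0 (sigma ^+ 2) -> independent2 P X eps ->
  (* the observations *)
  iid_replications P (response X eps theta) X bY bX ->
  (* the parameters theta_m and the estimators *)
  (forall m : {set 'I_p},
     is_argmin (model_space R m) (pred_risk P (response X eps theta) X)
       (theta_ m)) ->
  (forall m : {set 'I_p}, (#|m| < n)%N ->
     (forall j, measurable_fun [set: Omega] (fun w => thetahat m w j 0)) /\
     {ae P, forall w, is_argmin (model_space R m)
       (emp_risk (obs_response bY w) (obs_design bX w)) (thetahat m w)}) ->
  (* the selected model *)
  (forall m, m \in nested_collection p n./2 ->
     pen m = (1 - nu) * (#|m|%:R / (n%:R - #|m|%:R))) ->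
  (forall m : {set 'I_p}, measurable [set w | mhat w = m]) ->
  {ae P, forall w, is_argmin [set m | m \in nested_collection p n./2]
    (fun m => emp_risk (obs_response bY w) (obs_design bX w) (thetahat m w)
              * (1 + pen m))
    (mhat w)} ->
  n%:R / 2 <= p%:R :> R -> (n0 <= n)%N ->
  ((1 - delta)%:E <= P [set w | (n%:R / 4 <= #|mhat w|%:R :> R)%R])%E /\
  (loss P X (theta_ (nested_model p n./2)) theta + (L * sigma ^+ 2)%:E
   <= \int[P]_w loss P X (thetahat (mhat w) w) theta)%E.
Proof.
pose eta := nu / 40; have eta0 : 0 < eta by rewrite divr_gt0.
(* Q exceeds 50 / nu, so that the grid step n / Q is at most nu n / 50. *)
pose Q := (Num.Def.archi_bound (50 / nu)).+1.
(* The bound [delta] serves the dimension. The bound 1/4 serves the loss: with another 1/4 for the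
   scores, an event of probability at least 1/2 remains. *)
pose m0 := Num.min delta (1 / 4).
have m00 : 0 < m0 by rewrite lt_min hdelta0 divr_gt0.
(* The value of n from which the union bound (2 Q + 2) 560 / (eta^2 n) is at most [m0]. *)
pose x0 := (2 * Q).+2%:R * 560 / (eta ^+ 2 * m0).
have x00 : 0 <= x0.
  apply: divr_ge0; first by apply: mulr_ge0; exact: ler0n.
  by apply: mulr_ge0; [exact: sqr_ge0|exact: ltW].
(* The size 100 is for the arithmetic, Q makes the grid step positive, and the last bound is for the
   probabilities. The constant nu^2 / 200 is half of the nu^2 / 100 gained on an event of
   probability at least 1/2. *)
exists (maxn 100 (maxn Q (Num.Def.archi_bound x0))), (nu ^+ 2 / 200).
split; first by rewrite divr_gt0// exprn_gt0.
move=> n p Sigma theta sigma d T P X eps bY bX theta_ thetahat pen mhat.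
move=> gX zX cX uSigma sigma0 geps indXe iid theta_min hat_min penE mmhat mhat_min np.
rewrite !geq_max => /and3P[n100 nQ nx0].
have n0 : (0 < n)%N by exact: leq_trans n100.
have n0R : 0 < n%:R :> R by rewrite ltr0n.
pose N := n./2.
have Nle : (N <= n)%N by rewrite /N -{2}(odd_double_half n) -addnn addnA leq_addl.
have Nn : (N < n)%N by rewrite /N ltn_half_double -addnn -{1}(addn0 n) ltn_add2l.
have Np : (N <= p)%N.
  rewrite leq_half_double -(ler_nat R) (le_trans _ (_ : p.*2%:R <= _))//.
    by rewrite -muln2 natrM -ler_pdivrMr.
  by rewrite ler_nat.
pose g := (n %/ Q)%N.
have g0 : (0 < g)%N by rewrite divn_gt0.
have gn : g%:R <= nu / 50 * n%:R :> R.
  have h1 : g%:R * Q%:R <= n%:R :> R by rewrite -natrM ler_nat leq_trunc_div.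
  have h2 : 50 / nu < Q%:R.
    rewrite (lt_trans (archi_boundP _))// ?divr_ge0 ?ltW//.
    by rewrite ltr_nat.
  have h3 : g%:R * (50 / nu) <= n%:R by apply: le_trans h1; rewrite ler_wpM2l// ltW.
  by rewrite -ler_pdivrMl ?divr_gt0// invf_div mulrC.
(* Euclidean division gives n < (g + 1) Q, and g is at least 1. *)
have Qg : (n <= 2 * Q * g)%N.
  have := ltn_ceil n (isT : (0 < Q)%N); rewrite -/g => h.
  apply: leq_trans (ltnW h) _; rewrite mulSn mulnC -mulnA mul2n -addnn leq_add2r.
  by rewrite leq_pmulr.
have mX : measurable_fun [set: T] X := measurable_funPT X.
have meps : measurable_fun [set: T] eps := measurable_funPT eps.
have mbY i : measurable_fun [set: T] (bY i) := measurable_funPT (bY i).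
have mbX i : measurable_fun [set: T] (bX i) := measurable_funPT (bX i).
have Sigma_sym := design_cov_sym mX gX zX cX.
have Sigma_pos := design_cov_pos mX gX zX cX uSigma.
have [c cp] := gram_schmidt Sigma_sym Sigma_pos (leqnn p).
pose V := obs_score sigma theta c bY bX.
pose tau j := ip Sigma theta (c j).
have stdV : forall a, standardized P (V a).
  exact: (obs_standardized mX gX zX cX meps sigma0 geps cp mbY mbX iid).
have indV := obs_independent mX gX zX cX meps sigma0 geps indXe cp iid.
have var0 k : 0 < noise_var p tau sigma k by exact: noise_var_gt0.
pose B := deviations V tau sigma N Q g eta.
have mB : measurable B by exact: measurable_deviations.
have PB : (P B <= m0%:E)%E.
  apply: (le_trans (deviations_measure stdV indV Q g n0 erefl Np eta0 var0)).
  rewrite lee_fin mulrA ler_pdivrMr ?mulr_gt0 ?exprn_gt0//.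
  have := lt_le_trans (archi_boundP x00) (_ : _ <= n%:R); rewrite ler_nat => /(_ nx0)/ltW.
  rewrite /x0 ler_pdivrMr ?mulr_gt0 ?exprn_gt0// => h; apply: (le_trans h).
  by rewrite le_eqVlt; apply/orP; left; apply/eqP; ring.
pose S := [set w | 4 * (n%:R * N%:R * noise_var p tau sigma N) <=
  \sum_(j < N) (\sum_i score V i j w * noise V tau sigma N w i 0) ^+ 2].
have N0R : 0 < N%:R :> R.
  by rewrite ltr0n; apply: leq_trans (half_leq n100); exact: isT.
have mS : measurable S.
  apply: measurable_ge; apply: measurable_sum => j; apply: measurable_funX.
  apply: measurable_sum => i; apply: measurable_funM.
    exact: (measurable_score stdV).
  exact: (measurable_noise stdV).
(* Markov's inequality at four times the bound n N s_N^2 on the mean. *)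
have PS : (P S <= (1 / 4)%:E)%E.
  have s0 : 0 < 4 * (n%:R * N%:R * noise_var p tau sigma N) by rewrite !mulr_gt0.
  apply: (le_trans (score_noise_moment stdV indV tau sigma Np s0)).
  rewrite lee_fin le_eqVlt; apply/orP; left; apply/eqP; field.
  by rewrite !gt_eqF.
pose th k w := thetahat (nested_model p k) w.
have ae_rank : {ae P, forall w, forall k, (k <= N)%N ->
    \det ((design V k w)^T *m design V k w) != 0}.
  apply: ae_foralln => k; have [kN|_] := leqP k N; last exact: aeW.
  exists [set w | \det ((design V k w)^T *m design V k w) = 0]; split.
  - by apply: measurable_eq_cst; exact: (measurable_gram_det stdV).
  - exact: (design_full_rank stdV indV (leq_trans kN Nle) (leq_trans kN Np)).
  - by move=> w /= h; apply/eqP; apply: contra_notT h.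
have ae_min : {ae P, forall w, forall k, (k <= N)%N ->
    is_argmin (model_space R (nested_model p k))
      (emp_risk (obs_response bY w) (obs_design bX w)) (th k w)}.
  apply: ae_foralln => k; have [kN|kN] := leqP k N; last exact: aeW.
  have [] := hat_min (nested_model p k).
    by rewrite card_nested_model ?(leq_trans kN)// (leq_ltn_trans kN).
  move=> _; apply: filterS => w h _; exact: h.
(* One measurable null set collects the failures of full rank, of the least squares property and of
   the selection rule. *)
have [A [mA PA Asub]] := filterI (filterI ae_rank ae_min) mhat_min.
pose F := ~` A.
have mF : measurable F by exact: measurableC.
have PF : P F = 1%E by rewrite [P F]probability_setC// PA sube0.
have good w : F w -> [/\ forall k, (k <= N)%N -> \det ((design V k w)^T *m design V k w) != 0,
    forall k, (k <= N)%N -> is_argmin (model_space R (nested_model p k))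
      (emp_risk (obs_response bY w) (obs_design bX w)) (th k w) &
    exists kh, [/\ (kh <= N)%N, mhat w = nested_model p kh &
      crit n nu (sqn (obs_response bY w - obs_design bX w *m th kh w)) kh <=
      crit n nu (sqn (obs_response bY w - obs_design bX w *m th N w)) N]].
  move=> Fw; have [[h1 h2] [/= h3 h4]] : ((forall k, (k <= N)%N -> \det ((design V k w)^T *m design V k w) != 0) /\
      (forall k, (k <= N)%N -> is_argmin (model_space R (nested_model p k))
      (emp_risk (obs_response bY w) (obs_design bX w)) (th k w))) /\
      is_argmin [set m | m \in nested_collection p N]
    (fun m => emp_risk (obs_response bY w) (obs_design bX w) (thetahat m w)
              * (1 + pen m)) (mhat w).
    by apply: contrapT => h; apply: Fw; exact: Asub.
  split=> //; move: h3 => /imsetP[kh _ mE]; exists kh; split => //.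
    by rewrite -ltnS.
  have := h4 (nested_model p N); rewrite mE => /(_ _).
  have khN : (kh <= N)%N by rewrite -ltnS.
  have inN k : (k <= N)%N -> nested_model p k \in nested_collection p N.
    by move=> kN; apply/imsetP; exists (inord k) => //; rewrite inordK.
  move=> /(_ (inN N (leqnn N))).
  rewrite !penE ?inN// !card_nested_model ?(leq_trans khN)//.
have conc w : ~ B w -> forall a, (a <= 2 * Q)%N ->
    `|sqn (resid_proj (design V (grid N g a) w) *m noise V tau sigma (grid N g a) w) -
      (n%:R - (grid N g a)%:R) * noise_var p tau sigma (grid N g a)| <
    nu / 40 * ((n%:R - (grid N g a)%:R) * noise_var p tau sigma (grid N g a)).
  move=> Bw a aQ; have a2 : (a < (2 * Q).+2)%N by rewrite ltnS leqW.
  have := deviations_small Bw a2.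
  by rewrite /deviation aQ /= => /negP; rewrite -ltNge.
have dim w : F w -> ~ B w -> n%:R / 4 <= #|mhat w|%:R :> R.
  move=> Fw Bw; have [h1 h2 [kh [khN -> h3]]] := good w Fw.
  rewrite card_nested_model ?(leq_trans khN)//.
  exact: (selected_dimension cp sigma0 hnu0 hnu1 n100 erefl Np g0 gn Qg h1 h2 (conc w Bw) khN h3).
(* This lower bound needs no deviation event, since the selected estimator always lies in the
   largest model. It prevents the complement of the good event from lowering the expectation below
   the approximation error. *)
have los w : F w -> ((noise_var p tau sigma N - sigma ^+ 2)%:E <=
    loss P X (thetahat (mhat w) w) theta)%E.
  move=> Fw; have [h1 h2 [kh [khN -> h3]]] := good w Fw.
  rewrite (loss_design mX gX zX cX) lee_fin -/(th kh w).
  have [/model_space_nested khb _] := h2 _ khN.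
  rewrite (loss_below Sigma_sym cp theta sigma Np (belowW khN khb)) lerDr.
  by apply: sumr_ge0 => j _; exact: sqr_ge0.
have losG w : F w -> ~ B w -> ~ S w ->
    ((noise_var p tau sigma N - sigma ^+ 2 + nu ^+ 2 / 100 * sigma ^+ 2)%:E <=
    loss P X (thetahat (mhat w) w) theta)%E.
  move=> Fw Bw Sw; have [h1 h2 [kh [khN -> h3]]] := good w Fw.
  rewrite (loss_design mX gX zX cX) lee_fin -/(th kh w).
  apply: (selected_loss Sigma_sym cp sigma0 hnu0 hnu1 n100 erefl Np Qg h1 h2 (conc w Bw) khN h3).
    have := deviations_small Bw (leqnn _).
    by rewrite /deviation ltnn /= => /negP; rewrite -ltNge.
  by move/negP: Sw; rewrite -ltNge => /ltW.
split.
  apply: (@le_trans _ _ (1 - m0)%:E).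
    by rewrite lee_fin lerD2l lerN2 ge_min lexx.
  apply: (le_trans (probability_avoid mA mB PA PB)).
  apply: le_measure; rewrite ?inE.
  - by apply: measurableC; exact: measurableU.
  (* The dimension event is a finite union of events on which the selected model is constant, hence
     measurable. *)
  - rewrite (_ : [set _ | _] = \bigcup_(m in [set m : {set 'I_p} | n%:R / 4 <= #|m|%:R :> R])
        [set w | mhat w = m]).
      by apply: fin_bigcup_measurable => [|m _]; [exact: finite_finset|exact: mmhat].
    by apply/seteqP; split => [w h|w [m h mE]]; [by exists (mhat w)|by rewrite -mE in h].
  - by move=> w /= h; apply: dim => h'; apply: h; [left|right].
(* The prediction risk is the loss plus sigma^2, so its minimizer has loss at most that of the
   truncated expansion of theta. *)
have lossN : (loss P X (theta_ (nested_model p N)) theta <=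
    (noise_var p tau sigma N - sigma ^+ 2)%:E)%E.
  have [u ub <-] := best_approximation Sigma_sym cp theta sigma Np.
  have [_ /(_ u (proj2 (model_space_nested N u) ub))] := theta_min (nested_model p N).
  rewrite !(pred_risk_design mX gX zX cX meps geps indXe) (loss_design mX gX zX cX).
  have ipN (a b : 'cV[R]_p) : ip Sigma (a - b) (a - b) = ip Sigma (b - a) (b - a).
    rewrite -(opprB b a) -(scaleN1r (b - a)) (ipZl Sigma) (ipC Sigma_sym) (ipZl Sigma).
    by rewrite mulrA mulrNN !mul1r.
  by rewrite !lee_fin lerD2r (ipN theta) (ipN theta u).
apply: (@le_trans _ _ (noise_var p tau sigma N - sigma ^+ 2 + nu ^+ 2 / 100 * sigma ^+ 2 / 2)%:E).
  rewrite [in leRHS]EFinD leeD// lee_fin le_eqVlt; apply/orP; left; apply/eqP.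
  by field.
have mBS : measurable (B `|` S) by exact: measurableU.
have PBS : (P (B `|` S) <= (1 / 4 + 1 / 4)%:E)%E.
  rewrite (le_trans (measureU2 P mB mS))// EFinD leeD// (le_trans PB)// lee_fin.
  by rewrite ge_min lexx orbT.
apply: (integral_two_levels_le mF (G := ~` (A `|` (B `|` S)))).
- by apply: measurableC; exact: measurableU.
- by rewrite subr_ge0; exact: noise_var_ge_sqr.
- by rewrite mulr_ge0 ?sqr_ge0// divr_ge0// sqr_ge0.
- by move=> w; rewrite (loss_design mX gX zX cX) lee_fin (design_cov_ge0 mX gX zX cX).
- exact: PF.
- apply: le_trans (probability_avoid mA mBS PA PBS); rewrite lee_fin; lra.
- by move=> w /= h h'; apply: h; left.
- exact: los.
- move=> w /= h; apply: losG => h'; apply: h; first by left.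
  + by right; left.
  + by right; right.
Qed.
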